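(* Let $F$ be a holomorphic skew-product, defined near the origin of $\mathbb C^2$, of the form $F(z,w)=(f(z),g_z(w))$ with $f(z)=\lambda z+O(z^2)$, $g_0(0)=0$ and $g_0'(0)=1$. Assume that $\lambda$ is a Brjuno number. (1) If $g_0(w)\equiv w$, then $F$ is holomorphically linearizable (at the origin). (2) If $g_0(w)=w+\sum_{m\ge k+1}g_{0,m}w^m$ with $g_{0,k+1}\neq0$ for some $k\ge1$, then for any integer $h\ge0$ there exists a local holomorphic change of coordinates near the origin conjugating $F$ to a map of the form $\widetilde F(z,w)=(\lambda z,\tilde g(z,w))$ satisfying $$\tilde g(z,w)=w+g_{0,k+1}w^{k+1}+\cdots+g_{0,k+h+1}w^{k+h+1}+\sum_{j\ge h}w^{k+j+2}\alpha_{k+j+2}(z),$$ where, for $j\ge h$, $\alpha_{k+j+2}(z)$ is a holomorphic function of $z$ (near $0$) such that $\alpha_{k+j+2}(0)=g_{0,k+j+2}$.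
   Context: A number $\lambda=e^{2\pi i\theta}$ with $\theta\in\mathbb R\setminus\mathbb Q$ is called a Brjuno number if $\sum_{k=0}^{\infty}\frac1{2^k}\log\frac1{\omega(2^{k+1})}<+\infty$, where $\omega(m)=\min_{2\le k\le m}|\lambda^k-\lambda|$ for $m\ge2$. Here $g_z(w)$ is holomorphic in $(z,w)$ near the origin, and $g_{0,m}$ denotes the coefficient of $w^m$ in the power series of $g_0$ at $0$. Holomorphically linearizable means conjugate to its linear part at the origin by a local holomorphic change of coordinates fixing the origin. *)

(* Defs.v *)
From Stdlib Require Export Reals QArith Qreals List.
From Coquelicot Require Export Coquelicot.

Open Scope R_scope.

(* The min over 2 <= i <= m is only meaningful for m >= 2. *)
Definition omega (lambda : C) (m : nat) : R :=
  fold_right Rmin (Cmod (lambda ^ 2 - lambda))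
    (map (fun i => Cmod (lambda ^ i - lambda)) (seq 2 (m - 1))).

(* The terms of the series are bounded below by [- ln 2 / 2 ^ i], so a sum
   [< +oo] is the same as convergence. *)
Definition Brjuno (lambda : C) : Prop :=
  exists theta : R,
    (forall q : Q, theta <> Q2R q) /\
    lambda = (cos (2 * PI * theta), sin (2 * PI * theta)) /\
    ex_series (fun i : nat => 1 / 2 ^ i * ln (1 / omega lambda (2 ^ (i + 1)))).

(* Complex Frechet differentiability at every point of a neighbourhood: the
   scalars are [C_AbsRing], so the differentials are C-linear. Germs are
   represented by total functions whose values away from the point are
   irrelevant. *)
Definition holomorphic_near {U V : NormedModule C_AbsRing}
    (f : U -> V) (x : U) : Prop :=
  locally x (fun y => ex_filterdiff f (locally y)).

Definition origin : C * C := (RtoC 0, RtoC 0).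

Definition local_inverses (Phi Psi : C * C -> C * C) : Prop :=
  Phi origin = origin /\ Psi origin = origin /\
  locally origin (fun p => Psi (Phi p) = p) /\
  locally origin (fun p => Phi (Psi p) = p).

Definition local_coordinates (Phi : C * C -> C * C) : Prop :=
  holomorphic_near Phi origin /\
  exists Psi : C * C -> C * C,
    holomorphic_near Psi origin /\ local_inverses Phi Psi.

Definition locally_conjugate (F G : C * C -> C * C) : Prop :=
  exists Phi : C * C -> C * C,
    local_coordinates Phi /\ locally origin (fun p => Phi (F p) = G (Phi p)).

Definition linearizable (F : C * C -> C * C) : Prop :=
  exists L : C * C -> C * C,
    filterdiff (K := C_AbsRing) F (locally origin) L /\ locally_conjugate F L.

Definition skew_product (f : C -> C) (g : C -> C -> C) (p : C * C) : C * C :=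
  (f (fst p), g (fst p) (snd p)).

Definition power_series_at_0 (f : C -> C) (a : nat -> C) : Prop :=
  locally (RtoC 0) (fun w =>
    is_pseries (K := C_AbsRing) (V := C_NormedModule) a w (f w)).

(* Main.v *)
Require Import Defs.
From Stdlib Require Import Lra Lia Psatz Classical ClassicalEpsilon.
From Stdlib Require Import ssreflect.

(** Conjugating equations are solved by power series. Davie's refinement of the Brjuno condition
    gives a superadditive [K] with [K n <= B n] and [exp (K n - K (n+1)) <= |sigma (n+1)|], where
    [sigma n] is the divisor [k1 mu^n + k2]. Hence [exp (- K n) r^n] is a submultiplicative weight,
    and in the corresponding weighted l^1 algebra of series in [z, w], dividing the coefficients of
    [z h(z, w + x)] by the [sigma n] is bounded: the factor [z] pays for the divisor. So the formal
    solution of [k1 x(mu z, w) + k2 x(z, w) = z h(z, w + x(z, w))] stays in a small ball of the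
    algebra, without any counting of trees. Complex differentiability is turned into power series by
    Cauchy's formula, obtained from Goursat's bisection along the homotopy from a circle to a point.

    Solving for [phi = z (1 + y)] linearises [f]. If [g_0] is the identity, a shear [w + v(z, w)]
    conjugates [F] to [(lambda z, w)], and this to the differential [(lambda z, w + c z)] since
    [lambda <> 1]. In general, successive shears [w + beta(z) w^m] make the m-jet of
    the fibre maps independent of [z]; the equation for [beta] is that of an invariant curve for
    [m = 0], multiplicative for [m = 1] and additive for [m >= 2]. *)

(** All equations are written for the map going from the normal form to the given one: in
    [f (phi z) = phi (lambda z)] the unknown is composed, on one side, only with the rotation, which
    multiplies its [n]-th coefficient by [lambda^n]. That side is diagonal, and the nonlinear side
    carries no small divisors. The obstacle is that solving for coefficients multiplies divisors
    over and over, so that bounding each of them separately gives no positive radius. The inequality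
    [K m + K n <= K (m + n)] makes products of series free of charge, each division is paid by one
    step from [n] to [n + 1], and [K n <= B n], which expresses the finiteness of the Brjuno sum,
    leaves a positive radius in [z]. The variable [w] is a parameter in which no divisor occurs,
    hence its ordinary weight [rho^l]. With constant divisors the same result is an analytic
    implicit function theorem, which inverts the changes of coordinates. *)

(* In goals coming from Coquelicot the carrier is hidden behind a structure, where [ring] fails. *)
Ltac cring := match goal with |- @eq _ ?a ?b => change (@eq C a b); apply (eq_trans (eq_sym (Cplus_0_r a))); ring end.
Ltac rring := match goal with |- @eq _ ?a ?b => change (@eq R a b); apply (eq_trans (eq_sym (Rplus_0_r a))); ring end.

(** * Finite sums and series of complex numbers *)

Lemma csum_S (a : nat -> C) n : sum_n a (S n) = (sum_n a n + a (S n))%C.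
Proof. exact: sum_Sn. Qed.
Lemma rsum_S (a : nat -> R) n : sum_n a (S n) = sum_n a n + a (S n).
Proof. exact: sum_Sn. Qed.
Lemma csum_plus (a b : nat -> C) n :
  sum_n (fun k => (a k + b k)%C) n = (sum_n a n + sum_n b n)%C.
Proof. exact: sum_n_plus. Qed.
Lemma csum_scal (c : C) (a : nat -> C) n :
  sum_n (fun k => (c * a k)%C) n = (c * sum_n a n)%C.
Proof. exact: (sum_n_mult_l (K := C_Ring)). Qed.
Lemma rsum_plus (a b : nat -> R) n :
  sum_n (fun k => a k + b k) n = sum_n a n + sum_n b n.
Proof. exact: sum_n_plus. Qed.
Lemma rsum_scal (c : R) (a : nat -> R) n :
  sum_n (fun k => c * a k) n = c * sum_n a n.
Proof. exact: (sum_n_mult_l (K := R_Ring)). Qed.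
Lemma csum_opp (a : nat -> C) n :
  sum_n (fun k => (- a k)%C) n = (- sum_n a n)%C.
Proof.
elim: n => [|n IH]; first by rewrite !sum_O.
rewrite !csum_S IH; cring.
Qed.
Lemma csum_minus (a b : nat -> C) n :
  sum_n (fun k => (a k - b k)%C) n = (sum_n a n - sum_n b n)%C.
Proof. by rewrite csum_plus csum_opp. Qed.

Lemma rsum_le (a b : nat -> R) n :
  (forall k, (k <= n)%nat -> a k <= b k) -> sum_n a n <= sum_n b n.
Proof.
elim: n => [|n IH] H; first by rewrite !sum_O; apply: H.
rewrite !rsum_S; apply: Rplus_le_compat; last by apply: H.
by apply: IH => k kn; apply: H; lia.
Qed.
Lemma rsum_ge0 (a : nat -> R) n :
  (forall k, (k <= n)%nat -> 0 <= a k) -> 0 <= sum_n a n.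
Proof.
move=> H; have := rsum_le (fun _ => 0) a n H.
by rewrite sum_n_const Rmult_0_r.
Qed.
Lemma rsum_mono (a : nat -> R) n m :
  (n <= m)%nat -> (forall k, 0 <= a k) -> sum_n a n <= sum_n a m.
Proof.
move=> nm H; elim: nm => [|m' _ IH]; first by lra.
rewrite rsum_S; have := H (S m'); lra.
Qed.
Lemma csum_Cmod (a : nat -> C) n :
  Cmod (sum_n a n) <= sum_n (fun k => Cmod (a k)) n.
Proof.
elim: n => [|n IH]; first by rewrite !sum_O; lra.
rewrite csum_S rsum_S; apply: Rle_trans (Cmod_triangle _ _) _; lra.
Qed.
Lemma csum_zero (a : nat -> C) n :
  (forall k, (k <= n)%nat -> a k = RtoC 0) -> sum_n a n = RtoC 0.
Proof.
elim: n => [|n IH] H; first by rewrite sum_O H.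
rewrite csum_S IH; last by move=> k kn; apply: H; lia.
rewrite H //; cring.
Qed.

Lemma Cmod_sub_le0 (x y : C) : Cmod (x - y) <= 0 -> x = y.
Proof.
move=> h; have /Cmod_eq_0 E : Cmod (x - y) = 0 by have := Cmod_ge_0 (x - y); lra.
have -> : x = (x - y + y)%C by ring. rewrite E; ring.
Qed.
Lemma Cmod_sub_sym (x y : C) : Cmod (x - y) = Cmod (y - x).
Proof. by rewrite -Cmod_opp; congr Cmod; ring. Qed.
Lemma Cmod_sub_triangle (y x z : C) : Cmod (x - z) <= Cmod (x - y) + Cmod (y - z).
Proof.
have -> : (x - z = (x - y) + (y - z))%C by ring.
exact: Cmod_triangle.
Qed.

Lemma sum_geom_le (x : R) n : 0 <= x <= 1/2 -> sum_n (fun k => x ^ k) n <= 2.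
Proof.
move=> Hx.
have E : sum_n (fun k => x ^ k) n * (1 - x) = 1 - x ^ S n.
  elim: n => [|n IH]; first by rewrite sum_O /=; rring.
  rewrite rsum_S Rmult_plus_distr_r IH /=; rring.
have P : 0 <= x ^ S n by apply: pow_le; lra.
have P2 : 0 <= sum_n (fun k => x ^ k) n.
  by apply: rsum_ge0 => k _; apply: pow_le; lra.
nra.
Qed.

Notation serC a S := (is_series (K := C_AbsRing) (V := C_NormedModule) a S).

Lemma serC_eps (a : nat -> C) (S : C) :
  serC a S <-> forall eps, 0 < eps ->
     exists N, forall n, (N <= n)%nat -> Cmod (sum_n a n - S) < eps.
Proof.
split.
- move=> H eps He.
  have := H _ (locally_ball_norm (V := C_NormedModule) S (mkposreal _ He)).
  case=> N HN; exists N => n Hn; exact: HN n Hn.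
- move=> H P [eps HP].
  case: (H eps (cond_pos eps)) => N HN; exists N => n Hn; apply: HP.
  apply: C_NormedModule_mixin_compat1; exact: HN.
Qed.

Lemma serC_unique (a : nat -> C) (S T : C) : serC a S -> serC a T -> S = T.
Proof.
move=> /serC_eps HS /serC_eps HT.
apply: Cmod_sub_le0; apply: le_epsilon => eps He; have He2 : 0 < eps / 2 by lra.
case: (HS _ He2) => N1 H1; case: (HT _ He2) => N2 H2.
have := H1 (N1 + N2)%nat ltac:(lia); have := H2 (N1 + N2)%nat ltac:(lia).
have := Cmod_sub_triangle (sum_n a (N1 + N2)) S T; rewrite (Cmod_sub_sym S (sum_n a (N1 + N2))); lra.
Qed.

Lemma serC_le (a : nat -> C) (S : C) c :
  serC a S -> (forall n, Cmod (sum_n a n) <= c) -> Cmod S <= c.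
Proof.
move/serC_eps => H Hc; apply: le_epsilon => eps He.
case: (H eps He) => N HN; have := HN N (le_n _); have := Hc N.
have := Cmod_triangle (sum_n a N) (- (sum_n a N - S))%C.
rewrite Cmod_opp (_ : (sum_n a N + - (sum_n a N - S) = S)%C); last ring.
lra.
Qed.

Lemma ex_series_bounded (a : nat -> R) c :
  (forall n, 0 <= a n) -> (forall n, sum_n a n <= c) -> ex_series a.
Proof.
move=> Ha Hc.
have Hi : ex_finite_lim_seq (sum_n a).
  apply: (ex_finite_lim_seq_incr _ c) => // n.
  rewrite rsum_S; have := Ha (S n); lra.
case: Hi => l Hl; exists l; exact: Hl.
Qed.

Lemma serC_ex (a : nat -> C) c :
  (forall n, sum_n (fun k => Cmod (a k)) n <= c) ->
  exists S, serC a S /\ Cmod S <= c.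
Proof.
move=> H.
have [S HS] : ex_series (K := C_AbsRing) (V := C_CompleteNormedModule) a.
  apply: (ex_series_le (K := C_AbsRing) (V := C_CompleteNormedModule) a
            (fun k => Cmod (a k))) => [n|].
    change (Cmod (a n) <= Cmod (a n)); exact: Rle_refl.
  by apply: (ex_series_bounded _ c) => // n; apply: Cmod_ge_0.
exists S; split=> //; apply: (serC_le a) => // n.
by apply: Rle_trans (csum_Cmod _ _) _.
Qed.

Lemma serC_plus (a b : nat -> C) (S T : C) :
  serC a S -> serC b T -> serC (fun n => (a n + b n)%C) (S + T)%C.
Proof. exact: is_series_plus. Qed.
Lemma serC_scal (c : C) (a : nat -> C) (S : C) :
  serC a S -> serC (fun n => (c * a n)%C) (c * S)%C.
Proof. exact: (is_series_scal (K := C_AbsRing) (V := C_NormedModule)). Qed.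
Lemma serC_ext (a b : nat -> C) (S : C) :
  (forall n, a n = b n) -> serC a S -> serC b S.
Proof. exact: is_series_ext. Qed.
Lemma serC_zero : serC (fun _ => RtoC 0) (RtoC 0).
Proof.
apply/serC_eps => eps He; exists 0%nat => n _.
rewrite csum_zero //.
by rewrite (_ : (0 - 0 = 0)%C) ?Cmod_0 //; ring.
Qed.
Lemma serC_sum (a : nat -> nat -> C) (S : nat -> C) m :
  (forall k, (k <= m)%nat -> serC (a k) (S k)) ->
  serC (fun n => sum_n (fun k => a k n) m) (sum_n S m).
Proof.
elim: m => [|m IH] H.
  rewrite sum_O; apply: serC_ext (H 0%nat _) => // n; by rewrite sum_O.
rewrite csum_S.
apply: serC_ext (serC_plus _ _ _ _ (IH _) (H (Datatypes.S m) _)) => // [n|k km].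
  by rewrite csum_S.
by apply: H; lia.
Qed.

Definition conv (a b : nat -> C) (n : nat) : C :=
  sum_n (fun k => (a k * b (n - k)%nat)%C) n.

Lemma fst_csum (a : nat -> C) n : fst (sum_n a n) = sum_n (fun k => fst (a k)) n.
Proof. elim: n => [|n IH]; first by rewrite !sum_O. by rewrite csum_S rsum_S -IH. Qed.
Lemma snd_csum (a : nat -> C) n : snd (sum_n a n) = sum_n (fun k => snd (a k)) n.
Proof. elim: n => [|n IH]; first by rewrite !sum_O. by rewrite csum_S rsum_S -IH. Qed.

Lemma serR_eps (a : nat -> R) (S : R) :
  is_series a S <-> forall eps, 0 < eps ->
     exists N, forall n, (N <= n)%nat -> Rabs (sum_n a n - S) < eps.
Proof.
split.
- move=> H eps He.
  have := H _ (locally_ball S (mkposreal _ He)).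
  case=> N HN; exists N => n Hn; exact: HN n Hn.
- move=> H P [eps HP].
  case: (H eps (cond_pos eps)) => N HN; exists N => n Hn; apply: HP.
  exact: HN.
Qed.

Lemma im_le_Cmod (c : C) : Rabs (snd c) <= Cmod c.
Proof. apply: Rle_trans (Rmax_Cmod c); exact: Rmax_r. Qed.
Lemma Cmod_le_abs (c : C) : Cmod c <= Rabs (fst c) + Rabs (snd c).
Proof.
have {1}-> : c = (RtoC (fst c) + Ci * RtoC (snd c))%C.
  by apply: injective_projections => /=; ring.
apply: Rle_trans (Cmod_triangle _ _) _.
rewrite Cmod_mult Cmod_Ci !Cmod_R /=; apply: Req_le.
by congr (_ + _); rewrite ?Rmult_1_l; congr Rabs; ring.
Qed.

Lemma serC_comp (a : nat -> C) (S : C) :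
  serC a S <-> is_series (fun n => fst (a n)) (fst S) /\
               is_series (fun n => snd (a n)) (snd S).
Proof.
split.
- move/serC_eps => H; split; apply/serR_eps => eps He;
  case: (H eps He) => N HN; exists N => n Hn;
  apply: Rle_lt_trans (HN n Hn).
  + by rewrite -fst_csum; apply: (re_le_Cmod (sum_n a n - S)%C).
  + by rewrite -snd_csum; apply: (im_le_Cmod (sum_n a n - S)%C).
- case=> /serR_eps H1 /serR_eps H2; apply/serC_eps => eps He.
  have He2 : 0 < eps / 2 by lra.
  case: (H1 _ He2) => N1 HN1; case: (H2 _ He2) => N2 HN2.
  exists (N1 + N2)%nat => n Hn.
  apply: Rle_lt_trans (Cmod_le_abs _) _.
  have /HN1 : (N1 <= n)%nat by lia.
  have /HN2 : (N2 <= n)%nat by lia.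
  rewrite -fst_csum -snd_csum /= /Rminus; lra.
Qed.

(** Reduced to Cauchy products of absolutely convergent real series: the real part of a complex
    product is a difference of two of them, the imaginary part a sum. *)
Lemma conv_series (a b : nat -> C) (S T : C) c d :
  (forall n, sum_n (fun k => Cmod (a k)) n <= c) ->
  (forall n, sum_n (fun k => Cmod (b k)) n <= d) ->
  serC a S -> serC b T -> serC (conv a b) (S * T)%C.
Proof.
have X (u : nat -> C) e (p : C -> R) : (forall z, Rabs (p z) <= Cmod z) ->
   (forall n, sum_n (fun k => Cmod (u k)) n <= e) ->
   ex_series (fun n => Rabs (p (u n))).
  move=> Hp H; apply: (ex_series_bounded _ e) => n; first exact: Rabs_pos.
  by apply: Rle_trans (H n); apply: rsum_le.
move=> /[dup] /(X _ _ _ re_le_Cmod) A1 /(X _ _ _ im_le_Cmod) A2.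
move=> /[dup] /(X _ _ _ re_le_Cmod) B1 /(X _ _ _ im_le_Cmod) B2.
move=> /serC_comp [HS1 HS2] /serC_comp [HT1 HT2].
apply/serC_comp; split.
- have := is_series_minus _ _ _ _ (is_series_mult _ _ _ _ HS1 HT1 A1 B1)
     (is_series_mult _ _ _ _ HS2 HT2 A2 B2).
  apply: is_series_ext => n; rewrite -!sum_n_Reals /conv fst_csum.
  transitivity (sum_n (fun k => fst (a k) * fst (b (n - k)%nat)
     + (-1) * (snd (a k) * snd (b (n - k)%nat))) n).
    rewrite rsum_plus rsum_scal /minus /plus /opp /=; rring.
  apply: sum_n_ext => k /=; rring.
- have := is_series_plus _ _ _ _ (is_series_mult _ _ _ _ HS1 HT2 A1 B2)
     (is_series_mult _ _ _ _ HS2 HT1 A2 B1).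
  apply: is_series_ext => n; rewrite -!sum_n_Reals /conv snd_csum.
  by rewrite -sum_n_plus.
Qed.

(** * Double series *)

(** An iterated sum, over [l] inside each row and then over [n]. It is not visibly symmetric in the
    two indices. Absolute convergence is expressed by [abs_bound], which only mentions finite
    rectangles. *)
Definition is_dseries (A : nat -> nat -> C) (S : C) : Prop :=
  exists al : nat -> C, (forall n, serC (A n) (al n)) /\ serC al S.
Definition abs_bound (A : nat -> nat -> C) (c : R) : Prop :=
  forall N L, sum_n (fun n => sum_n (fun l => Cmod (A n l)) L) N <= c.

Lemma abs_bound_row A c n L : abs_bound A c -> sum_n (fun l => Cmod (A n l)) L <= c.
Proof.
move=> H; apply: Rle_trans (H n L).
case: n => [|n]; first by rewrite sum_O; apply: Rle_refl.
rewrite rsum_S.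
have : 0 <= sum_n (fun n => sum_n (fun l => Cmod (A n l)) L) n.
  by apply: rsum_ge0 => k _; apply: rsum_ge0 => l _; apply: Cmod_ge_0.
lra.
Qed.

(** Each of the finitely many row sums is within [eps / (N + 1)] of its partial sums from some index
    on; a common large [L] brings all of them under the bound for one finite rectangle. *)
Lemma abs_bound_rows A c al : abs_bound A c -> (forall n, serC (A n) (al n)) ->
  forall N, sum_n (fun n => Cmod (al n)) N <= c.
Proof.
move=> H Hal N.
apply: le_epsilon => eps He.
have HN : 0 < INR N + 1 by have := pos_INR N; lra.
have He' : 0 < eps / (INR N + 1) by apply: Rdiv_lt_0_compat.
have X : forall M, exists L0, forall L, (L0 <= L)%nat -> 
    sum_n (fun n => Cmod (al n)) M <= sum_n (fun n => sum_n (fun l => Cmod (A n l)) L) M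
       + (INR M + 1) * (eps / (INR N + 1)).
  have Y : forall n, exists L0, forall L, (L0 <= L)%nat -> 
      Cmod (al n) <= sum_n (fun l => Cmod (A n l)) L + eps / (INR N + 1).
    move=> n; have := Hal n; move/serC_eps/(_ _ He') => [L0 HL]; exists L0 => L /HL.
    have := Cmod_triangle (sum_n (A n) L) (- (sum_n (A n) L - al n))%C.
    rewrite Cmod_opp.
    have -> : (sum_n (A n) L + - (sum_n (A n) L - al n) = al n)%C by ring.
    have := csum_Cmod (A n) L; lra.
  elim=> [|M [L1 H1]].
    case: (Y 0%nat) => L0 HL; exists L0 => L /HL; rewrite !sum_O /=; lra.
  case: (Y (S M)) => L2 H2; exists (L1 + L2)%nat => L HL.
  rewrite !rsum_S S_INR.
  have := H1 L ltac:(lia); have := H2 L ltac:(lia); lra.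
case: (X N) => L0 /(_ L0 (le_n _)) HL; have := H N L0.
have E : (INR N + 1) * (eps / (INR N + 1)) = eps by field; lra.
rewrite E in HL; lra.
Qed.

Lemma ds_ex A c : abs_bound A c -> exists S, is_dseries A S /\ Cmod S <= c.
Proof.
move=> H.
have Y n : exists a, serC (A n) a.
  case: (serC_ex (A n) c) => [L|a [Ha _]]; [exact: abs_bound_row|by exists a].
have [al Hal] : exists al, forall n, serC (A n) (al n).
  exists (fun n => proj1_sig (constructive_indefinite_description _ (Y n))).
  by move=> n; case: constructive_indefinite_description.
case: (serC_ex al c) => [|S [HS Hc]]; first exact: abs_bound_rows.
by exists S; split=> //; exists al.
Qed.

Lemma ds_unique A S T : is_dseries A S -> is_dseries A T -> S = T.
Proof.
case=> a [Ha HS] [b [Hb HT]].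
apply: serC_unique HS _; apply: serC_ext HT => n; exact: serC_unique (Hb n) (Ha n).
Qed.

Lemma ds_ext A B S : (forall n l, A n l = B n l) -> is_dseries A S -> is_dseries B S.
Proof.
move=> E [a [Ha HS]]; exists a; split=> // n; apply: serC_ext (Ha n) => l; exact: E.
Qed.

Lemma ds_le A c S : abs_bound A c -> is_dseries A S -> Cmod S <= c.
Proof.
by move=> /ds_ex [T [HT Hc]] HS; rewrite (ds_unique _ _ _ HS HT).
Qed.

Lemma ds_plus A B S T : is_dseries A S -> is_dseries B T ->
  is_dseries (fun n l => (A n l + B n l)%C) (S + T)%C.
Proof.
case=> a [Ha HS] [b [Hb HT]]; exists (fun n => (a n + b n)%C); split.
  by move=> n; apply: serC_plus.
exact: serC_plus.
Qed.

Lemma ds_scal (c : C) A S : is_dseries A S -> is_dseries (fun n l => (c * A n l)%C) (c * S)%C.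
Proof.
case=> a [Ha HS]; exists (fun n => (c * a n)%C); split.
  by move=> n; apply: serC_scal.
exact: serC_scal.
Qed.

Lemma ds_minus A B S T : is_dseries A S -> is_dseries B T ->
  is_dseries (fun n l => (A n l - B n l)%C) (S - T)%C.
Proof.
move=> HA /(ds_scal (- 1)%C) HB.
have -> : (S - T = S + - 1 * T)%C by ring.
apply: ds_ext (ds_plus _ _ _ _ HA HB) => n l; ring.
Qed.

Lemma ds_sum (A : nat -> nat -> nat -> C) (S : nat -> C) m :
  (forall k, (k <= m)%nat -> is_dseries (A k) (S k)) ->
  is_dseries (fun n l => sum_n (fun k => A k n l) m) (sum_n S m).
Proof.
elim: m => [|m IH] H.
  rewrite sum_O; apply: ds_ext (H 0%nat _) => // n l; by rewrite sum_O.
rewrite csum_S.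
apply: ds_ext (ds_plus _ _ _ _ (IH _) (H (Datatypes.S m) _)) => // [n l|k km].
  by rewrite csum_S.
by apply: H; lia.
Qed.

Lemma ds_shift A S : is_dseries A S ->
  is_dseries (fun n l => match n with O => RtoC 0 | Datatypes.S n => A n l end) S.
Proof.
case=> a [Ha HS]; exists (fun n => match n with O => RtoC 0 | Datatypes.S n => a n end).
split; first by case=> //; exact: serC_zero.
apply: is_series_decr_1; rewrite /plus /opp /=.
by have -> : (S + - 0 = S)%C by ring.
Qed.

Definition conv2 (a b : nat -> nat -> C) (n l : nat) : C :=
  sum_n (fun k => conv (a k) (b (n - k)%nat) l) n.

(** The one-variable Cauchy product is applied twice: to the rows, then to the sequences of row
    sums. *)
Lemma conv2_ds A B c d S T : abs_bound A c -> abs_bound B d -> is_dseries A S -> is_dseries B T ->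
  is_dseries (conv2 A B) (S * T)%C.
Proof.
move=> Ac Bd [a [Ha HS]] [b [Hb HT]].
exists (conv a b); split.
- move=> n; apply: serC_sum => k _.
  apply: conv_series (Ha k) (Hb (n - k)%nat); move=> L; [exact: abs_bound_row Ac|exact: abs_bound_row Bd].
- by apply: conv_series HS HT; [apply: abs_bound_rows Ac Ha|apply: abs_bound_rows Bd Hb].
Qed.

(** * Weighted norms of formal double series *)

(* A weighted l^1 norm bound; submultiplicativity of the weight makes it an algebra norm. *)
Definition wnorm_le (W : nat -> R) (rho : R) (a : nat -> nat -> C) (c : R) : Prop :=
  forall N L, sum_n (fun n => W n * sum_n (fun l => Cmod (a n l) * rho ^ l) L) N <= c.

Definition submult (W : nat -> R) : Prop :=
  (forall n, 0 <= W n) /\ (forall m n, W (m + n)%nat <= W m * W n).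

Lemma pow_submult rho : 0 <= rho -> submult (fun l => rho ^ l).
Proof.
move=> H; split=> [n|m n]; first exact: pow_le.
by rewrite pow_add; apply: Rle_refl.
Qed.

(** The triangle of index pairs lies in the square; the rest [D] of the square contributes a
    nonnegative amount. *)
Lemma conv_le1 (x y : nat -> R) N : (forall n, 0 <= x n) -> (forall n, 0 <= y n) ->
  sum_n (fun n => sum_n (fun k => x k * y (n - k)%nat) n) N <= sum_n x N * sum_n y N.
Proof.
move=> Hx Hy; rewrite !sum_n_Reals.
case: N => [|N]; first by rewrite /= sum_O; apply: Rle_refl.
rewrite cauchy_finite; last lia.
set A := sum_f_R0 _ _; set B := sum_f_R0 _ _; set D := sum_f_R0 _ _.
have -> : A = B.
  by rewrite /A /B; apply: sum_eq => i _; rewrite sum_n_Reals.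
have : 0 <= D; last lra.
rewrite /D; apply: cond_pos_sum => n; apply: cond_pos_sum => m.
exact: Rmult_le_pos.
Qed.

Lemma conv_leW (W x y : nat -> R) N : submult W ->
  (forall n, 0 <= x n) -> (forall n, 0 <= y n) ->
  sum_n (fun n => W n * sum_n (fun k => x k * y (n - k)%nat) n) N <=
  sum_n (fun n => W n * x n) N * sum_n (fun n => W n * y n) N.
Proof.
move=> [W0 WM] Hx Hy.
apply: Rle_trans (conv_le1 _ _ N _ _); first last.
- by move=> n; apply: Rmult_le_pos.
- by move=> n; apply: Rmult_le_pos.
apply: rsum_le => n _; rewrite -rsum_scal; apply: rsum_le => k kn.
have := WM k (n - k)%nat; rewrite (_ : (k + (n - k) = n)%nat); last lia.
have := Hx k; have := Hy (n - k)%nat => h1 h2.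
have h3 := Rmult_le_pos _ _ h2 h1.
move=> h; have := Rmult_le_compat_r _ _ _ h3 h; lra.
Qed.

Lemma wnorm_le_ge0 W rho a c : submult W -> 0 <= rho -> wnorm_le W rho a c -> 0 <= c.
Proof.
move=> [W0 _] Hr H; apply: Rle_trans (H 0%nat 0%nat); rewrite !sum_O.
by apply: Rmult_le_pos => //; apply: Rmult_le_pos; [apply: Cmod_ge_0|apply: pow_le].
Qed.

(** The estimate [conv_leW] is used twice: with weight [rho^l] inside the rows, whose norms are [x]
    and [y], and with weight [W] across the rows. *)
Lemma wnorm_le_conv2 W rho a b c d : submult W -> 0 <= rho ->
  wnorm_le W rho a c -> wnorm_le W rho b d -> wnorm_le W rho (conv2 a b) (c * d).
Proof.
move=> HW Hr Ha Hb N L.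
have W0 := proj1 HW.
pose x n := sum_n (fun l => Cmod (a n l) * rho ^ l) L.
pose y n := sum_n (fun l => Cmod (b n l) * rho ^ l) L.
have Hx n : 0 <= x n.
  by apply: rsum_ge0 => l _; apply: Rmult_le_pos; [apply: Cmod_ge_0|apply: pow_le].
have Hy n : 0 <= y n.
  by apply: rsum_ge0 => l _; apply: Rmult_le_pos; [apply: Cmod_ge_0|apply: pow_le].
apply: Rle_trans (_ : sum_n (fun n => W n * x n) N * sum_n (fun n => W n * y n) N <= _);
  last first.
  apply: Rmult_le_compat; [| |exact: Ha|exact: Hb];
  by apply: rsum_ge0 => n _; apply: Rmult_le_pos.
apply: Rle_trans (conv_leW W x y N HW Hx Hy).
apply: rsum_le => n _; apply: Rmult_le_compat_l => //.
apply: Rle_trans (_ : sum_n (fun l => sum_n (fun k => 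
   sum_n (fun j => Cmod (a k j) * Cmod (b (n - k)%nat (l - j)%nat)) l * rho ^ l) n) L <= _).
  apply: rsum_le => l _; rewrite /conv2.
  apply: Rle_trans (Rmult_le_compat_r _ _ _ (pow_le _ _ Hr) (csum_Cmod _ _)) _.
  rewrite Rmult_comm -rsum_scal; apply: rsum_le => k _.
  rewrite Rmult_comm; apply: Rmult_le_compat_r; first exact: pow_le.
  apply: Rle_trans (csum_Cmod _ _) _; apply: rsum_le => j _.
  by rewrite Cmod_mult; apply: Rle_refl.
rewrite sum_n_switch; apply: rsum_le => k _.
have := conv_leW (fun l => rho ^ l) (fun j => Cmod (a k j)) (fun j => Cmod (b (n-k)%nat j))
   L (pow_submult _ Hr) (fun j => Cmod_ge_0 _) (fun j => Cmod_ge_0 _).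
rewrite /x /y => H; apply: Rle_trans (Rle_trans _ _ _ _ H) _; apply: Req_le.
- apply: sum_n_ext => l; rring.
- congr Rmult; apply: sum_n_ext => l; rring.
Qed.

Lemma wnorm_le_plus W rho a b c d : wnorm_le W rho a c -> wnorm_le W rho b d ->
  submult W -> 0 <= rho ->
  wnorm_le W rho (fun n l => (a n l + b n l)%C) (c + d).
Proof.
move=> Ha Hb [W0 _] Hr N L.
apply: Rle_trans (Rplus_le_compat _ _ _ _ (Ha N L) (Hb N L)).
rewrite -rsum_plus; apply: rsum_le => n _.
rewrite -Rmult_plus_distr_l -rsum_plus; apply: Rmult_le_compat_l => //.
apply: rsum_le => l _; rewrite -Rmult_plus_distr_r.
by apply: Rmult_le_compat_r; [apply: pow_le|apply: Cmod_triangle].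
Qed.

Definition one2 (n l : nat) : C :=
  match n, l with O, O => 1 | _, _ => 0 end.
Definition zvar (n l : nat) : C :=
  match n, l with S O, O => 1 | _, _ => 0 end.
Definition wvar (n l : nat) : C :=
  match n, l with O, S O => 1 | _, _ => 0 end.

Fixpoint pow2 (q : nat -> nat -> C) (j : nat) : nat -> nat -> C :=
  match j with O => one2 | S j => conv2 q (pow2 q j) end.

Lemma sum_single (x : nat -> R) m N : (forall n, n <> m -> x n = 0) -> 0 <= x m ->
  sum_n x N <= x m.
Proof.
move=> H Hm.
have : sum_n x N <= x m /\ ((N < m)%nat -> sum_n x N = 0); last by case.
elim: N => [|N [IH1 IH2]].
  rewrite !sum_O; case: (Nat.eq_dec 0 m) => [<-|hm]; first by split; [lra|lia].
  by rewrite H //; split.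
rewrite rsum_S; case: (Nat.eq_dec (S N) m) => [e|hm].
  subst m; by rewrite IH2; [split; [rewrite Rplus_0_l; exact: Rle_refl|lia]|lia].
rewrite (H (S N)) // Rplus_0_r; split=> // h; apply: IH2; lia.
Qed.

Lemma wnorm_le_single W rho a m p : submult W -> 0 <= rho ->
  (forall n l, (n, l) <> (m, p) -> a n l = RtoC 0) ->
  wnorm_le W rho a (W m * (Cmod (a m p) * rho ^ p)).
Proof.
move=> [W0 _] Hr H N L.
have Hp : 0 <= Cmod (a m p) * rho ^ p.
  by apply: Rmult_le_pos; [apply: Cmod_ge_0|apply: pow_le].
apply: Rle_trans (sum_single _ m N _ _) _.
- move=> n nm; rewrite (_ : sum_n _ _ = 0) ?Rmult_0_r //.
  rewrite (sum_n_ext _ (fun _ => 0)); first by rewrite sum_n_const; rring.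
  by move=> l; rewrite H ?Cmod_0 ?Rmult_0_l //; case.
- by apply: Rmult_le_pos => //; apply: rsum_ge0 => l _; apply: Rmult_le_pos; [apply: Cmod_ge_0|apply: pow_le].
apply: Rmult_le_compat_l => //.
apply: (sum_single (fun l => Cmod (a m l) * rho ^ l)) => // l lp.
by rewrite H ?Cmod_0 ?Rmult_0_l //; case.
Qed.

Lemma wnorm_le_pow2 W rho q c j : submult W -> 0 <= rho -> W 0%nat <= 1 ->
  wnorm_le W rho q c -> wnorm_le W rho (pow2 q j) (c ^ j).
Proof.
move=> HW Hr HW0 Hq; elim: j => [|j IH] /=; last exact: wnorm_le_conv2.
move=> N L; apply: Rle_trans (wnorm_le_single W rho one2 0 0 HW Hr _ N L) _.
  by case=> [|n] [|l].
rewrite /= Cmod_1; lra.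
Qed.

(** * Order and substitution of formal series *)

Definition val_ge (a : nat -> nat -> C) (d : nat) : Prop :=
  forall n l, (n + l < d)%nat -> a n l = RtoC 0.
(** Equality modulo total degree [d]: the adic topology in which the formal fixed point is
    reached. *)
Definition agree (d : nat) (a b : nat -> nat -> C) : Prop :=
  forall n l, (n + l < d)%nat -> a n l = b n l.

Lemma val_conv2 a b d e : val_ge a d -> val_ge b e -> val_ge (conv2 a b) (d + e).
Proof.
move=> Ha Hb n l nl; apply: csum_zero => k kn; apply: csum_zero => j jl.
case: (Compare_dec.le_lt_dec d (k + j)) => h.
  rewrite (Hb (n - k)%nat (l - j)%nat); last lia. cring.
rewrite Ha //; cring.
Qed.
Lemma val_pow2 q d j : val_ge q d -> val_ge (pow2 q j) (j * d).
Proof.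
move=> H; elim: j => [|j IH] /=; first by move=> n l; lia.
exact: val_conv2.
Qed.
Lemma agree_conv2 d a a' b b' : agree d a a' -> agree d b b' ->
  agree d (conv2 a b) (conv2 a' b').
Proof.
move=> Ha Hb n l nl; apply: sum_n_ext_loc => k kn; apply: sum_n_ext_loc => j jl.
by rewrite Ha ?Hb //; lia.
Qed.
Lemma agree_pow2 d q q' j : agree d q q' -> agree d (pow2 q j) (pow2 q' j).
Proof.
move=> H; elim: j => [|j IH] /=; first by move=> n l.
exact: agree_conv2.
Qed.

(** Formal substitution [c (p, q)]. Cutting the sums at total degree [n + l] loses nothing when [p]
    and [q] have no constant term, because [p^i q^j] then starts in degree [i + j]; see
    [comp_trunc]. *)
Definition comp (c p q : nat -> nat -> C) (n l : nat) : C :=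
  sum_n (fun i => sum_n (fun j => (c i j * conv2 (pow2 p i) (pow2 q j) n l)%C)
    (n + l)) (n + l).

Lemma agree_comp d c p q q' : agree d q q' -> agree d (comp c p q) (comp c p q').
Proof.
move=> H n l nl; apply: sum_n_ext => i; apply: sum_n_ext => j.
congr Cmult; apply: agree_conv2 nl => //; exact: agree_pow2.
Qed.

Lemma csum_trunc (a : nat -> C) m J : (m <= J)%nat ->
  (forall k, (m < k)%nat -> a k = RtoC 0) -> sum_n a m = sum_n a J.
Proof.
move=> mJ H; elim: mJ => [//|J' mJ' IH].
rewrite csum_S -IH H; last lia. cring.
Qed.

Lemma comp_trunc c p q n l J : val_ge p 1 -> val_ge q 1 -> (n + l <= J)%nat ->
  comp c p q n l = 
  sum_n (fun i => sum_n (fun j => (c i j * conv2 (pow2 p i) (pow2 q j) n l)%C) J) J.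
Proof.
move=> Hp Hq HJ.
have Z i j : (n + l < i + j)%nat -> conv2 (pow2 p i) (pow2 q j) n l = RtoC 0.
  move=> h; have := val_conv2 _ _ _ _ (val_pow2 p 1 i Hp) (val_pow2 q 1 j Hq).
  by apply; lia.
rewrite /comp (csum_trunc _ (n + l) J) //.
  apply: sum_n_ext => i; apply: csum_trunc => // j hj; rewrite Z; last lia. cring.
move=> i hi; apply: csum_zero => j hj; rewrite Z; last lia. cring.
Qed.

(** Ratios are kept at most [1/2] throughout, so each geometric sum is at most 2; this is the origin
    of the factors 4 in later bounds. *)
Lemma geom2_le M x y J : 0 <= M -> 0 <= x <= 1/2 -> 0 <= y <= 1/2 ->
  sum_n (fun i => sum_n (fun j => M * x ^ i * y ^ j) J) J <= 4 * M.
Proof.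
move=> HM Hx Hy.
have -> : sum_n (fun i => sum_n (fun j => M * x ^ i * y ^ j) J) J =
  M * (sum_n (fun i => x ^ i) J * sum_n (fun j => y ^ j) J).
  rewrite (Rmult_comm (sum_n (fun i => x ^ i) J)) -rsum_scal -rsum_scal.
  apply: sum_n_ext => i; rewrite (rsum_scal _ (fun j => y ^ j)); rring.
have h1 := sum_geom_le x J Hx; have h2 := sum_geom_le y J Hy.
have p1 : 0 <= sum_n (fun k => x ^ k) J by apply: rsum_ge0 => k _; apply: pow_le; lra.
have p2 : 0 <= sum_n (fun k => y ^ k) J by apply: rsum_ge0 => k _; apply: pow_le; lra.
have := Rmult_le_compat _ _ _ _ p1 p2 h1 h2; nra.
Qed.

Lemma wnorm_le_comp W rho c p q M R1 k1 k2 : submult W -> 0 <= rho -> W 0%nat <= 1 ->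
  val_ge p 1 -> val_ge q 1 -> wnorm_le W rho p k1 -> wnorm_le W rho q k2 ->
  0 <= R1 -> k1 * R1 <= 1/2 -> k2 * R1 <= 1/2 ->
  (forall i j, Cmod (c i j) <= M * R1 ^ (i + j)) -> 
  wnorm_le W rho (comp c p q) (4 * M).
Proof.
move=> HW Hr HW0 vp vq Hp Hq HR h1 h2 Hc N L.
have k1p := wnorm_le_ge0 _ _ _ _ HW Hr Hp.
have k2p := wnorm_le_ge0 _ _ _ _ HW Hr Hq.
have W0 := proj1 HW.
have HM : 0 <= M.
  have := Hc 0%nat 0%nat; rewrite /= Rmult_1_r; have := Cmod_ge_0 (c 0%nat 0%nat); lra.
(* One truncation degree for every coefficient of the rectangle, so that all sums are finite over
   fixed ranges and can be exchanged. *)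
set J := (N + L)%nat.
apply: Rle_trans (_ : sum_n (fun i => sum_n (fun j => Cmod (c i j) *
  sum_n (fun n => W n * sum_n (fun l => Cmod (conv2 (pow2 p i) (pow2 q j) n l) * rho ^ l) L) N) J) J
   <= _); last first.
  apply: Rle_trans (geom2_le M (k1 * R1) (k2 * R1) J HM _ _); [|split=> //; exact: Rmult_le_pos..].
  apply: rsum_le => i _; apply: rsum_le => j _.
  have Q := wnorm_le_conv2 _ _ _ _ _ _ HW Hr (wnorm_le_pow2 _ _ _ _ i HW Hr HW0 Hp)
     (wnorm_le_pow2 _ _ _ _ j HW Hr HW0 Hq) N L.
  apply: Rle_trans (_ : M * R1 ^ (i + j) * (k1 ^ i * k2 ^ j) <= _).
    apply: Rmult_le_compat => //; first exact: Cmod_ge_0.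
    apply: rsum_ge0 => n _; apply: Rmult_le_pos => //; apply: rsum_ge0 => l _.
    by apply: Rmult_le_pos; [apply: Cmod_ge_0|apply: pow_le].
  rewrite !Rpow_mult_distr pow_add; apply: Req_le; ring.
apply: Rle_trans (_ : sum_n (fun n => sum_n (fun i => sum_n (fun j => 
  Cmod (c i j) * (W n * sum_n (fun l => Cmod (conv2 (pow2 p i) (pow2 q j) n l) * rho ^ l) L)) J) J) N <= _).
  apply: rsum_le => n nN.
  apply: Rle_trans (_ : W n * sum_n (fun i => sum_n (fun j =>
     Cmod (c i j) * (sum_n (fun l => Cmod (conv2 (pow2 p i) (pow2 q j) n l) * rho ^ l) L)) J) J <= _);
   last first.
    rewrite -rsum_scal; apply: rsum_le => i _; rewrite -rsum_scal; apply: rsum_le => j _.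
    by apply: Req_le; ring.
  apply: Rmult_le_compat_l => //.
  apply: Rle_trans (_ : sum_n (fun l => sum_n (fun i => sum_n (fun j => 
     Cmod (c i j) * (Cmod (conv2 (pow2 p i) (pow2 q j) n l) * rho ^ l)) J) J) L <= _).
    apply: rsum_le => l lL; rewrite (comp_trunc c p q n l J) //; last lia.
    apply: Rle_trans (Rmult_le_compat_r _ _ _ (pow_le _ _ Hr) (csum_Cmod _ _)) _.
    rewrite Rmult_comm -rsum_scal; apply: rsum_le => i _.
    rewrite Rmult_comm.
    apply: Rle_trans (Rmult_le_compat_r _ _ _ (pow_le _ _ Hr) (csum_Cmod _ _)) _.
    rewrite Rmult_comm -rsum_scal; apply: rsum_le => j _.
    rewrite Cmod_mult; apply: Req_le; ring.
  rewrite sum_n_switch; apply: rsum_le => i _.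
  rewrite sum_n_switch; apply: rsum_le => j _.
  by rewrite rsum_scal; apply: Rle_refl.
rewrite sum_n_switch; apply: rsum_le => i _.
rewrite sum_n_switch; apply: rsum_le => j _.
by rewrite rsum_scal; apply: Rle_refl.
Qed.

(** * Evaluation of formal series at a point *)

Definition monomials (a : nat -> nat -> C) (z w : C) (n l : nat) : C :=
  (a n l * (z ^ n * w ^ l))%C.

(** A weight that dominates the powers of [|z|] turns the norm bound into absolute convergence at
    [(z, w)]. *)
Lemma wnorm_le_abs_bound W rho a c z w : wnorm_le W rho a c -> 0 <= rho ->
  (forall n, Cmod z ^ n <= W n) -> Cmod w <= rho -> abs_bound (monomials a z w) c.
Proof.
move=> H Hr Hz Hw N L; apply: Rle_trans (H N L).
apply: rsum_le => n _.
rewrite -rsum_scal; apply: rsum_le => l _.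
rewrite /monomials !Cmod_mult !Cmod_pow.
have h1 := pow_incr _ _ l (conj (Cmod_ge_0 w) Hw).
have h2 := pow_le _ n (Cmod_ge_0 z); have h3 := pow_le _ l (Cmod_ge_0 w).
have h4 := Cmod_ge_0 (a n l).
have h5 := Rmult_le_compat _ _ _ _ h2 h3 (Hz n) h1.
have := Rmult_le_compat_l _ _ _ h4 h5; lra.
Qed.

Lemma monomials_conv2 a b z w n l : monomials (conv2 a b) z w n l = conv2 (monomials a z w) (monomials b z w) n l.
Proof.
rewrite /monomials /conv2 Cmult_comm -csum_scal; apply: sum_n_ext_loc => k kn.
rewrite /conv -csum_scal; apply: sum_n_ext_loc => j jl.
have -> : (z ^ n = z ^ k * z ^ (n - k))%C by rewrite -Cpow_add_r; congr Cpow; lia.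
have -> : (w ^ l = w ^ j * w ^ (l - j))%C by rewrite -Cpow_add_r; congr Cpow; lia.
cring.
Qed.

Lemma ds_single (a : nat -> nat -> C) m p :
  (forall n l, (n, l) <> (m, p) -> a n l = RtoC 0) -> is_dseries a (a m p).
Proof.
move=> H.
have X (b : nat -> C) k : (forall n, n <> k -> b n = RtoC 0) -> serC b (b k).
  move=> Hb; apply/serC_eps => eps He; exists k => n kn.
  have -> : sum_n b n = b k.
    rewrite -(csum_trunc _ k) //; last by move=> i ik; apply: Hb; lia.
    case: k Hb {kn} => [|k] Hb; first by rewrite sum_O.
    rewrite csum_S csum_zero; last by move=> i ik; apply: Hb; lia. cring.
  have -> : (b k - b k = 0)%C by ring. by rewrite Cmod_0.
exists (fun n => a n p); split.
- move=> n; apply: X => l lp; apply: H; by case.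
- by apply: X => n nm; apply: H; case.
Qed.

Lemma pow2_ds W rho q c z w Q j : submult W -> 0 <= rho -> W 0%nat <= 1 ->
  wnorm_le W rho q c -> (forall n, Cmod z ^ n <= W n) -> Cmod w <= rho ->
  is_dseries (monomials q z w) Q -> is_dseries (monomials (pow2 q j) z w) (Q ^ j)%C.
Proof.
move=> HW Hr HW0 Hq Hz Hw HQ; elim: j => [|j IH].
  have E : monomials one2 z w 0 0 = (Q ^ 0)%C by rewrite /monomials /=; ring.
  rewrite -E; apply: ds_single => n l; rewrite /monomials /one2.
  case: n => [|n]; case: l => [|l] //= _; ring.
rewrite Cpow_S.
apply: ds_ext (fun n l => eq_sym (monomials_conv2 _ _ _ _ n l)) _.
apply: conv2_ds IH => //; first by apply: wnorm_le_abs_bound Hq _ _ _.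
by apply: wnorm_le_abs_bound (wnorm_le_pow2 _ _ _ _ j HW Hr HW0 Hq) _ _ _.
Qed.

Lemma serC_fin (a : nat -> C) I : (forall k, (I < k)%nat -> a k = RtoC 0) ->
  serC a (sum_n a I).
Proof.
move=> H; apply/serC_eps => eps He; exists I => n nI.
rewrite (csum_trunc a I n) //.
have -> : (sum_n a n - sum_n a n = 0)%C by ring. by rewrite Cmod_0.
Qed.

Definition cut (I : nat) (c : nat -> nat -> C) (i j : nat) : C :=
  if (Nat.leb i I && Nat.leb j I)%bool then c i j else RtoC 0.

(** Outside the square [i + j] is at least [I], so doubling the growth rate [R1] buys a factor
    [(1/2)^I]: the tail is small in the same kind of norm. *)
Lemma cut_tail c I M R1 : 0 <= M -> 0 <= R1 ->
  (forall i j, Cmod (c i j) <= M * R1 ^ (i + j)) ->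
  forall i j, Cmod (c i j - cut I c i j) <= M * (1/2) ^ I * (2 * R1) ^ (i + j).
Proof.
move=> HM HR H i j.
have P : 0 <= M * (1/2) ^ I * (2 * R1) ^ (i + j).
  apply: Rmult_le_pos; first (apply: Rmult_le_pos => //); apply: pow_le; lra.
have tail : (I <= i + j)%nat -> Cmod (c i j - 0) <= M * (1/2) ^ I * (2 * R1) ^ (i + j).
  move=> hI; rewrite (_ : (c i j - 0 = c i j)%C); last ring.
  apply: Rle_trans (H i j) _; rewrite Rpow_mult_distr.
  have -> : (i + j = I + (i + j - I))%nat by lia.
  set k := (i + j - I)%nat.
  have E : (1/2) ^ I * 2 ^ I = 1 by rewrite -Rpow_mult_distr (_ : 1/2*2 = 1) ?pow1 //; field.
  rewrite (pow_add 2).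
  have -> : M * (1/2)^I * (2 ^ I * 2 ^ k * R1 ^ (I + k)) = M * R1 ^ (I+k) * 2 ^ k * ((1/2)^I * 2^I) by ring.
  rewrite E Rmult_1_r.
  have h1 : 0 <= M * R1 ^ (I + k) by apply: Rmult_le_pos => //; apply: pow_le.
  have := Rmult_le_compat_l _ _ _ h1 (pow_R1_Rle 2 k ltac:(lra)); lra.
rewrite /cut; case: (Nat.leb_spec i I) => hi; last by apply: tail; lia.
case: (Nat.leb_spec j I) => hj; last by apply: tail; lia.
by rewrite /= (_ : (c i j - c i j = 0)%C) ?Cmod_0 //; ring.
Qed.

Lemma abs_bound_sq A c : (forall J, sum_n (fun n => sum_n (fun l => Cmod (A n l)) J) J <= c) ->
  abs_bound A c.
Proof.
move=> H N L; apply: Rle_trans (H (N + L)%nat).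
apply: Rle_trans (rsum_mono _ N (N + L) _ _); first 1 last.
- lia.
- by move=> n; apply: rsum_ge0 => l _; apply: Cmod_ge_0.
apply: rsum_le => n _; apply: rsum_mono; [lia|move=> l; exact: Cmod_ge_0].
Qed.

Lemma abs_bound_geom c M R1 z w : 0 <= R1 -> 0 <= M ->
  (forall i j, Cmod (c i j) <= M * R1 ^ (i + j)) ->
  Cmod z * R1 <= 1/2 -> Cmod w * R1 <= 1/2 -> abs_bound (monomials c z w) (4 * M).
Proof.
move=> HR HM Hc Hz Hw; apply: abs_bound_sq => J.
apply: Rle_trans (geom2_le M (Cmod z * R1) (Cmod w * R1) J HM _ _);
  [|split=> //; apply: Rmult_le_pos => //; apply: Cmod_ge_0..].
apply: rsum_le => i _; apply: rsum_le => j _.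
rewrite /monomials !Cmod_mult !Cmod_pow !Rpow_mult_distr.
have h2 := pow_le _ i (Cmod_ge_0 z); have h3 := pow_le _ j (Cmod_ge_0 w).
have := Rmult_le_compat_r _ _ _ (Rmult_le_pos _ _ h2 h3) (Hc i j).
rewrite pow_add; lra.
Qed.

Lemma pow_small x : 0 < x -> exists I, (1/2) ^ I < x.
Proof.
move=> Hx; case: (pow_lt_1_zero (1/2) _ x Hx) => [|N HN].
  by rewrite Rabs_right; lra.
exists N; have := HN N (le_n _); rewrite Rabs_right //.
apply: Rle_ge; apply: pow_le; lra.
Qed.

(** Evaluation commutes with substitution. For a polynomial [c] this is algebra; in general both
    sides are compared with the truncation [cut I c], and [cut_tail] makes both errors at most
    [4 M (1/2)^I]. This is why the smallness hypotheses involve [2 * R1]. *)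
Lemma comp_ds W rho c p q M R1 k1 k2 z w P Q h : submult W -> 0 <= rho -> W 0%nat <= 1 ->
  val_ge p 1 -> val_ge q 1 -> wnorm_le W rho p k1 -> wnorm_le W rho q k2 ->
  0 <= R1 -> 0 <= M -> k1 * (2 * R1) <= 1/2 -> k2 * (2 * R1) <= 1/2 ->
  (forall i j, Cmod (c i j) <= M * R1 ^ (i + j)) ->
  (forall n, Cmod z ^ n <= W n) -> Cmod w <= rho ->
  is_dseries (monomials p z w) P -> is_dseries (monomials q z w) Q ->
  is_dseries (monomials c P Q) h -> is_dseries (monomials (comp c p q) z w) h.
Proof.
move=> HW Hr HW0 vp vq Hp Hq HR HM h1 h2 Hc Hz Hw HP HQ Hh.
have k1p := wnorm_le_ge0 _ _ _ _ HW Hr Hp.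
have k2p := wnorm_le_ge0 _ _ _ _ HW Hr Hq.
have PB : Cmod P <= k1 by apply: ds_le HP; apply: wnorm_le_abs_bound Hp _ _ _.
have QB : Cmod Q <= k2 by apply: ds_le HQ; apply: wnorm_le_abs_bound Hq _ _ _.
have PB2 : Cmod P * (2 * R1) <= 1/2.
  apply: Rle_trans h1; apply: Rmult_le_compat_r => //; lra.
have QB2 : Cmod Q * (2 * R1) <= 1/2.
  apply: Rle_trans h2; apply: Rmult_le_compat_r => //; lra.
have g1 : k1 * R1 <= 1/2 by have := Rmult_le_pos _ _ k1p HR; lra.
have g2 : k2 * R1 <= 1/2 by have := Rmult_le_pos _ _ k2p HR; lra.
have AB := wnorm_le_abs_bound _ _ _ _ z w (wnorm_le_comp W rho c p q M R1 k1 k2 HW Hr HW0 vp vq Hp Hq HR g1 g2 Hc) Hr Hz Hw.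
case: (ds_ex _ _ AB) => S [HS _].
suff -> : h = S by [].
apply: Cmod_sub_le0; apply: le_epsilon => eps He.
(* Two errors of [4 M (1/2)^I] add up to [8 M (1/2)^I]; the summand 1 keeps the denominator positive
   when [M = 0]. *)
have He2 : 0 < eps / (8 * M + 1) by apply: Rdiv_lt_0_compat; lra.
case: (pow_small _ He2) => I HI.
pose hI := sum_n (fun i => sum_n (fun j => (c i j * (P ^ i * Q ^ j))%C) I) I.
have MI : 0 <= M * (1/2)^I by apply: Rmult_le_pos => //; apply: pow_le; lra.
have X1 : is_dseries (monomials (cut I c) P Q) hI.
  exists (fun i => if Nat.leb i I then sum_n (fun j => (c i j * (P ^ i * Q ^ j))%C) I else RtoC 0).
  split.
  - move=> i.
    have -> : (if Nat.leb i I then sum_n (fun j => (c i j * (P ^ i * Q ^ j))%C) I else RtoC 0)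
        = sum_n (monomials (cut I c) P Q i) I.
      case E: (Nat.leb i I).
        apply: sum_n_ext_loc => j jI; rewrite /monomials /cut E /=.
        by have -> : Nat.leb j I = true by apply/Nat.leb_le.
      symmetry; apply: csum_zero => j jI; rewrite /monomials /cut E /=; ring.
    apply: serC_fin => j jI; rewrite /monomials /cut.
    have -> : Nat.leb j I = false by apply/Nat.leb_gt.
    rewrite Bool.andb_false_r; ring.
  - have -> : hI = sum_n (fun i => if Nat.leb i I then sum_n (fun j => (c i j * (P ^ i * Q ^ j))%C) I else RtoC 0) I.
      apply: sum_n_ext_loc => i iI.
      by have -> : Nat.leb i I = true by apply/Nat.leb_le.
    apply: serC_fin => i iI.
    by have -> : Nat.leb i I = false by apply/Nat.leb_gt.
have X2 : is_dseries (monomials (comp (cut I c) p q) z w) hI.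
  apply: (ds_ext (fun n l => sum_n (fun i => sum_n (fun j =>
     (c i j * conv2 (monomials (pow2 p i) z w) (monomials (pow2 q j) z w) n l)%C) I) I)).
    move=> n l; rewrite /monomials (comp_trunc _ _ _ _ _ (n + l + I)) //; last lia.
    rewrite Cmult_comm -csum_scal.
    have Z i j : ((I < i)%nat \/ (I < j)%nat) -> cut I c i j = RtoC 0.
      rewrite /cut; case: (Nat.leb_spec i I); case: (Nat.leb_spec j I) => //=; lia.
    rewrite -(csum_trunc _ I); last first.
    - move=> i iI; rewrite csum_zero; last by move=> j _; rewrite Z; [cring|by left]. cring.
    - lia.
    apply: sum_n_ext_loc => i iI.
    rewrite -csum_scal -(csum_trunc _ I); last first.
    - by move=> j jI; rewrite Z; [cring|by right].
    - lia.
    apply: sum_n_ext_loc => j jI.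
    rewrite -monomials_conv2 /monomials /cut.
    have -> : Nat.leb i I = true by apply/Nat.leb_le.
    have -> : Nat.leb j I = true by apply/Nat.leb_le.
    rewrite /=; cring.
  apply: ds_sum => i _; apply: ds_sum => j _; apply: ds_scal.
  apply: conv2_ds.
  - exact: wnorm_le_abs_bound (wnorm_le_pow2 _ _ _ _ i HW Hr HW0 Hp) Hr Hz Hw.
  - exact: wnorm_le_abs_bound (wnorm_le_pow2 _ _ _ _ j HW Hr HW0 Hq) Hr Hz Hw.
  - exact: pow2_ds Hp Hz Hw HP.
  - exact: pow2_ds Hq Hz Hw HQ.
have T := cut_tail c I M R1 HM HR Hc.
have Y1 : Cmod (h - hI) <= 4 * (M * (1/2)^I).
  apply: ds_le (ds_minus _ _ _ _ Hh X1).
  have := abs_bound_geom _ _ (2*R1) P Q ltac:(lra) MI T PB2 QB2.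
  move=> H N L; apply: Rle_trans (H N L); apply: Req_le.
  apply: sum_n_ext => n; apply: sum_n_ext => l; congr Cmod; rewrite /monomials; ring.
have Y2 : Cmod (S - hI) <= 4 * (M * (1/2)^I).
  apply: ds_le (ds_minus _ _ _ _ HS X2).
  have := wnorm_le_abs_bound _ _ _ _ z w (wnorm_le_comp W rho _ p q _ (2*R1) k1 k2 HW Hr HW0 vp vq Hp Hq ltac:(lra) h1 h2 T) Hr Hz Hw.
  move=> H N L; apply: Rle_trans (H N L); apply: Req_le.
  apply: sum_n_ext => n; apply: sum_n_ext => l; congr Cmod; rewrite /monomials.
  have -> : forall a b d : C, (a * d - b * d)%C = ((a - b) * d)%C by move=> *; ring.
  congr Cmult.
  rewrite /comp -csum_minus; apply: sum_n_ext => i.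
  rewrite -csum_minus; apply: sum_n_ext => j; cring.
have := Cmod_sub_triangle hI h S; rewrite (Cmod_sub_sym hI S).
have : (8 * M + 1) * (1/2)^I <= eps.
  have -> : eps = (8 * M + 1) * (eps / (8 * M + 1)) by field; lra.
  apply: Rmult_le_compat_l; lra.
have : 0 <= (1/2)^I by apply: pow_le; lra.
lra.
Qed.

(** * Formal solution of the twisted equation *)

(* The coefficientwise form of [X = z * c (z, w + X) / sig]: degree [d] on the right only
   depends on degrees [< d] of [X], so iterating from [0] stabilises. *)
Definition twisted_op (sig : nat -> C) (c X : nat -> nat -> C) (n l : nat) : C :=
  match n with
  | O => 0
  | S n => (comp c zvar (fun n l => wvar n l + X n l) n l / sig (S n))%C
  end.
Fixpoint twisted_iter sig c (k : nat) : nat -> nat -> C :=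
  match k with O => fun _ _ => RtoC 0 | S k => twisted_op sig c (twisted_iter sig c k) end.
(** The coefficient in degree [n + l] is frozen from the iterate [S (n + l)] on, so the limit is
    read off diagonally. *)
Definition twisted_sol sig c (n l : nat) : C := twisted_iter sig c (S (n + l)) n l.

Lemma agree_twisted_op sig c d X Y : agree d X Y -> agree (S d) (twisted_op sig c X) (twisted_op sig c Y).
Proof.
move=> H [|n] l nl //=; congr Cdiv; apply: (agree_comp d); last lia.
by move=> n' l' h; rewrite H.
Qed.

Lemma agree_twisted_iter sig c k m : agree k (twisted_iter sig c k) (twisted_iter sig c (k + m)).
Proof.
elim: k => [|k IH] /=; first by move=> n l; lia.
exact: agree_twisted_op.
Qed.
Lemma agree_twisted_sol sig c k : agree k (twisted_sol sig c) (twisted_iter sig c k).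
Proof.
move=> n l nl; rewrite /twisted_sol.
have := agree_twisted_iter sig c (S (n + l)) (k - S (n + l)) n l ltac:(lia).
by have -> : (S (n + l) + (k - S (n + l)) = k)%nat by lia.
Qed.
Lemma twisted_sol_eq sig c n l : twisted_sol sig c n l = twisted_op sig c (twisted_sol sig c) n l.
Proof.
rewrite {1}/twisted_sol /=; symmetry; apply: (agree_twisted_op _ _ (n + l)); last lia.
exact: agree_twisted_sol.
Qed.

Lemma wnorm_le_weaken W rho a c d : c <= d -> wnorm_le W rho a c -> wnorm_le W rho a d.
Proof. move=> cd H N L; exact: Rle_trans (H N L) cd. Qed.

Lemma val_wX X : X 0%nat 0%nat = RtoC 0 -> val_ge (fun n l => (wvar n l + X n l)%C) 1.
Proof.
move=> H [|n] [|l] nl; try lia. rewrite H /=; ring.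
Qed.
Lemma val_z : val_ge zvar 1.
Proof. by move=> [|n] [|l] nl //; lia. Qed.

Lemma rsum_shift (a : nat -> R) N :
  sum_n a (S N) = a 0%nat + sum_n (fun n => a (S n)) N.
Proof.
elim: N => [|N IH]; first by rewrite rsum_S !sum_O.
by rewrite rsum_S IH rsum_S; rring.
Qed.

(** The factor [z] moves row [n] to row [S n], where the weight is smaller by [r * |sig (S n)|]:
    this gain absorbs the division by the divisor and leaves the factor [r]. *)
Lemma wnorm_le_twisted_op W rho sig c X k r M : submult W -> 0 <= rho -> 0 <= r -> 
  (forall n, W (S n) <= r * W n * Cmod (sig (S n))) -> (forall n, sig (S n) <> RtoC 0) ->
  wnorm_le W rho (comp c zvar (fun n l => wvar n l + X n l)%C) M -> r * M <= k ->
  wnorm_le W rho (twisted_op sig c X) k.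
Proof.
move=> [W0 _] Hr Hr' HW Hs H Hk N L.
have Z : sum_n (fun l => Cmod (twisted_op sig c X 0 l) * rho ^ l) L = 0.
  rewrite (sum_n_ext _ (fun _ => 0)); first by rewrite sum_n_const; rring.
  move=> l; rewrite /= Cmod_0; rring.
apply: Rle_trans Hk.
have M0 : 0 <= M.
  apply: Rle_trans (H 0%nat 0%nat); rewrite !sum_O.
  by apply: Rmult_le_pos => //; apply: Rmult_le_pos; [apply: Cmod_ge_0|apply: pow_le].
case: N => [|N]; first by rewrite sum_O Z Rmult_0_r; apply: Rmult_le_pos.
rewrite rsum_shift Z Rmult_0_r Rplus_0_l.
apply: Rle_trans (Rmult_le_compat_l _ _ _ Hr' (H N L)); rewrite -rsum_scal.
apply: rsum_le => n _; rewrite -Rmult_assoc.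
rewrite -rsum_scal -rsum_scal; apply: rsum_le => l _.
rewrite /twisted_op /=; set u := comp _ _ _ _ _.
have sp : 0 < Cmod (sig (S n)) by apply/Cmod_gt_0.
rewrite Cmod_div //.
have h := HW n.
have : W (S n) / Cmod (sig (S n)) <= r * W n by apply/Rle_div_l; lra.
have : 0 <= Cmod u * rho ^ l by apply: Rmult_le_pos; [apply: Cmod_ge_0|apply: pow_le].
move=> h1 h2; have := Rmult_le_compat_r _ _ _ h1 h2; rewrite /Rdiv; lra.
Qed.

Theorem formal_solution (K : nat -> R) (B : R) (sig : nat -> C) (c : nat -> nat -> C) (M R1 : R) :
  K 0%nat = 0 -> (forall n, 0 <= K n) -> (forall m n, K m + K n <= K (m + n)%nat) ->
  (forall n, K n <= B * INR n) ->
  (forall n, exp (K n - K (S n)) <= Cmod (sig (S n))) ->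
  0 < R1 -> 0 <= M -> (forall i j, Cmod (c i j) <= M * R1 ^ (i + j)) ->
  exists (X : nat -> nat -> C) (d M' R' : R), 0 < d /\ 0 <= M' /\ 0 < R' /\
   (forall l, X 0%nat l = RtoC 0) /\
   (forall n l, Cmod (X n l) <= M' * R' ^ (n + l)) /\
   (forall z w, Cmod z <= d -> Cmod w <= d -> exists x,
       is_dseries (monomials X z w) x /\ Cmod z * R1 <= 1/4 /\ Cmod (w + x) * R1 <= 1/4 /\
       forall h, is_dseries (monomials c z (w + x)) h ->
        is_dseries (monomials (fun n l => (sig n * X n l)%C) z w) (z * h)%C).
Proof.
move=> K0 Kp KS KB Hsig HR HM Hc.
(* The series [w + X] has norm at most [2 rho], and [2 rho * (2 R1) = 1/2] is the limit allowed by
   [comp_ds]. The choice [r * 4 (M + 1) = rho] makes the operator, whose norm is at most [r * 4 M],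
   preserve the ball of radius [rho]. *)
pose rho := / (8 * R1).
pose r := / (32 * R1 * (M + 1)).
have rhop : 0 < rho by apply: Rinv_0_lt_compat; lra.
have P1 : 0 < 32 * R1 * (M + 1) by apply: Rmult_lt_0_compat; lra.
have rp : 0 < r by apply: Rinv_0_lt_compat.
(* The factor [exp (- K n)] absorbs the divisors and is submultiplicative by superadditivity of [K];
   [r^n] is a mere rescaling of [z]. *)
pose W n := exp (- K n) * r ^ n.
have HW : submult W.
  split=> [n|m n].
    by apply: Rmult_le_pos; [apply: Rlt_le; apply: exp_pos|apply: pow_le; lra].
  rewrite /W pow_add.
  have -> : exp (- K m) * r ^ m * (exp (- K n) * r ^ n) = exp (- K m + - K n) * (r ^ m * r ^ n).
    rewrite exp_plus; ring.
  apply: Rmult_le_compat_r; first by apply: Rmult_le_pos; apply: pow_le; lra.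
  case: (Req_dec (- K (m + n)%nat) (- K m + - K n)) => [->|ne]; first exact: Rle_refl.
  apply: Rlt_le; apply: exp_increasing; have := KS m n; lra.
have HW0 : W 0%nat <= 1 by rewrite /W K0 Ropp_0 exp_0 /=; lra.
have expm x y : x <= y -> exp x <= exp y.
  move=> h; case: (Req_dec x y) => [->|ne]; first exact: Rle_refl.
  by apply: Rlt_le; apply: exp_increasing; lra.
have rho0 : 0 <= rho by lra.
have Hz : wnorm_le W rho zvar r.
  apply: wnorm_le_weaken (wnorm_le_single W rho zvar 1 0 HW rho0 _); last by case=> [|[|n]] [|l].
  rewrite /= Cmod_1 /W /= !Rmult_1_r.
  have : exp (- K 1%nat) <= 1 by rewrite -exp_0; apply: expm; have := Kp 1%nat; lra.
  by move=> h; have := Rmult_le_compat_r r _ _ ltac:(lra) h; lra.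
have Hw : wnorm_le W rho wvar rho.
  apply: wnorm_le_weaken (wnorm_le_single W rho wvar 0 1 HW rho0 _); last by case=> [|n] [|[|l]].
  rewrite /= Cmod_1 /W /= !Rmult_1_r Rmult_1_l.
  by rewrite K0 Ropp_0 exp_0; lra.
have Er : r * (32 * R1 * (M + 1)) = 1 by rewrite /r; field; lra.
have Erho : rho * (8 * R1) = 1 by rewrite /rho; field; lra.
have rR : r * (2 * R1) <= 1/2.
  have : 0 <= r * R1 * M by apply: Rmult_le_pos => //; apply: Rmult_le_pos; lra.
  lra.
have rho2 : (rho + rho) * (2 * R1) <= 1/2 by lra.
have sig0 n : sig (S n) <> RtoC 0.
  move=> E; have := Hsig n; rewrite E Cmod_0; have := exp_pos (K n - K (S n)); lra.
have Wsig n : W (S n) <= r * W n * Cmod (sig (S n)).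
  rewrite /W /=.
  have : exp (- K (S n)) = exp (- K n) * exp (K n - K (S n)).
    by rewrite -exp_plus; congr exp; ring.
  move=> ->.
  have h : 0 <= r * r ^ n * exp (- K n).
    apply: Rmult_le_pos; last by apply: Rlt_le; apply: exp_pos.
    by apply: Rmult_le_pos; [lra|apply: pow_le; lra].
  have := Rmult_le_compat_l _ _ _ h (Hsig n); lra.
have Mr : r * (4 * M) <= rho.
  have -> : rho = r * (4 * (M + 1)) by rewrite /rho /r; field; lra.
  apply: Rmult_le_compat_l; lra.
have HIt k : twisted_iter sig c k 0%nat 0%nat = RtoC 0 /\ wnorm_le W rho (twisted_iter sig c k) rho.
  elim: k => [|k [IH0 IH]].
    split=> // N L.
    rewrite (sum_n_ext _ (fun _ => 0)); first by rewrite sum_n_const Rmult_0_r.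
    move=> n /=; rewrite (sum_n_ext _ (fun _ => 0)); first by rewrite sum_n_const; rring.
    move=> l; rewrite Cmod_0; rring.
  split=> //=; apply: (wnorm_le_twisted_op _ _ _ _ _ _ r (4 * M)) => //; first lra.
  apply: (wnorm_le_comp _ _ _ _ _ _ R1 r (rho + rho)) => //.
  - exact: val_z.
  - exact: val_wX.
  - exact: wnorm_le_plus.
  - lra.
  - have := Rmult_lt_0_compat _ _ rp HR; lra.
  - lra.
pose X := twisted_sol sig c.
have HX : wnorm_le W rho X rho.
  (* On a finite rectangle the formal solution coincides with an iterate, so the uniform bound
     passes to it without any limit. *)
  move=> N L; apply: Rle_trans (proj2 (HIt (S (N + L))) N L); apply: Req_le.
  apply: sum_n_ext_loc => n nN; congr Rmult; apply: sum_n_ext_loc => l lL.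
  by rewrite /X (agree_twisted_sol _ _ (S (N + L))) //; lia.
have X0 l : X 0%nat l = RtoC 0 by rewrite /X twisted_sol_eq.
(* The linear bound [K n <= B n] gives [s^n <= W n]: the weighted ball consists of series that
   converge for [|z| <= s]. *)
pose s := r * exp (- B).
have sp : 0 < s by apply: Rmult_lt_0_compat => //; apply: exp_pos.
have sW n : s ^ n <= W n.
  rewrite /s /W Rpow_mult_distr Rmult_comm; apply: Rmult_le_compat_r; first by apply: pow_le; lra.
  have -> : exp (- B) ^ n = exp (- (B * INR n)).
    elim: n => [|n IH]; first by rewrite /= Rmult_0_r Ropp_0 exp_0.
    rewrite S_INR /= IH -exp_plus; congr exp; ring.
  apply: expm; have := KB n; lra.
pose d := Rmin s rho.
have dp : 0 < d by apply: Rmin_pos.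
pose R' := / s + / rho.
have Rs : 0 < / s by apply: Rinv_0_lt_compat.
have Rr : 0 < / rho by apply: Rinv_0_lt_compat.
exists X, d, rho, R'.
split=> //; split=> //; split; first by rewrite /R'; lra.
split=> //; split.
- move=> n l.
  have H1 : W n * (Cmod (X n l) * rho ^ l) <= rho.
    apply: Rle_trans (HX n l).
    have T (a : nat -> R) m : (forall k, 0 <= a k) -> a m <= sum_n a m.
      move=> Ha; case: m => [|m]; first by rewrite sum_O; apply: Rle_refl.
      by rewrite rsum_S; have := rsum_ge0 a m (fun k _ => Ha k); lra.
    have T0 k : 0 <= Cmod (X n k) * rho ^ k.
      by apply: Rmult_le_pos; [apply: Cmod_ge_0|apply: pow_le; lra].
    apply: Rle_trans (T (fun n => W n * sum_n (fun l => Cmod (X n l) * rho ^ l) l) n _).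
      by apply: Rmult_le_compat_l; [apply: (proj1 HW)|apply: (T (fun l => Cmod (X n l) * rho ^ l) l)].
    move=> k; apply: Rmult_le_pos; first by apply: (proj1 HW).
    apply: rsum_ge0 => j _; by apply: Rmult_le_pos; [apply: Cmod_ge_0|apply: pow_le; lra].
  have H2 : s ^ n * (Cmod (X n l) * rho ^ l) <= rho.
    apply: Rle_trans H1; apply: Rmult_le_compat_r (sW n).
    by apply: Rmult_le_pos; [apply: Cmod_ge_0|apply: pow_le; lra].
  have sn := pow_lt s n sp; have rl := pow_lt rho l rhop.
  apply: Rle_trans (_ : rho * ((/ s) ^ n * (/ rho) ^ l) <= _).
    rewrite (pow_inv s) (pow_inv rho).
    have -> : Cmod (X n l) = s ^ n * (Cmod (X n l) * rho ^ l) * (/ s ^ n * / rho ^ l) by field; lra.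
    apply: Rmult_le_compat_r => //.
    by apply: Rmult_le_pos; apply: Rlt_le; apply: Rinv_0_lt_compat.
  apply: Rmult_le_compat_l => //; rewrite pow_add; apply: Rmult_le_compat; try (apply: pow_le; lra);
  apply: pow_incr; rewrite /R'; lra.
move=> z w Hzd Hwd.
have zW n : Cmod z ^ n <= W n.
  apply: Rle_trans (sW n); apply: pow_incr; split; first exact: Cmod_ge_0.
  apply: Rle_trans Hzd _; exact: Rmin_l.
have wr : Cmod w <= rho by apply: Rle_trans Hwd _; exact: Rmin_r.
have AX := wnorm_le_abs_bound _ _ _ _ z w HX rho0 zW wr.
case: (ds_ex _ _ AX) => x [Hx xr].
have zr : Cmod z <= r.
  have := zW 1%nat; rewrite /= Rmult_1_r => h; apply: Rle_trans h _.
  rewrite /W /= !Rmult_1_r.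
  have : exp (- K 1%nat) <= 1 by rewrite -exp_0; apply: expm; have := Kp 1%nat; lra.
  by move=> h; have := Rmult_le_compat_r r _ _ ltac:(lra) h; lra.
exists x; split=> //; split.
  have := Rmult_le_compat_r R1 _ _ ltac:(lra) zr; lra.
split.
  have : Cmod (w + x) <= rho + rho by apply: Rle_trans (Cmod_triangle _ _) _; lra.
  move=> h; have := Rmult_le_compat_r R1 _ _ ltac:(lra) h; lra.
move=> h Hh.
have wx0 : X 0%nat 0%nat = RtoC 0 by [].
have Hc2 : is_dseries (monomials (comp c zvar (fun n l => wvar n l + X n l)%C) z w) h.
  apply: (comp_ds W rho c _ _ M R1 r (rho + rho) z w z (w + x)) => //.
  - exact: val_z.
  - exact: val_wX.
  - exact: wnorm_le_plus.
  - lra.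
  - have E : z = monomials zvar z w 1%nat 0%nat by rewrite /monomials /=; ring.
    rewrite {2}E.
    apply: ds_single => n l nl; rewrite {1}/monomials.
    by case: n nl => [|[|n]]; case: l => [|l] nl //=; ring.
  - have Hw1 : is_dseries (monomials wvar z w) w.
      have E : w = monomials wvar z w 0%nat 1%nat by rewrite /monomials /=; ring.
      rewrite {2}E; apply: ds_single => n l nl; rewrite /monomials.
      by case: n nl => [|n]; case: l => [|[|l]] nl //=; ring.
    apply: ds_ext (ds_plus _ _ _ _ Hw1 Hx) => n l; rewrite /monomials; ring.
have := ds_shift _ _ (ds_scal z _ _ Hc2).
apply: ds_ext => n l; rewrite /monomials.
(* In row 0 both sides vanish, so [sig 0], which is zero for the divisors [lambda^n - 1], is never
   divided by. *)
case: n => [|n]; first by rewrite X0; ring.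
rewrite /X twisted_sol_eq /twisted_op Cpow_S -/X; field; exact: sig0.
Qed.

(** * Small divisors *)

(* Davie's function for the indices [n] with [D n < eps], which are assumed to be [q]-separated:
   it is superadditive, linearly bounded, and gains 1 at each such index. *)
Fixpoint last_hit (q : R) (D : nat -> R) (eps : R) (n : nat) : R :=
  match n with
  | O => 0
  | S m => if Rlt_dec (D (S m)) eps is left _
           then Rmax (last_hit q D eps m) (2 * INR (S m) / q - 1)
           else last_hit q D eps m
  end.
Definition davie q D eps n := Rmax (last_hit q D eps n) (2 * INR n / q - 2).

Section Davie.
Context (q : R) (D : nat -> R) (eps : R).
Context (q0 : 0 < q).
Context (hgap : forall m n, (1 <= m < n)%nat -> D m < eps -> D n < eps -> INR m + q <= INR n).
Context (hmin : forall n, (1 <= n)%nat -> D n < eps -> q <= INR n).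

Lemma last_hit_ge0 n : 0 <= last_hit q D eps n.
Proof.
elim: n => [|n IH] /=; first lra.
case: Rlt_dec => _ //; apply: Rle_trans IH _; exact: Rmax_l.
Qed.
Lemma last_hit_mono n m : (n <= m)%nat -> last_hit q D eps n <= last_hit q D eps m.
Proof.
elim=> [|m' _ IH] /=; first lra.
case: Rlt_dec => _ //; apply: Rle_trans IH _; exact: Rmax_l.
Qed.
Lemma divq_mono (x y : R) : x <= y -> x / q <= y / q.
Proof. move=> h; apply: Rmult_le_compat_r => //; left; exact: Rinv_0_lt_compat. Qed.
Lemma last_hit_val n : last_hit q D eps n = 0 \/
  exists m, (1 <= m <= n)%nat /\ D m < eps /\ last_hit q D eps n = 2 * INR m / q - 1.
Proof.
elim: n => [|n IH]; first by left.
rewrite /last_hit -/last_hit; case: Rlt_dec => h.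
  rewrite /Rmax; case: Rle_dec => _.
    by right; exists (S n); split=> //; lia.
  case: IH => [->|[m [H1 H2]]]; [by left|right; exists m; split=> //; lia].
case: IH => [->|[m [H1 H2]]]; [by left|right; exists m; split=> //; lia].
Qed.
Lemma davie_0 : davie q D eps 0 = 0.
Proof. rewrite /davie /= Rmax_left //; rewrite Rmult_0_r /Rdiv; lra. Qed.
Lemma davie_mono n m : (n <= m)%nat -> davie q D eps n <= davie q D eps m.
Proof.
move=> h; apply: Rmax_lub.
  apply: Rle_trans (last_hit_mono _ _ h) _; exact: Rmax_l.
apply: Rle_trans (Rmax_r _ _).
have := divq_mono (2 * INR n) (2 * INR m); have := le_INR _ _ h; lra.
Qed.
Lemma davie_ge0 n : 0 <= davie q D eps n.
Proof. apply: Rle_trans (last_hit_ge0 n) _; exact: Rmax_l. Qed.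
Lemma davie_cases n : davie q D eps n = 0 \/ davie q D eps n <= 2 * INR n / q - 1.
Proof.
rewrite /davie; case: (last_hit_val n) => [->|[m [H1 [H2 ->]]]].
  rewrite /Rmax; case: Rle_dec => h; [right; lra|by left].
right; apply: Rmax_lub; last lra.
have := divq_mono (2 * INR m) (2 * INR n); have : INR m <= INR n by apply: le_INR; lia.
lra.
Qed.
Lemma davie_le n : davie q D eps n <= 2 * INR n / q.
Proof.
case: (davie_cases n) => [->|h]; last lra.
by apply: Rdiv_le_0_compat => //; have := pos_INR n; lra.
Qed.
(** If one value vanishes, monotonicity suffices. Otherwise each is at most [2 n / q - 1], and the
    two losses of 1 add up to the loss of 2 in the linear part of [davie]. *)
Lemma davie_super m n : davie q D eps m + davie q D eps n <= davie q D eps (m + n).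
Proof.
case: (davie_cases m) => [->|hm].
  rewrite Rplus_0_l; apply: davie_mono; lia.
case: (davie_cases n) => [->|hn].
  rewrite Rplus_0_r; apply: davie_mono; lia.
apply: Rle_trans (Rmax_r _ _); rewrite plus_INR.
have -> : 2 * (INR m + INR n) / q = 2 * INR m / q + 2 * INR n / q by field; lra.
lra.
Qed.
(** A hit at [S n] lifts the value to at least [2 (n + 1) / q - 1], while before it the value is at
    most [2 (n + 1) / q - 2]: an earlier hit lies at least [q] behind, and without one, [q <= n + 1]
    makes this bound nonnegative. *)
Lemma davie_jump n : D (S n) < eps -> davie q D eps n + 1 <= davie q D eps (S n).
Proof.
move=> h.
apply: Rle_trans (_ : 2 * INR (S n) / q - 1 <= _); last first.
  apply: Rle_trans (Rmax_l _ _); rewrite /last_hit -/last_hit; case: Rlt_dec => // _; exact: Rmax_r.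
have A : q <= INR (S n) by apply: hmin => //; lia.
have E : q / q = 1 by field; lra.
suff : davie q D eps n <= 2 * INR (S n) / q - 2 by lra.
apply: Rmax_lub; last first.
  have := divq_mono (2 * INR n) (2 * INR (S n)); rewrite S_INR; lra.
case: (last_hit_val n) => [->|[m [H1 [H2 ->]]]].
  have := divq_mono (2 * q) (2 * INR (S n)).
  have -> : 2 * q / q = 2 by field; lra.
  lra.
have := hgap m (S n) ltac:(lia) H2 h => g.
have := divq_mono (2 * INR m + 2 * q) (2 * INR (S n)).
have -> : (2 * INR m + 2 * q) / q = 2 * INR m / q + 2 by field; lra.
lra.
Qed.
End Davie.

Lemma term_le_Series (a : nat -> R) j : (forall n, 0 <= a n) -> ex_series a -> a j <= Series a.
Proof.
move=> Ha [l Hl]; rewrite (is_series_unique _ _ Hl).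
have : sum_n a j <= l.
  apply: (is_lim_seq_incr_compare (sum_n a) l) => // n.
  rewrite rsum_S; have := Ha (S n); lra.
case: j => [|j]; first by rewrite sum_O.
rewrite rsum_S; have := rsum_ge0 a j (fun k _ => Ha k); lra.
Qed.

(* The weights [ln (2 / Om (k + 1))] telescope the small divisor along the dyadic scales. *)
Lemma davie_weight (D Om : nat -> R) : (forall k, 0 < Om k <= 2) ->
  (forall k m n, (1 <= m < n)%nat -> D m < Om k / 2 -> D n < Om k / 2 -> INR m + 2 ^ k <= INR n) ->
  (forall k n, (1 <= n)%nat -> D n < Om k / 2 -> 2 ^ k <= INR n) ->
  ex_series (fun k => ln (2 / Om (S k)) / 2 ^ k) ->
  exists (K : nat -> R) (B : R), K 0%nat = 0 /\ (forall n, 0 <= K n) /\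
   (forall m n, K m + K n <= K (m + n)%nat) /\ (forall n, K n <= B * INR n) /\
   (forall n, exp (K n - K (S n)) <= D (S n)).
Proof.
move=> HOm Hgap Hmin Hser.
have p2 k : 0 < 2 ^ k by apply: pow_lt; lra.
pose w k := ln (2 / Om (S k)).
have lnp k : 0 <= ln (2 / Om k).
  case: (HOm k) => h1 h2; rewrite -ln_1.
  apply: ln_le; first lra.
  apply/Rle_div_r => //; lra.
have wp k : 0 <= w k by apply: lnp.
pose N k := davie (2 ^ k) D (Om k / 2).
have N0 k n : 0 <= N k n by apply: davie_ge0.
have wN0 k n : 0 <= w k * N k n by apply: Rmult_le_pos.
have Ex n : ex_series (fun k => w k * N k n).
  apply: (ex_series_le (K := R_AbsRing) (V := R_CompleteNormedModule) _
     (fun k => (2 * INR n) * (w k / 2 ^ k))).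
  - move=> k; rewrite /norm /= /abs /= Rabs_right; last by apply: Rle_ge.
    have := Rmult_le_compat_l _ _ _ (wp k) (davie_le (2 ^ k) D (Om k / 2) (p2 k) n).
    rewrite /N; have -> : w k * (2 * INR n / 2 ^ k) = 2 * INR n * (w k / 2 ^ k) by field; have := p2 k; lra.
    by [].
  - exact: (ex_series_scal (K := R_AbsRing) (V := R_NormedModule)).
(* The linear term [c0 * n] pays for divisors that are hit at no scale, which may still be as small
   as [Om 0 / 2]. *)
pose c0 := ln (2 / Om 0%nat).
have c0p : 0 <= c0 by apply: lnp.
exists (fun n => c0 * INR n + Series (fun k => w k * N k n)),
  (c0 + 2 * Series (fun k => w k / 2 ^ k)).
have Sp n : 0 <= Series (fun k => w k * N k n).
  apply: Rle_trans (wN0 0%nat n) _; exact: (term_le_Series (fun k => w k * N k n) 0).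
split.
  rewrite Rmult_0_r Rplus_0_l; transitivity (Series (fun k => 0 * (w k * N k 0%nat))).
    apply: Series_ext => k; rewrite /N davie_0; ring.
  by rewrite Series_scal_l; ring.
split; first by move=> n; have := Sp n; have := Rmult_le_pos _ _ c0p (pos_INR n); lra.
split.
  move=> m n; rewrite plus_INR.
  have : Series (fun k => w k * N k m) + Series (fun k => w k * N k n) <=
         Series (fun k => w k * N k (m + n)%nat).
    rewrite -Series_plus //; apply: Series_le => // k; split.
      by apply: Rplus_le_le_0_compat.
    rewrite -Rmult_plus_distr_l; apply: Rmult_le_compat_l => //; apply: davie_super; exact: p2.
  lra.
split.
  move=> n; have : Series (fun k => w k * N k n) <= 2 * INR n * Series (fun k => w k / 2 ^ k).
    rewrite -Series_scal_l; apply: Series_le.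
      move=> k; split=> //.
      have -> : 2 * INR n * (w k / 2 ^ k) = w k * (2 * INR n / 2 ^ k) by field; have := p2 k; lra.
      by apply: Rmult_le_compat_l => //; apply: davie_le; apply: p2.
    exact: (ex_series_scal (K := R_AbsRing) (V := R_NormedModule)).
  lra.
move=> n.
have JS : Series (fun k => w k * N k (S n)) - Series (fun k => w k * N k n) =
   Series (fun k => w k * N k (S n) - w k * N k n) by rewrite Series_minus.
have dp k : 0 <= w k * N k (S n) - w k * N k n.
  have := Rmult_le_compat_l _ _ _ (wp k) (davie_mono (2^k) D (Om k / 2) (p2 k) n (S n) ltac:(lia)).
  rewrite /N; lra.
have dex : ex_series (fun k => w k * N k (S n) - w k * N k n).
  exact: (ex_series_minus (K := R_AbsRing) (V := R_NormedModule)).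
(* A hit at scale [j] forces [2^j <= n + 1], hence fine scales are never hit by a given index. *)
have [j Hj] : exists j, ~ (D (S n) < Om j / 2).
  case: (Pow_x_infinity 2 _ (INR (S n) + 1)); first by rewrite Rabs_right; lra.
  move=> j /(_ j (le_n _)); rewrite Rabs_right; last by have := p2 j; lra.
  by move=> h; exists j => hD; have := Hmin j (S n) ltac:(lia) hD; lra.
(* Descend to a scale [i] that is not hit but whose predecessor is. Then the divisor is at least
   [Om i / 2], and the jump at scale [i - 1], of weight [ln (2 / Om i)], pays exactly for it. *)
have [i [Hi Hi']] : exists i, ~ (D (S n) < Om i / 2) /\
     (i = 0%nat \/ exists i', i = S i' /\ D (S n) < Om i' / 2).
  elim: j Hj => [|j IH] Hj; first by exists 0%nat; split=> //; left.
  case: (Rlt_dec (D (S n)) (Om j / 2)) => h; last exact: IH.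
  by exists (S j); split=> //; right; exists j.
have {}Hi : Om i / 2 <= D (S n) by lra.
have Dp : 0 < D (S n) by have := HOm i; lra.
have key : ln (2 / Om i) <= c0 * INR (S n) + Series (fun k => w k * N k (S n)) - 
   (c0 * INR n + Series (fun k => w k * N k n)).
  rewrite S_INR.
  case: Hi' => [->|[i' [-> hi']]].
    rewrite -/c0; have : 0 <= Series (fun k => w k * N k (S n) - w k * N k n).
      apply: Rle_trans (dp 0%nat) _; exact: (term_le_Series (fun k => w k * N k (S n) - w k * N k n) 0).
    lra.
  have := term_le_Series _ i' dp dex.
  have := davie_jump (2 ^ i') D (Om i' / 2) (p2 i') (Hgap i') (Hmin i') n hi'.
  rewrite -/(N i') -/(w i') => h; have := Rmult_le_compat_l _ _ _ (wp i') h.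
  lra.
have -> : D (S n) = exp (ln (D (S n))) by rewrite exp_ln.
have : - ln (2 / Om i) <= ln (D (S n)).
  rewrite -ln_Rinv; last by apply: Rdiv_lt_0_compat; [lra|apply: (proj1 (HOm i))].
  apply: ln_le.
    apply: Rinv_0_lt_compat; apply: Rdiv_lt_0_compat; [lra|apply: (proj1 (HOm i))].
  have -> : / (2 / Om i) = Om i / 2 by field; have := HOm i; lra.
  by [].
move=> h; case: (Rle_lt_or_eq_dec (c0 * INR n + Series (fun k => w k * N k n)
  - (c0 * INR (S n) + Series (fun k => w k * N k (S n)))) (ln (D (S n)))); first lra.
  by move=> hb; left; exact: exp_increasing.
by move=> ->; right.
Qed.

Lemma cis_pow (t : R) n : ((cos t, sin t) ^ n)%C = (cos (INR n * t), sin (INR n * t)).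
Proof.
elim: n => [|n IH]; first by rewrite /= Rmult_0_l cos_0 sin_0.
rewrite Cpow_S IH S_INR.
have -> : (INR n + 1) * t = t + INR n * t by ring.
by rewrite cos_plus sin_plus /Cmult /=; congr pair; ring.
Qed.
Lemma Cmod_cis t : Cmod (cos t, sin t) = 1.
Proof.
rewrite /Cmod /= !Rmult_1_r -sqrt_1; congr sqrt; have := sin2_cos2 t; rewrite /Rsqr; lra.
Qed.

Lemma fold_Rmin_le (l : list R) b x : In x l -> fold_right Rmin b l <= x.
Proof.
elim: l => [//|y l IH] /= [->|h]; first exact: Rmin_l.
apply: Rle_trans (Rmin_r _ _) _; exact: IH.
Qed.
Lemma fold_Rmin_pos (l : list R) b : 0 < b -> (forall x, In x l -> 0 < x) -> 0 < fold_right Rmin b l.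
Proof.
move=> hb; elim: l => [//|y l IH] /= H.
apply: Rmin_pos; [apply: H; by left|apply: IH => x h; apply: H; by right].
Qed.

(** If the power were 1, the half angle formula would give [sin (t / 2) = 0], so [n * theta] would
    be an integer. *)
Lemma irrational_rotation theta n : (forall q : Q, theta <> Q2R q) -> (1 <= n)%nat ->
  ((cos (2 * PI * theta), sin (2 * PI * theta)) ^ n)%C <> RtoC 1.
Proof.
move=> Hq Hn; rewrite cis_pow => -[]; set t := INR n * _ => Hc _.
have : sin (t / 2) = 0.
  have E : cos t = 1 - 2 * sin (t/2) * sin (t/2).
    rewrite -cos_2a_sin; congr cos; field.
  nra.
move/sin_eq_0_0 => [k Hk].
apply: (Hq (Qmake k (Pos.of_nat n))).
have hn : INR n <> 0 by apply: not_0_INR; lia.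
rewrite /Q2R; cbn [Qnum Qden].
have -> : IZR (Z.pos (Pos.of_nat n)) = INR n.
  by rewrite -Znat.positive_nat_Z Nat2Pos.id; [rewrite -INR_IZR_INZ|lia].
have hp := PI_RGT_0.
have : PI * (theta * INR n - IZR k) = 0 by rewrite /t in Hk; lra.
move/Rmult_integral => [|h]; first lra.
by apply: (Rmult_eq_reg_r (INR n)) => //; rewrite Rmult_assoc Rinv_l //; lra.
Qed.

Lemma brjuno_unit lambda : Brjuno lambda -> Cmod lambda = 1 /\
  forall n, (1 <= n)%nat -> (lambda ^ n)%C <> RtoC 1.
Proof.
move=> [theta [Hq [-> _]]]; split; first exact: Cmod_cis.
move=> n; exact: irrational_rotation.
Qed.

(** Two divisors below [Om k / 2] at indices [m < n] give [|lambda^(n - m) - 1| < Om k], hence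
    [n - m >= 2^(k+1)]: the shift [s] cancels in the difference. It only affects the first hit,
    where [n + s >= 2^(k+1)] still yields [n >= 2^k]. The case [s = 1] serves the invariant
    curve. *)
Lemma brjuno_weight_shift lambda s : Brjuno lambda -> (s <= 1)%nat ->
  exists (K : nat -> R) (B : R), K 0%nat = 0 /\ (forall n, 0 <= K n) /\
   (forall m n, K m + K n <= K (m + n)%nat) /\ (forall n, K n <= B * INR n) /\
   (forall n, exp (K n - K (S n)) <= Cmod (lambda ^ (S n + s) - 1)).
Proof.
move=> HB Hs; case: (brjuno_unit _ HB) => L1 Lne.
case: HB => theta [_ [_ Hser]].
pose Om k := omega lambda (2 ^ (k + 1)).
have shift j : Cmod (lambda ^ S j - lambda) = Cmod (lambda ^ j - 1).
  have -> : (lambda ^ S j - lambda = lambda * (lambda ^ j - 1))%C by rewrite Cpow_S; ring.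
  by rewrite Cmod_mult L1 Rmult_1_l.
have pos j : (1 <= j)%nat -> 0 < Cmod (lambda ^ j - 1).
  move=> hj; apply/Cmod_gt_0 => E; apply: (Lne j hj).
  have -> : (lambda ^ j = lambda ^ j - 1 + 1)%C by ring. rewrite E; ring.
(* The exponent [i] in [omega] starts at 2 and corresponds to the divisor of index [j = i - 1],
   which therefore ranges over [1 <= j < 2^(k+1)]. *)
have Omle k j : (1 <= j)%nat -> (j < 2 ^ (k + 1))%nat -> Om k <= Cmod (lambda ^ j - 1).
  move=> h1 h2; rewrite -shift; apply: fold_Rmin_le.
  apply/in_map_iff; exists (S j); split=> //; apply/in_seq; lia.
have p1 k : (1 < 2 ^ (k + 1))%nat.
  by rewrite Nat.add_1_r; apply: Nat.pow_gt_1; lia.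
have Ompos k : 0 < Om k <= 2.
  split.
    apply: fold_Rmin_pos; first by rewrite shift; apply: pos.
    move=> x /in_map_iff [[|i] [<- /in_seq hi]]; first by lia.
    by rewrite shift; apply: pos; lia.
  apply: Rle_trans (Omle k 1%nat (le_n _) (p1 k)) _.
  apply: Rle_trans (Cmod_triangle _ _) _.
  by rewrite Cmod_opp Cmod_1 Cpow_1_r L1; lra.
have pk k : INR (2 ^ k) = 2 ^ k by rewrite pow_INR.
apply: (davie_weight (fun n => Cmod (lambda ^ (n + s) - 1)) Om Ompos).
- move=> k m n mn Hm Hn.
  have h : (2 ^ (k + 1) <= n - m)%nat.
    case: (Nat.le_gt_cases (2 ^ (k + 1)) (n - m)) => // hlt.
    have := Omle k (n - m)%nat ltac:(lia) hlt.
    have : Cmod (lambda ^ (n - m) - 1) = Cmod ((lambda ^ (n + s) - 1) + - (lambda ^ (m + s) - 1)).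
      have -> : (lambda ^ (n + s) - 1 + - (lambda ^ (m + s) - 1) = lambda ^ (m + s) * (lambda ^ (n - m) - 1))%C.
        have -> : (n + s = (m + s) + (n - m))%nat by lia.
        rewrite Cpow_add_r; ring.
      by rewrite Cmod_mult Cmod_pow L1 pow1 Rmult_1_l.
    move=> ->; have := Cmod_triangle (lambda ^ (n + s) - 1) (- (lambda ^ (m + s) - 1)).
    rewrite Cmod_opp; lra.
  rewrite -pk -plus_INR; apply: le_INR.
  have : (2 ^ k <= 2 ^ (k + 1))%nat by apply: Nat.pow_le_mono_r; lia.
  lia.
- move=> k n hn Hn.
  rewrite -pk; apply: le_INR.
  have h2 : (2 ^ (k + 1) = 2 ^ k + 2 ^ k)%nat by rewrite Nat.add_1_r /=; lia.
  have h3 : (0 < 2 ^ k)%nat by have := Nat.pow_nonzero 2 k; lia.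
  case: (Nat.le_gt_cases (2 ^ (k + 1)) (n + s)) => [|hlt]; first lia.
  have := Omle k (n + s)%nat ltac:(lia) hlt; have := Ompos k; lra.
(* Split [ln (2 / Om)] into [ln 2], which gives a geometric series, and [ln (1 / Om)]; passing from
   the term [k + 1] of the Brjuno series to the denominator [2^k] costs a factor 2. *)
- have E1 : ex_series (fun k => ln 2 * (/ 2) ^ k).
    apply: (ex_series_scal (K := R_AbsRing) (V := R_NormedModule)); apply: ex_series_geom.
    rewrite Rabs_right; lra.
  have E2 := proj1 (ex_series_incr_1 _) Hser.
  have := ex_series_plus _ _ E1 (ex_series_scal (K := R_AbsRing) (V := R_NormedModule) 2 _ E2).
  apply: ex_series_ext => k; rewrite /plus /scal /= /mult /= -/(Om (S k)).
  have h := Ompos (S k).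
  have hp := pow_lt 2 k ltac:(lra).
  rewrite /Rdiv (ln_mult 2 (/ Om (S k))); [|lra|by apply: Rinv_0_lt_compat; lra].
  rewrite pow_inv !Rmult_1_l. field; lra.
Qed.

(** * Cauchy's formula *)

Definition ccont (f : R -> C) (t : R) : Prop :=
  forall eps, 0 < eps -> exists del, 0 < del /\
    forall u, Rabs (u - t) < del -> Cmod (f u - f t) < eps.

Lemma ccont_const c t : ccont (fun _ => c) t.
Proof.
move=> eps He; exists 1; split; first lra.
move=> u _; have -> : (c - c = 0)%C by ring. by rewrite Cmod_0.
Qed.
Lemma ccont_plus f g t : ccont f t -> ccont g t -> ccont (fun u => (f u + g u)%C) t.
Proof.
move=> Hf Hg eps He; have He2 : 0 < eps / 2 by lra.
case: (Hf _ He2) => d1 [p1 H1]; case: (Hg _ He2) => d2 [p2 H2].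
exists (Rmin d1 d2); split; first exact: Rmin_pos.
move=> u Hu.
have := H1 u (Rlt_le_trans _ _ _ Hu (Rmin_l _ _)); have := H2 u (Rlt_le_trans _ _ _ Hu (Rmin_r _ _)).
have -> : (f u + g u - (f t + g t) = (f u - f t) + (g u - g t))%C by ring.
have := Cmod_triangle (f u - f t) (g u - g t); lra.
Qed.
Lemma ccont_bdd f t : ccont f t -> exists del, 0 < del /\
  forall u, Rabs (u - t) < del -> Cmod (f u) <= Cmod (f t) + 1.
Proof.
move=> /(_ 1 ltac:(lra)) [d [dp H]]; exists d; split=> // u /H.
have := Cmod_triangle (f u - f t) (f t).
have -> : (f u - f t + f t = f u)%C by ring. lra.
Qed.
Lemma ccont_mult f g t : ccont f t -> ccont g t -> ccont (fun u => (f u * g u)%C) t.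
Proof.
move=> Hf Hg eps He.
case: (ccont_bdd _ _ Hg) => d0 [p0 H0].
have gp := Cmod_ge_0 (g t); have fp := Cmod_ge_0 (f t).
have He1 : 0 < eps / 2 / (Cmod (g t) + 1) by apply: Rdiv_lt_0_compat; lra.
have He2 : 0 < eps / 2 / (Cmod (f t) + 1) by apply: Rdiv_lt_0_compat; lra.
case: (Hf _ He1) => d1 [p1 H1]; case: (Hg _ He2) => d2 [p2 H2].
exists (Rmin d0 (Rmin d1 d2)); split; first by apply: Rmin_pos => //; apply: Rmin_pos.
move=> u Hu.
have := Rmin_l d0 (Rmin d1 d2); have := Rmin_r d0 (Rmin d1 d2).
have := Rmin_l d1 d2; have := Rmin_r d1 d2 => m1 m2 m3 m4.
have h0 := H0 u ltac:(lra); have h1 := H1 u ltac:(lra); have h2 := H2 u ltac:(lra).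
have -> : (f u * g u - f t * g t = (f u - f t) * g u + f t * (g u - g t))%C by ring.
apply: Rle_lt_trans (Cmod_triangle _ _) _; rewrite !Cmod_mult.
have e1 : Cmod (f u - f t) * Cmod (g u) <= Cmod (f u - f t) * (Cmod (g t) + 1).
  by apply: Rmult_le_compat_l => //; apply: Cmod_ge_0.
have e2 : Cmod (f u - f t) * (Cmod (g t) + 1) < eps / 2 / (Cmod (g t) + 1) * (Cmod (g t) + 1).
  by apply: Rmult_lt_compat_r => //; lra.
have e3 : Cmod (f t) * Cmod (g u - g t) <= (Cmod (f t) + 1) * Cmod (g u - g t).
  by apply: Rmult_le_compat_r; [apply: Cmod_ge_0|lra].
have e4 : (Cmod (f t) + 1) * Cmod (g u - g t) < (Cmod (f t) + 1) * (eps / 2 / (Cmod (f t) + 1)).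
  by apply: Rmult_lt_compat_l => //; lra.
have e5 : eps / 2 / (Cmod (g t) + 1) * (Cmod (g t) + 1) = eps / 2 by field; lra.
have e6 : (Cmod (f t) + 1) * (eps / 2 / (Cmod (f t) + 1)) = eps / 2 by field; lra.
lra.
Qed.
Lemma ccont_inv g t : ccont g t -> g t <> RtoC 0 -> ccont (fun u => (/ g u)%C) t.
Proof.
move=> Hg g0 eps He.
have gp : 0 < Cmod (g t) by apply/Cmod_gt_0.
have He1 : 0 < Cmod (g t) / 2 by lra.
have He2 : 0 < eps * (Cmod (g t) * (Cmod (g t) / 2)).
  by apply: Rmult_lt_0_compat => //; apply: Rmult_lt_0_compat.
case: (Hg _ He1) => d1 [p1 H1]; case: (Hg _ He2) => d2 [p2 H2].
exists (Rmin d1 d2); split; first exact: Rmin_pos.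
move=> u Hu.
have h1 := H1 u (Rlt_le_trans _ _ _ Hu (Rmin_l _ _)); have h2 := H2 u (Rlt_le_trans _ _ _ Hu (Rmin_r _ _)).
have gu : Cmod (g t) / 2 < Cmod (g u).
  have := Cmod_triangle (g u) (- (g u - g t)); rewrite Cmod_opp.
  have -> : (g u + - (g u - g t) = g t)%C by ring. lra.
have gu0 : g u <> RtoC 0 by apply/Cmod_gt_0; lra.
have -> : (/ g u - / g t = - (g u - g t) * / (g t * g u))%C by field.
rewrite Cmod_mult Cmod_opp Cmod_inv; last by apply: Cmult_neq_0.
rewrite Cmod_mult; apply/Rlt_div_l; first by apply: Rlt_gt; apply: Rmult_lt_0_compat; lra.
apply: Rlt_trans h2 _; apply: Rmult_lt_compat_l => //; apply: Rmult_lt_compat_l => //.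
Qed.
Lemma ccont_minus f g t : ccont f t -> ccont g t -> ccont (fun u => (f u - g u)%C) t.
Proof.
move=> Hf Hg.
have -> : (fun u => (f u - g u)%C) = (fun u => (f u + (RtoC (-1)) * g u)%C).
  apply: FunctionalExtensionality.functional_extensionality => u; ring.
by apply: ccont_plus => //; apply: ccont_mult => //; apply: ccont_const.
Qed.
Lemma ccont_id t : ccont RtoC t.
Proof.
move=> eps He; exists eps; split=> // u Hu.
by rewrite -RtoC_minus Cmod_R.
Qed.
Lemma ccont_fst f t : ccont f t -> continuous (fun u => fst (f u)) t.
Proof.
move=> H P [eps HP]; case: (H eps (cond_pos eps)) => d [dp Hd].
exists (mkposreal d dp) => u Hu; apply: HP.
by apply: Rle_lt_trans (Hd u Hu); apply: (re_le_Cmod (f u - f t)%C).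
Qed.
Lemma ccont_snd f t : ccont f t -> continuous (fun u => snd (f u)) t.
Proof.
move=> H P [eps HP]; case: (H eps (cond_pos eps)) => d [dp Hd].
exists (mkposreal d dp) => u Hu; apply: HP.
by apply: Rle_lt_trans (Hd u Hu); apply: (im_le_Cmod (f u - f t)%C).
Qed.
Lemma ccont_pair (x y : R -> R) t : continuous x t -> continuous y t -> ccont (fun u => (x u, y u)) t.
Proof.
move=> Hx Hy eps He; have He2 : 0 < eps / 2 by lra.
have := Hx _ (locally_ball (x t) (mkposreal _ He2)) => -[d1 H1].
have := Hy _ (locally_ball (y t) (mkposreal _ He2)) => -[d2 H2].
exists (Rmin d1 d2); split; first by apply: Rmin_pos; apply: cond_pos.
move=> u Hu; apply: Rle_lt_trans (Cmod_le_abs _) _.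
have h1 := H1 u (Rlt_le_trans _ _ _ Hu (Rmin_l _ _)); have h2 := H2 u (Rlt_le_trans _ _ _ Hu (Rmin_r _ _)).
rewrite /ball /= /AbsRing_ball /abs /minus /plus /opp /= in h1, h2.
rewrite /=; lra.
Qed.
Lemma ccont_pow f t n : ccont f t -> ccont (fun u => (f u ^ n)%C) t.
Proof.
move=> H; elim: n => [|n IH]; first exact: ccont_const.
have -> : (fun u => (f u ^ S n)%C) = (fun u => (f u * f u ^ n)%C).
  apply: FunctionalExtensionality.functional_extensionality => u; exact: Cpow_S.
exact: ccont_mult.
Qed.

Definition cint (f : R -> C) (a b : R) : C :=
  (RInt (fun t => fst (f t)) a b, RInt (fun t => snd (f t)) a b).
Definition cont_on (f : R -> C) a b := forall t, a <= t <= b -> ccont f t.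

Lemma cont_on_ex_RInt f a b : a <= b -> cont_on f a b ->
  ex_RInt (fun t => fst (f t)) a b /\ ex_RInt (fun t => snd (f t)) a b.
Proof.
move=> ab H; split; apply: (ex_RInt_continuous (V := R_CompleteNormedModule)) => t;
rewrite Rmin_left // Rmax_right // => Ht; [apply: ccont_fst|apply: ccont_snd]; exact: H.
Qed.
Lemma cont_on_sub f a b c d : a <= c -> d <= b -> cont_on f a b -> cont_on f c d.
Proof. by move=> ac db H t Ht; apply: H; lra. Qed.

Lemma cint_ext f g a b : a <= b -> (forall t, a <= t <= b -> f t = g t) -> cint f a b = cint g a b.
Proof.
move=> ab H; rewrite /cint; congr pair; apply: RInt_ext => t;
rewrite Rmin_left // Rmax_right // => Ht; rewrite H //; lra.
Qed.
Lemma cint_plus f g a b : a <= b -> cont_on f a b -> cont_on g a b ->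
  cint (fun t => (f t + g t)%C) a b = (cint f a b + cint g a b)%C.
Proof.
move=> ab Hf Hg; case: (cont_on_ex_RInt _ _ _ ab Hf) => f1 f2; case: (cont_on_ex_RInt _ _ _ ab Hg) => g1 g2.
rewrite /cint /Cplus /=; congr pair.
  exact: (RInt_plus (V := R_CompleteNormedModule)).
exact: (RInt_plus (V := R_CompleteNormedModule)).
Qed.
Lemma cint_scal (c : C) f a b : a <= b -> cont_on f a b ->
  cint (fun t => (c * f t)%C) a b = (c * cint f a b)%C.
Proof.
move=> ab Hf; case: (cont_on_ex_RInt _ _ _ ab Hf) => f1 f2.
have S1 k := ex_RInt_scal (V := R_NormedModule) _ _ _ k f1.
have S2 k := ex_RInt_scal (V := R_NormedModule) _ _ _ k f2.
rewrite /cint /Cmult /=; congr pair.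
- transitivity (minus (RInt (fun t => scal (fst c) (fst (f t))) a b)
     (RInt (fun t => scal (snd c) (snd (f t))) a b)).
    exact: (RInt_minus (V := R_CompleteNormedModule) _ _ _ _ (S1 _) (S2 _)).
  by rewrite (RInt_scal (V := R_CompleteNormedModule) _ _ _ _ f1)
     (RInt_scal (V := R_CompleteNormedModule) _ _ _ _ f2).
- transitivity (plus (RInt (fun t => scal (fst c) (snd (f t))) a b)
     (RInt (fun t => scal (snd c) (fst (f t))) a b)).
    exact: (RInt_plus (V := R_CompleteNormedModule) _ _ _ _ (S2 _) (S1 _)).
  by rewrite (RInt_scal (V := R_CompleteNormedModule) _ _ _ _ f1)
     (RInt_scal (V := R_CompleteNormedModule) _ _ _ _ f2).
Qed.
Lemma cont_on_scal (c : C) f a b : cont_on f a b -> cont_on (fun t => (c * f t)%C) a b.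
Proof. by move=> H t Ht; apply: ccont_mult; [exact: ccont_const|exact: H]. Qed.
Lemma cint_minus f g a b : a <= b -> cont_on f a b -> cont_on g a b ->
  cint (fun t => (f t - g t)%C) a b = (cint f a b - cint g a b)%C.
Proof.
move=> ab Hf Hg.
rewrite (cint_ext _ (fun t => (f t + RtoC (-1) * g t)%C)) //; last by move=> t _; ring.
by rewrite cint_plus ?cint_scal //; [ring|exact: cont_on_scal].
Qed.
Lemma cint_Chasles f a b c : a <= b -> b <= c -> cont_on f a c ->
  cint f a c = (cint f a b + cint f b c)%C.
Proof.
move=> ab bc H.
case: (cont_on_ex_RInt f a b ab (cont_on_sub _ _ _ _ _ (Rle_refl a) bc H)) => f1 f2.
case: (cont_on_ex_RInt f b c bc (cont_on_sub _ _ _ _ _ ab (Rle_refl c) H)) => g1 g2.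
rewrite /cint /Cplus /=; congr pair; symmetry;
exact: (RInt_Chasles (V := R_CompleteNormedModule)).
Qed.
Lemma cint_const (c : C) a b : cint (fun _ => c) a b = (RtoC (b - a) * c)%C.
Proof.
rewrite /cint !(RInt_const (V := R_CompleteNormedModule)) /scal /= /mult /=.
rewrite /Cmult /=; congr pair; ring.
Qed.
(** The factor 2 comes from bounding real and imaginary parts separately; sharp constants are
    irrelevant for convergence. *)
Lemma cint_bound f a b M : a <= b -> cont_on f a b -> (forall t, a <= t <= b -> Cmod (f t) <= M) ->
  Cmod (cint f a b) <= 2 * (M * (b - a)).
Proof.
move=> ab Hf HM; case: (cont_on_ex_RInt _ _ _ ab Hf) => f1 f2.
apply: Rle_trans (Cmod_le_abs _) _; rewrite /=.
have h1 : Rabs (RInt (fun t => fst (f t)) a b) <= (b - a) * M.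
  apply: abs_RInt_le_const => // t Ht; apply: Rle_trans (re_le_Cmod _) _; exact: HM.
have h2 : Rabs (RInt (fun t => snd (f t)) a b) <= (b - a) * M.
  apply: abs_RInt_le_const => // t Ht; apply: Rle_trans (im_le_Cmod _) _; exact: HM.
lra.
Qed.

Lemma nested_limit (a : nat -> R) (w : R) : 0 <= w ->
  (forall n, a n <= a (S n)) -> (forall n, a (S n) + w / 2 ^ (S n) <= a n + w / 2 ^ n) ->
  exists u, forall n, a n <= u <= a n + w / 2 ^ n.
Proof.
move=> Hw Hi Hd.
have wp n : 0 <= w / 2 ^ n by apply: Rdiv_le_0_compat => //; apply: pow_lt; lra.
have Mi n m : (n <= m)%nat -> a n <= a m.
  elim=> [|m' _ IH]; first lra. have := Hi m'; lra.
have Md n m : (n <= m)%nat -> a m + w / 2 ^ m <= a n + w / 2 ^ n.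
  elim=> [|m' _ IH]; first lra. have := Hd m'; lra.
have Ub n : forall x, (exists m, x = a m) -> x <= a n + w / 2 ^ n.
  move=> x [m ->]; case: (Nat.le_gt_cases n m) => h.
    have := Md _ _ h; have := wp m; lra.
  have := Mi m n ltac:(lia); have := wp n; lra.
case: (completeness (fun x => exists m, x = a m)).
- by exists (a 0%nat + w / 2 ^ 0); apply: Ub.
- by exists (a 0%nat); exists 0%nat.
- move=> u [U1 U2]; exists u => n; split; first by apply: U1; exists n.
  by apply: U2; apply: Ub.
Qed.

(** The compactness principle behind Goursat: a property of rectangles of fixed shape that passes
    from four quarters to the whole and holds for small rectangles around each point holds for the
    whole. Otherwise nested bad quarters would shrink to a point. *)
Lemma bisect2 (P : R -> R -> R -> Prop) (h k a0 c0 : R) : 0 <= h -> 0 <= k ->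
  (forall a c th, 0 < th -> P a c (th / 2) -> P (a + h * (th / 2)) c (th / 2) ->
     P a (c + k * (th / 2)) (th / 2) -> P (a + h * (th / 2)) (c + k * (th / 2)) (th / 2) -> P a c th) ->
  (forall u v, a0 <= u <= a0 + h -> c0 <= v <= c0 + k -> exists del, 0 < del /\
     forall a c th, 0 < th < del -> a <= u <= a + h * th -> c <= v <= c + k * th -> P a c th) ->
  P a0 c0 1.
Proof.
move=> Hh Hk Hdiv Hloc.
case: (classic (P a0 c0 1)) => // HN; exfalso.
have pn n : 0 < / 2 ^ n by apply: Rinv_0_lt_compat; apply: pow_lt; lra.
have half n : / 2 ^ (S n) = / 2 ^ n / 2 by rewrite /=; field; apply: pow_nonzero; lra.
(* The badness of [x] is put inside the existential, so that the choice of a next quarter is a total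
   function of [x]. *)
have step (n : nat) (x : R * R) : exists y : R * R, ~ P (fst x) (snd x) (/ 2 ^ n) ->
   ~ P (fst y) (snd y) (/ 2 ^ S n) /\
   (fst y = fst x \/ fst y = fst x + h * / 2 ^ S n) /\
   (snd y = snd x \/ snd y = snd x + k * / 2 ^ S n).
  case: x => a c /=.
  case: (classic (P a c (/ 2 ^ n))) => H; first by exists (a, c).
  have T : ~ (P a c (/ 2 ^ S n) /\ P (a + h * / 2 ^ S n) c (/ 2 ^ S n) /\
     P a (c + k * / 2 ^ S n) (/ 2 ^ S n) /\ P (a + h * / 2 ^ S n) (c + k * / 2 ^ S n) (/ 2 ^ S n)).
    rewrite half => -[h1 [h2 [h3 h4]]]; apply: H; exact: Hdiv.
  case: (classic (P a c (/ 2 ^ S n))) => H1; last first.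
    by exists (a, c) => _; split=> //; split; left.
  case: (classic (P (a + h * / 2 ^ S n) c (/ 2 ^ S n))) => H2; last first.
    by exists (a + h * / 2 ^ S n, c) => _; split=> //; split; [right|left].
  case: (classic (P a (c + k * / 2 ^ S n) (/ 2 ^ S n))) => H3; last first.
    by exists (a, c + k * / 2 ^ S n) => _; split=> //; split; [left|right].
  case: (classic (P (a + h * / 2 ^ S n) (c + k * / 2 ^ S n) (/ 2 ^ S n))) => H4; last first.
    by exists (a + h * / 2 ^ S n, c + k * / 2 ^ S n) => _; split=> //; split; right.
  by case: T.
pose nx n x := proj1_sig (constructive_indefinite_description _ (step n x)).
have Hnx n x : ~ P (fst x) (snd x) (/ 2 ^ n) ->
   ~ P (fst (nx n x)) (snd (nx n x)) (/ 2 ^ S n) /\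
   (fst (nx n x) = fst x \/ fst (nx n x) = fst x + h * / 2 ^ S n) /\
   (snd (nx n x) = snd x \/ snd (nx n x) = snd x + k * / 2 ^ S n).
  rewrite /nx; case: constructive_indefinite_description => y /= Hy; exact: Hy.
pose X := fix X n := match n with O => (a0, c0) | S n => nx n (X n) end.
have HX n : ~ P (fst (X n)) (snd (X n)) (/ 2 ^ n).
  elim: n => [|n IH]; first by rewrite /= Rinv_1.
  exact: (proj1 (Hnx n (X n) IH)).
have hp n : 0 <= h * / 2 ^ S n by apply: Rmult_le_pos => //; left.
have kp n : 0 <= k * / 2 ^ S n by apply: Rmult_le_pos => //; left.
have hh n : h / 2 ^ n = h * / 2 ^ S n + h * / 2 ^ S n by rewrite half /Rdiv; field; apply: pow_nonzero; lra.
have kh n : k / 2 ^ n = k * / 2 ^ S n + k * / 2 ^ S n by rewrite half /Rdiv; field; apply: pow_nonzero; lra.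
have XS n : X (S n) = nx n (X n) by [].
case: (nested_limit (fun n => fst (X n)) h Hh) => [n|n|u Hu].
- rewrite XS; have := hp n; case: (proj1 (proj2 (Hnx n (X n) (HX n)))) => ->; lra.
- rewrite XS; have := hp n; have := hh n; rewrite /Rdiv.
  case: (proj1 (proj2 (Hnx n (X n) (HX n)))) => ->; lra.
case: (nested_limit (fun n => snd (X n)) k Hk) => [n|n|v Hv].
- rewrite XS; have := kp n; case: (proj2 (proj2 (Hnx n (X n) (HX n)))) => ->; lra.
- rewrite XS; have := kp n; have := kh n; rewrite /Rdiv.
  case: (proj2 (proj2 (Hnx n (X n) (HX n)))) => ->; lra.
have := Hu 0%nat; have := Hv 0%nat; rewrite /= /Rdiv Rinv_1 !Rmult_1_r => Hv0 Hu0.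
case: (Hloc u v Hu0 Hv0) => del [dp Hdel].
case: (pow_small del dp) => n Hn.
apply: (HX n); apply: Hdel; [|exact: Hu|exact: Hv].
split=> //; apply: Rle_lt_trans Hn.
rewrite -pow_inv; apply: pow_incr; lra.
Qed.

Definition cderivable (f : C -> C) (x : C) : Prop := exists l : C, forall eps, 0 < eps ->
  exists del, 0 < del /\ forall y, Cmod (y - x) < del ->
    Cmod (f y - f x - l * (y - x)) <= eps * Cmod (y - x).

Lemma cderivable_cont f x : cderivable f x -> forall eps, 0 < eps -> exists del, 0 < del /\
  forall y, Cmod (y - x) < del -> Cmod (f y - f x) < eps.
Proof.
move=> [l Hl] eps He; case: (Hl 1 ltac:(lra)) => d [dp Hd].
have lp := Cmod_ge_0 l.
have ep : 0 < eps / (Cmod l + 2) by apply: Rdiv_lt_0_compat; lra.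
exists (Rmin d (eps / (Cmod l + 2))); split; first exact: Rmin_pos.
move=> y Hy; have := Hd y (Rlt_le_trans _ _ _ Hy (Rmin_l _ _)).
have h2 := Rlt_le_trans _ _ _ Hy (Rmin_r _ _).
have := Cmod_triangle (f y - f x - l * (y - x)) (l * (y - x)).
have -> : (f y - f x - l * (y - x) + l * (y - x) = f y - f x)%C by ring.
rewrite Cmod_mult => h3 h4.
have : (Cmod l + 2) * Cmod (y - x) < (Cmod l + 2) * (eps / (Cmod l + 2)).
  by apply: Rmult_lt_compat_l; lra.
have -> : (Cmod l + 2) * (eps / (Cmod l + 2)) = eps by field; lra.
have := Cmod_ge_0 (y - x); lra.
Qed.

Lemma ccont_comp f g t : cderivable f (g t) -> ccont g t -> ccont (fun u => f (g u)) t.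
Proof.
move=> Hf Hg eps He; case: (cderivable_cont _ _ Hf eps He) => d [dp Hd].
case: (Hg d dp) => d' [dp' Hd']; exists d'; split=> // u /Hd'; exact: Hd.
Qed.

Definition circ (r t : R) : C := (r * cos t, r * sin t).
Lemma Cmod_circ r t : 0 <= r -> Cmod (circ r t) = r.
Proof.
move=> Hr; have -> : circ r t = (RtoC r * (cos t, sin t))%C.
  by rewrite /circ /Cmult /=; congr pair; ring.
by rewrite Cmod_mult Cmod_R Rabs_right ?Cmod_cis; lra.
Qed.
Lemma ccont_circ r t : ccont (circ r) t.
Proof.
apply: ccont_pair; apply: (continuous_mult (K := R_AbsRing)); try exact: continuous_const.
  by apply: continuous_cos.
by apply: continuous_sin.
Qed.
Lemma cint_dcirc r a b : a <= b -> cint (fun t => (Ci * circ r t)%C) a b = (circ r b - circ r a)%C.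
Proof.
move=> ab; rewrite /cint /circ /Cminus /Cplus /Copp /=; congr pair.
- apply: is_RInt_unique.
  apply: (is_RInt_ext (fun t => r * - sin t)); first by move=> x _ /=; rring.
  apply: (is_RInt_derive (V := R_CompleteNormedModule) (fun t => r * cos t)).
    move=> x _; auto_derive => //; rring.
  move=> x _; apply: (continuous_mult (K := R_AbsRing)); first exact: continuous_const.
  apply: (continuous_opp (V := R_NormedModule)); exact: continuous_sin.
- apply: is_RInt_unique.
  apply: (is_RInt_ext (fun t => r * cos t)); first by move=> x _ /=; rring.
  apply: (is_RInt_derive (V := R_CompleteNormedModule) (fun t => r * sin t)).
    move=> x _; auto_derive => //; rring.
  move=> x _; apply: (continuous_mult (K := R_AbsRing)); first exact: continuous_const.
  exact: continuous_cos.
Qed.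

(* Goursat on the rectangle [s in [0,1]], [t in [0, 2 PI]] parametrising the homotopy from the
   circle to the point [z]; at [s = 0] the integral is that of the constant [f z]. *)
Section Goursat.
Context (f : C -> C) (z : C) (r R0 : R).
Context (zr : Cmod z < r) (rR : r < R0).
Context (Hf : forall x, Cmod x < R0 -> cderivable f x).

Definition toward (s t : R) : C := (z + RtoC s * (circ r t - z))%C.
Definition cauchy_kernel (t : R) : C := (Ci * circ r t / (circ r t - z))%C.
Definition homotopy_integrand (s : R) (t : R) : C := (f (toward s t) * cauchy_kernel t)%C.

Let r0 : 0 < r.
Proof. have := Cmod_ge_0 z; lra. Qed.
Lemma circ_z t : r - Cmod z <= Cmod (circ r t - z) <= 2 * r.
Proof.
have := Cmod_triangle (circ r t - z) z; have := Cmod_triangle (circ r t) (- z).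
have -> : (circ r t - z + z = circ r t)%C by ring.
rewrite -/(Cminus _ _) Cmod_opp Cmod_circ; last lra. by move=> h1 h2; split; lra.
Qed.
Lemma circ_z0 t : (circ r t - z)%C <> RtoC 0.
Proof. apply/Cmod_gt_0; have := circ_z t; lra. Qed.
Lemma cauchy_kernel_le t : Cmod (cauchy_kernel t) <= r / (r - Cmod z).
Proof.
rewrite /cauchy_kernel Cmod_div; last exact: circ_z0.
rewrite Cmod_mult Cmod_Ci Rmult_1_l Cmod_circ; last lra.
apply: Rmult_le_compat_l; first lra.
apply: Rinv_le_contravar; have := circ_z t; lra.
Qed.
Lemma toward_in s t : 0 <= s <= 1 -> Cmod (toward s t) < R0.
Proof.
move=> Hs; apply: Rle_lt_trans rR.
have -> : toward s t = (RtoC (1 - s) * z + RtoC s * circ r t)%C.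
  rewrite /toward RtoC_minus; ring.
apply: Rle_trans (Cmod_triangle _ _) _; rewrite !Cmod_mult !Cmod_R Cmod_circ; last lra.
rewrite !Rabs_right; [nra|lra|lra].
Qed.
Lemma cauchy_kernel_cont t : ccont cauchy_kernel t.
Proof.
apply: ccont_mult; first by apply: ccont_mult; [exact: ccont_const|exact: ccont_circ].
apply: ccont_inv; last exact: circ_z0.
by apply: ccont_minus; [exact: ccont_circ|exact: ccont_const].
Qed.
Lemma f_toward_cont_t s t : 0 <= s <= 1 -> ccont (fun t => f (toward s t)) t.
Proof.
move=> Hs; apply: (ccont_comp f (toward s)); first by apply: Hf; apply: toward_in.
apply: ccont_plus; first exact: ccont_const.
apply: ccont_mult; first exact: ccont_const.
by apply: ccont_minus; [exact: ccont_circ|exact: ccont_const].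
Qed.
Lemma f_toward_cont_s s t : 0 <= s <= 1 -> ccont (fun s => f (toward s t)) s.
Proof.
move=> Hs; apply: (ccont_comp f (fun s => toward s t)); first by apply: Hf; apply: toward_in.
apply: ccont_plus; first exact: ccont_const.
by apply: ccont_mult; [exact: ccont_id|exact: ccont_const].
Qed.
Lemma homotopy_integrand_cont s a b : 0 <= s <= 1 -> cont_on (homotopy_integrand s) a b.
Proof. by move=> Hs t _; apply: ccont_mult; [exact: f_toward_cont_t|exact: cauchy_kernel_cont]. Qed.

(** Along [zeta = toward s t] one has [d zeta / (zeta - z) = cauchy_kernel t dt + ds / s]. This is
    the [ds] part, taken as the difference between the sides [t = d] and [t = c]; dividing by [s] is
    why rectangles stay away from [s = 0]. *)
Definition side_form (c d s : R) : C := ((f (toward s d) - f (toward s c)) / RtoC s)%C.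
Lemma side_form_cont c d a b : 0 < a -> b <= 1 -> cont_on (side_form c d) a b.
Proof.
move=> Ha Hb s Hs; apply: ccont_mult.
  by apply: ccont_minus; apply: f_toward_cont_s; lra.
apply: ccont_inv; first exact: ccont_id.
by move=> E; have := RtoC_inj _ _ E; lra.
Qed.

Definition boundary_integral (a b c d : R) : C :=
  (cint (fun t => homotopy_integrand b t - homotopy_integrand a t)%C c d - cint (side_form c d) a b)%C.

Lemma boundary_split_s a m b c d : 0 < a -> a <= m <= b -> b <= 1 -> c <= d ->
  boundary_integral a b c d = (boundary_integral a m c d + boundary_integral m b c d)%C.
Proof.
move=> Ha Hm Hb cd; rewrite /boundary_integral (cint_Chasles _ a m b); [|lra|lra|exact: side_form_cont].
have W s : 0 <= s <= 1 -> cont_on (homotopy_integrand s) c d by move=> Hs; apply: homotopy_integrand_cont.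
rewrite !cint_minus //; try (apply: W; lra). ring.
Qed.
Lemma boundary_split_t a b c m d : 0 < a -> a <= b -> b <= 1 -> c <= m <= d ->
  boundary_integral a b c d = (boundary_integral a b c m + boundary_integral a b m d)%C.
Proof.
move=> Ha ab Hb Hm; rewrite /boundary_integral (cint_Chasles _ c m d); [|lra|lra|].
  rewrite (cint_ext (side_form c d) (fun s => side_form c m s + side_form m d s)%C) //; last first.
    move=> t Ht; rewrite /side_form; field; move=> E; have := RtoC_inj _ _ E; lra.
  rewrite cint_plus //; try exact: side_form_cont. ring.
by move=> t Ht; apply: ccont_minus; apply: (homotopy_integrand_cont _ c d) => //; lra.
Qed.

Lemma circ_lip t v : Cmod (circ r t - circ r v) <= 2 * r * Rabs (t - v).
Proof.
have X a b : a <= b -> Cmod (circ r b - circ r a) <= 2 * r * (b - a).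
  move=> ab; rewrite -cint_dcirc // Rmult_assoc; apply: cint_bound => //.
    by move=> x _; apply: ccont_mult; [exact: ccont_const|exact: ccont_circ].
  by move=> x _; rewrite Cmod_mult Cmod_Ci Cmod_circ; lra.
case: (Rle_dec v t) => h; first by rewrite Rabs_right; [exact: X|lra].
rewrite Rabs_left; last lra.
have := X t v ltac:(lra).
have -> : (circ r v - circ r t = - (circ r t - circ r v))%C by ring.
rewrite Cmod_opp; lra.
Qed.

Lemma toward_lip s t u v : 0 <= u <= 1 ->
  Cmod (toward s t - toward u v) <= 2 * r * (Rabs (s - u) + Rabs (t - v)).
Proof.
move=> Hu.
have -> : (toward s t - toward u v = RtoC (s - u) * (circ r t - z) + RtoC u * (circ r t - circ r v))%C.
  rewrite /toward RtoC_minus; ring.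
apply: Rle_trans (Cmod_triangle _ _) _; rewrite !Cmod_mult !Cmod_R.
have h1 := Rmult_le_compat_l _ _ _ (Rabs_pos (s - u)) (proj2 (circ_z t)).
have h2 := circ_lip t v.
have : Rabs u * Cmod (circ r t - circ r v) <= 1 * Cmod (circ r t - circ r v).
  by apply: Rmult_le_compat_r; [apply: Cmod_ge_0|rewrite Rabs_right; lra].
lra.
Qed.

Lemma boundary_zero s0 : 0 < s0 < 1 -> boundary_integral s0 1 0 (2 * PI) = RtoC 0.
Proof.
move=> Hs0.
have pip := PI_RGT_0.
pose h := 1 - s0; pose k := 2 * PI.
have hp : 0 < h by rewrite /h; lra.
have kp : 0 < k by rewrite /k; lra.
pose C1 := 2 * r * (h + k).
have C1p : 0 < C1 by apply: Rmult_lt_0_compat; lra.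
pose Om := r / (r - Cmod z).
have Omp : 0 < Om by apply: Rdiv_lt_0_compat; lra.
(* A rectangle of scale [th] has image of size at most [C1 * th], on which [f] is affine up to
   [eps * C1 * th]. The factor 4 combines the 2 of [cint_bound] with the two ends of each
   difference; [Om] and [/ s0] bound the two parts of the form. *)
pose C2 := 4 * C1 * (Om * k + h / s0).
have hs : 0 < h / s0 by apply: Rdiv_lt_0_compat; lra.
have C2p : 0 < C2.
  apply: Rmult_lt_0_compat; first lra. have := Rmult_lt_0_compat _ _ Omp kp; lra.
have key eps : 0 < eps -> Cmod (boundary_integral s0 1 0 (2 * PI)) <= eps * C2.
  move=> He.
  pose P a c th := s0 <= a -> a + h * th <= 1 -> 0 <= c -> c + k * th <= 2 * PI ->
     Cmod (boundary_integral a (a + h * th) c (c + k * th)) <= eps * C2 * (th * th).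
  have : P s0 0 1; last first.
    move=> H; have := H (Rle_refl _) ltac:(rewrite /h; lra) (Rle_refl _) ltac:(rewrite /k; lra).
    rewrite !Rmult_1_r Rplus_0_l; have -> : s0 + h = 1 by rewrite /h; ring. by [].
  apply: (bisect2 P h k s0 0); [lra|lra| |].
  - move=> a c th Hth H1 H2 H3 H4 ha hb hc hd.
    have hth : 0 < h * (th / 2) by apply: Rmult_lt_0_compat; lra.
    have kth : 0 < k * (th / 2) by apply: Rmult_lt_0_compat; lra.
    have eh : a + h * th = a + h * (th / 2) + h * (th / 2) by field.
    have ek : c + k * th = c + k * (th / 2) + k * (th / 2) by field.
    rewrite (boundary_split_s _ (a + h * (th / 2))); [|lra..].
    rewrite (boundary_split_t _ _ _ (c + k * (th / 2))); [|lra..].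
    rewrite (boundary_split_t _ (a + h * th) _ (c + k * (th / 2))); [|lra..].
    rewrite eh ek in hb hd |- *.
    have {}H1 := H1 ltac:(lra) ltac:(lra) ltac:(lra) ltac:(lra).
    have {}H2 := H2 ltac:(lra) ltac:(lra) ltac:(lra) ltac:(lra).
    have {}H3 := H3 ltac:(lra) ltac:(lra) ltac:(lra) ltac:(lra).
    have {}H4 := H4 ltac:(lra) ltac:(lra) ltac:(lra) ltac:(lra).
    apply: Rle_trans (Cmod_triangle _ _) _.
    have T1 := Cmod_triangle (boundary_integral a (a + h * (th / 2)) c (c + k * (th / 2)))
      (boundary_integral a (a + h * (th / 2)) (c + k * (th / 2)) (c + k * (th / 2) + k * (th / 2))).
    have T2 := Cmod_triangle (boundary_integral (a + h * (th / 2)) (a + h * (th / 2) + h * (th / 2)) c (c + k * (th / 2)))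
      (boundary_integral (a + h * (th / 2)) (a + h * (th / 2) + h * (th / 2)) (c + k * (th / 2)) (c + k * (th / 2) + k * (th / 2))).
    lra.
  - move=> u v; rewrite /h /k => Hu Hv; rewrite -/h -/k.
    have u01 : 0 <= u <= 1 by lra.
    case: (Hf (toward u v) (toward_in u v u01)) => l /(_ eps He) [d1 [d1p Hd1]].
    exists (d1 / C1); split; first exact: Rdiv_lt_0_compat.
    move=> a c th [th0 thd] Hau Hcv ha hb hc hd.
    have thd1 : C1 * th < d1.
      have := Rmult_lt_compat_l _ _ _ C1p thd.
      have -> : C1 * (d1 / C1) = d1 by field; lra. by [].
    have hth : 0 < h * th by apply: Rmult_lt_0_compat.
    have kth : 0 < k * th by apply: Rmult_lt_0_compat.
    set b := a + h * th in hb Hau |- *; set d := c + k * th in hd Hcv |- *.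
    (* The remainder of [f] after its affine approximation at [toward u v]; the constant term drops
       out of the differences below. *)
    pose e s t := (f (toward s t) - f (toward u v) - l * (toward s t - toward u v))%C.
    have He' s t : a <= s <= b -> c <= t <= d -> Cmod (e s t) <= eps * (C1 * th).
      move=> Hs Ht.
      have L : Cmod (toward s t - toward u v) <= C1 * th.
        apply: Rle_trans (toward_lip s t u v u01) _; rewrite /C1 !Rmult_assoc.
        do 2 (apply: Rmult_le_compat_l; first lra).
        have : Rabs (s - u) <= h * th by apply: Rabs_le; rewrite /b in Hs Hau; lra.
        have : Rabs (t - v) <= k * th by apply: Rabs_le; rewrite /d in Ht Hcv; lra.
        lra.
      apply: Rle_trans (Hd1 (toward s t) _) _; first lra.
      by apply: Rmult_le_compat_l; lra.
    have ab : a <= b by rewrite /b; lra.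
    have cd : c <= d by rewrite /d; lra.
    have Ap : 0 <= eps * (C1 * th).
      by apply: Rmult_le_pos; [lra|apply: Rmult_le_pos; lra].
    have conw : cont_on (fun t => homotopy_integrand b t - homotopy_integrand a t)%C c d.
      by move=> t Ht; apply: ccont_minus; apply: (homotopy_integrand_cont _ c d) => //; lra.
    (* The linear part contributes [l (b - a) (circ r d - circ r c)] to each of the two pairs of
       opposite sides, so it cancels in [boundary_integral] and only the remainder is left. *)
    have B1 : Cmod (cint (fun t => homotopy_integrand b t - homotopy_integrand a t)%C c d -
          l * RtoC (b - a) * (circ r d - circ r c)) <= 2 * (2 * (eps * (C1 * th)) * Om * (k * th)).
      rewrite -cint_dcirc // -cint_scal //; last first.
        by move=> t Ht; apply: ccont_mult; [exact: ccont_const|exact: ccont_circ].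
      rewrite -cint_minus //; last first.
        move=> t Ht; apply: ccont_mult; first exact: ccont_const.
        by apply: ccont_mult; [exact: ccont_const|exact: ccont_circ].
      rewrite (cint_ext _ (fun t => (e b t - e a t) * cauchy_kernel t)%C) //; last first.
        move=> t Ht; rewrite /e /homotopy_integrand.
        have -> : ((f (toward b t) - f (toward u v) - l * (toward b t - toward u v) - (f (toward a t) - f (toward u v) - l * (toward a t - toward u v))) * cauchy_kernel t
          = f (toward b t) * cauchy_kernel t - f (toward a t) * cauchy_kernel t - l * ((toward b t - toward a t) * cauchy_kernel t))%C by ring.
        have -> : ((toward b t - toward a t) * cauchy_kernel t = RtoC (b - a) * (Ci * circ r t))%C.
          rewrite /toward /cauchy_kernel RtoC_minus; field; exact: circ_z0.
        ring.
      have -> : k * th = d - c by rewrite /d; ring.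
      apply: cint_bound => //.
        move=> t Ht; apply: ccont_mult; last exact: cauchy_kernel_cont.
        apply: ccont_minus; apply: ccont_minus; try (apply: ccont_minus; [|exact: ccont_const]).
        + by apply: f_toward_cont_t; lra.
        + apply: ccont_mult; first exact: ccont_const.
          apply: ccont_minus; last exact: ccont_const.
          apply: ccont_plus; first exact: ccont_const. apply: ccont_mult; first exact: ccont_const.
          by apply: ccont_minus; [exact: ccont_circ|exact: ccont_const].
        + by apply: f_toward_cont_t; lra.
        + apply: ccont_mult; first exact: ccont_const.
          apply: ccont_minus; last exact: ccont_const.
          apply: ccont_plus; first exact: ccont_const. apply: ccont_mult; first exact: ccont_const.
          by apply: ccont_minus; [exact: ccont_circ|exact: ccont_const].
      move=> t Ht; rewrite Cmod_mult; apply: Rmult_le_compat; try exact: Cmod_ge_0.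
        apply: Rle_trans (Cmod_triangle _ _) _; rewrite Cmod_opp.
        have := He' b t ltac:(lra) Ht; have := He' a t ltac:(lra) Ht; lra.
      exact: cauchy_kernel_le.
    have B2 : Cmod (cint (side_form c d) a b - l * RtoC (b - a) * (circ r d - circ r c))
       <= 2 * (2 * (eps * (C1 * th)) * / s0 * (h * th)).
      have -> : (l * RtoC (b - a) * (circ r d - circ r c) = cint (fun _ => l * (circ r d - circ r c)) a b)%C.
        rewrite cint_const; ring.
      have cons : cont_on (side_form c d) a b by apply: side_form_cont; lra.
      rewrite -cint_minus //; last by move=> t _; exact: ccont_const.
      have -> : h * th = b - a by rewrite /b; ring.
      apply: cint_bound => //.
        by move=> s Hs; apply: ccont_minus; [exact: cons|exact: ccont_const].
      move=> s Hs.
      have s0' : RtoC s <> RtoC 0 by move=> E; have := RtoC_inj _ _ E; lra.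
      have -> : (side_form c d s - l * (circ r d - circ r c) = (e s d - e s c) / RtoC s)%C.
        rewrite /side_form /e /toward; field; exact: s0'.
      rewrite Cmod_div // Cmod_R; apply: Rmult_le_compat; first exact: Cmod_ge_0.
      + left; apply: Rinv_0_lt_compat; apply: Rabs_pos_lt; lra.
      + apply: Rle_trans (Cmod_triangle _ _) _; rewrite Cmod_opp.
        have := He' s d Hs ltac:(lra); have := He' s c Hs ltac:(lra); lra.
      + apply: Rinv_le_contravar; rewrite ?Rabs_right; lra.
    have := Cmod_triangle (cint (fun t => homotopy_integrand b t - homotopy_integrand a t)%C c d - l * RtoC (b - a) * (circ r d - circ r c))
       (- (cint (side_form c d) a b - l * RtoC (b - a) * (circ r d - circ r c))).
    rewrite Cmod_opp /boundary_integral.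
    set x := cint _ c d in B1 |- *; set y := cint _ a b in B2 |- *; set g := (l * _ * _)%C in B1 B2 |- *.
    have -> : (x - g + - (y - g) = x - y)%C by ring.
    have -> : eps * C2 * (th * th) = 2 * (2 * (eps * (C1 * th)) * Om * (k * th)) +
       2 * (2 * (eps * (C1 * th)) * / s0 * (h * th)) by rewrite /C2 /Rdiv; ring.
    lra.
apply: Cmod_eq_0; apply: Rle_antisym; last exact: Cmod_ge_0.
apply: le_epsilon => eps He.
have := key (eps / C2) (Rdiv_lt_0_compat _ _ He C2p).
have -> : eps / C2 * C2 = eps by field; lra. lra.
Qed.

(** Since the circle is closed, the two sides [t = 0] and [t = 2 PI] cancel and the integral does
    not depend on [s]; continuity of [f] at [z] handles small [s]. The integral of the kernel stays
    unevaluated: [cauchy_taylor] finds it by expanding the constant 1. *)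
Lemma cauchy_formula :
  cint (fun t => f (circ r t) * cauchy_kernel t)%C 0 (2 * PI) = (f z * cint cauchy_kernel 0 (2 * PI))%C.
Proof.
have pip := PI_RGT_0.
have cO : cont_on cauchy_kernel 0 (2 * PI) by move=> t _; exact: cauchy_kernel_cont.
have W1 : cint (fun t => f (circ r t) * cauchy_kernel t)%C 0 (2 * PI) = cint (homotopy_integrand 1) 0 (2 * PI).
  apply: cint_ext; first lra. move=> t _; rewrite /homotopy_integrand /toward; congr (f _ * _)%C; ring.
have Ws s0 : 0 < s0 < 1 -> cint (homotopy_integrand 1) 0 (2 * PI) = cint (homotopy_integrand s0) 0 (2 * PI).
  move=> Hs0; have := boundary_zero s0 Hs0; rewrite /boundary_integral cint_minus; try (apply: homotopy_integrand_cont; lra); last lra.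
  have -> : cint (side_form 0 (2 * PI)) s0 1 = RtoC 0.
    rewrite (cint_ext _ (fun _ => RtoC 0)); [|lra|].
      rewrite cint_const; ring.
    move=> s Hs; rewrite /side_form /toward /circ cos_2PI sin_2PI cos_0 sin_0; field.
    move=> E; have := RtoC_inj _ _ E; lra.
  move=> E.
  set a := cint (homotopy_integrand 1) _ _ in E |- *; set b := cint _ _ _ in E |- *.
  have -> : a = (a - b - 0 + b)%C by ring. rewrite E; ring.
rewrite W1.
set A := cint (homotopy_integrand 1) _ _ in Ws |- *.
apply: Cmod_sub_le0; apply: le_epsilon => eps He; rewrite Rplus_0_l.
pose Om := r / (r - Cmod z).
have Omp : 0 < Om by apply: Rdiv_lt_0_compat; lra.
pose eps' := eps / (2 * (Om * (2 * PI))).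
have dp : 0 < 2 * (Om * (2 * PI)).
  by apply: Rmult_lt_0_compat; [lra|apply: Rmult_lt_0_compat; lra].
have e'p : 0 < eps' by apply: Rdiv_lt_0_compat.
case: (cderivable_cont f z (Hf z ltac:(lra)) eps' e'p) => d [dpos Hd].
(* As [circ r t - z] has modulus at most [2 r], this keeps [toward s0 t] within [d / 2] of [z]. *)
pose s0 := Rmin (1/2) (d / (4 * r)).
have s0p : 0 < s0.
  by apply: Rmin_pos; [lra|apply: Rdiv_lt_0_compat; lra].
have s0h : s0 <= 1/2 by exact: Rmin_l.
have s0d : s0 * (4 * r) <= d.
  have := Rmult_le_compat_r (4 * r) _ _ ltac:(lra) (Rmin_r (1/2) (d / (4 * r))).
  have -> : d / (4 * r) * (4 * r) = d by field; lra. by [].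
rewrite (Ws s0); last lra.
rewrite -cint_scal //; last lra.
rewrite -cint_minus; [|lra|apply: homotopy_integrand_cont; lra|exact: cont_on_scal].
have -> : eps = 2 * (eps' * Om * (2 * PI - 0)).
  rewrite /eps'; field; lra.
apply: cint_bound; first lra.
- move=> t Ht; apply: ccont_minus; first by apply: (homotopy_integrand_cont _ 0 (2*PI)) => //; lra.
  by apply: ccont_mult; [exact: ccont_const|exact: cauchy_kernel_cont].
- move=> t Ht; rewrite /homotopy_integrand.
  have -> : (f (toward s0 t) * cauchy_kernel t - f z * cauchy_kernel t = (f (toward s0 t) - f z) * cauchy_kernel t)%C by ring.
  rewrite Cmod_mult; apply: Rmult_le_compat; try exact: Cmod_ge_0; last exact: cauchy_kernel_le.
  left; apply: Hd; rewrite /toward.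
  have -> : (z + RtoC s0 * (circ r t - z) - z = RtoC s0 * (circ r t - z))%C by ring.
  rewrite Cmod_mult Cmod_R Rabs_right; last lra.
  have := Rmult_le_compat_l s0 _ _ ltac:(lra) (proj2 (circ_z t)).
  have := Rmult_lt_0_compat _ _ s0p r0; lra.
Qed.
End Goursat.

(** * Taylor coefficients on a circle *)

Definition fourier (g : R -> C) (r : R) (n : nat) : C :=
  cint (fun t => g t * / circ r t ^ n)%C 0 (2 * PI).

Lemma circ_neq0 r t : 0 < r -> circ r t <> RtoC 0.
Proof. by move=> h; apply/Cmod_gt_0; rewrite Cmod_circ; lra. Qed.

Lemma ccont_circ_inv r t n : 0 < r -> ccont (fun t => / circ r t ^ n)%C t.
Proof.
move=> h; apply: ccont_inv; first by apply: ccont_pow; exact: ccont_circ.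
by apply: Cpow_nz; apply: circ_neq0.
Qed.

Lemma fourier_le g r M n : 0 < r -> (forall t, 0 <= t <= 2 * PI -> ccont g t) ->
  (forall t, 0 <= t <= 2 * PI -> Cmod (g t) <= M) -> Cmod (fourier g r n) <= 4 * PI * M / r ^ n.
Proof.
move=> Hr Hg HM; have pip := PI_RGT_0.
have -> : 4 * PI * M / r ^ n = 2 * (M * / r ^ n * (2 * PI - 0)).
  by field; apply: pow_nonzero; lra.
apply: cint_bound; first lra.
  by move=> t Ht; apply: ccont_mult; [exact: Hg|exact: ccont_circ_inv].
move=> t Ht; rewrite Cmod_mult Cmod_inv; last by apply: Cpow_nz; apply: circ_neq0.
rewrite Cmod_pow Cmod_circ; last lra.
apply: Rmult_le_compat_r; last exact: HM.
by left; apply: Rinv_0_lt_compat; apply: pow_lt.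
Qed.

(* Expand the Cauchy kernel as a geometric series in [z / circ r t]. *)
Lemma kernel_series (g : R -> C) z r M : Cmod z < r ->
  (forall t, 0 <= t <= 2 * PI -> ccont g t) ->
  (forall t, 0 <= t <= 2 * PI -> Cmod (g t) <= M) ->
  serC (fun n => z ^ n * (Ci * fourier g r n))%C (cint (fun t => g t * cauchy_kernel z r t)%C 0 (2 * PI)).
Proof.
move=> zr Hg HM.
have pip := PI_RGT_0.
have zp := Cmod_ge_0 z.
have rp : 0 < r by lra.
pose q := Cmod z / r.
have q0 : 0 <= q by apply: Rdiv_le_0_compat; lra.
have q1 : q < 1 by apply/Rlt_div_l; lra.
have cg : cont_on g 0 (2 * PI) by [].
have co t : ccont (cauchy_kernel z r) t by apply: cauchy_kernel_cont.
have cgo : cont_on (fun t => g t * cauchy_kernel z r t)%C 0 (2 * PI).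
  by move=> t Ht; apply: ccont_mult; [exact: Hg|exact: co].
have cF n : cont_on (fun t => g t * / circ r t ^ n)%C 0 (2 * PI).
  by move=> t Ht; apply: ccont_mult; [exact: Hg|exact: ccont_circ_inv].
have M0 : 0 <= M by have := HM 0 ltac:(lra); have := Cmod_ge_0 (g 0); lra.
(* The exact remainder of the geometric series of the kernel after the term [n]; its modulus decays
   like [(|z| / r)^(n+1)]. *)
pose rem n t := (g t * (cauchy_kernel z r t * (z ^ S n * / circ r t ^ S n)))%C.
have crem n : cont_on (rem n) 0 (2 * PI).
  move=> t Ht; apply: ccont_mult; first exact: Hg.
  apply: ccont_mult; first exact: co.
  by apply: ccont_mult; [exact: ccont_const|exact: ccont_circ_inv].
have cnz t : (circ r t - z)%C <> RtoC 0 by apply: circ_z0.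
have S n : cint (fun t => g t * cauchy_kernel z r t)%C 0 (2 * PI) =
    (sum_n (fun n => z ^ n * (Ci * fourier g r n))%C n + cint (rem n) 0 (2 * PI))%C.
  elim: n => [|n IH].
    rewrite sum_O /fourier -cint_scal //; last lra.
    have -> : forall x : C, (z ^ 0 * x = x)%C by move=> x /=; ring.
    rewrite -cint_plus //; [|lra|exact: cont_on_scal].
    apply: cint_ext; first lra.
    move=> t _; rewrite /rem /cauchy_kernel /=; field; split; [exact: circ_neq0|exact: cnz].
  rewrite csum_S IH -Cplus_assoc; congr Cplus.
  rewrite /fourier -cint_scal //; last lra.
  have cc := cont_on_scal Ci _ _ _ (cF (Datatypes.S n)).
  rewrite -cint_scal //; last lra.
  rewrite -cint_plus //; [|lra|exact: cont_on_scal].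
  apply: cint_ext; first lra.
  move=> t _; rewrite /rem /cauchy_kernel !(Cpow_S _ (Datatypes.S n)).
  have cn : (circ r t ^ Datatypes.S n)%C <> RtoC 0 by apply: Cpow_nz; apply: circ_neq0.
  move: cn; set cN := (circ r t ^ _)%C; set zN := (z ^ _)%C => cn.
  field; split; first exact: cn. split; [exact: circ_neq0|exact: cnz].
apply/serC_eps => eps He.
pose Om := r / (r - Cmod z).
have Omp : 0 < Om by apply: Rdiv_lt_0_compat; lra.
pose c := 2 * (M * Om * (2 * PI)) + 1.
have cp : 0 < c.
  rewrite /c; have : 0 <= M * Om * (2 * PI) by apply: Rmult_le_pos; [apply: Rmult_le_pos; lra|lra].
  lra.
case: (pow_lt_1_zero q _ (eps / c)) => [|| N HN].
- by rewrite Rabs_right; lra.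
- exact: Rdiv_lt_0_compat.
exists N => n Hn; rewrite (S n).
set s := sum_n _ _.
have -> : (s - (s + cint (rem n) 0 (2 * PI)) = - cint (rem n) 0 (2 * PI))%C by ring.
rewrite Cmod_opp.
have qn := HN (Datatypes.S n) ltac:(lia).
have qnp : 0 <= q ^ Datatypes.S n by apply: pow_le.
rewrite Rabs_right in qn; last lra.
apply: Rle_lt_trans (_ : 2 * (M * (Om * q ^ Datatypes.S n) * (2 * PI - 0)) < _).
  apply: cint_bound; [lra|exact: crem|].
  move=> t Ht; rewrite /rem Cmod_mult; apply: Rmult_le_compat; try exact: Cmod_ge_0; first exact: HM.
  rewrite Cmod_mult; apply: Rmult_le_compat; try exact: Cmod_ge_0; first exact: cauchy_kernel_le.
  rewrite Cmod_mult Cmod_inv; last by apply: Cpow_nz; apply: circ_neq0.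
  rewrite !Cmod_pow Cmod_circ; last lra.
  rewrite /q /Rdiv Rpow_mult_distr pow_inv; exact: Rle_refl.
have : c * q ^ Datatypes.S n < c * (eps / c) by apply: Rmult_lt_compat_l.
have -> : c * (eps / c) = eps by field; lra.
rewrite /c; lra.
Qed.

Lemma fourier_one r n : 0 < r -> fourier (fun _ => RtoC 1) r n =
  if Nat.eqb n 0 then RtoC (2 * PI) else RtoC 0.
Proof.
move=> Hr; have pip := PI_RGT_0; rewrite /fourier.
case: n => [|n].
  rewrite (cint_ext _ (fun _ => RtoC 1)); [|lra|].
    rewrite cint_const Rminus_0_r /=; ring.
  by move=> t _ /=; field.
rewrite [Nat.eqb _ _]/=; have : (0 < S n)%nat by lia.
move: (S n) => N Npos.
pose e t : C := (cos (INR N * t), - sin (INR N * t)).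
have Np : 0 < INR N by apply: lt_0_INR.
have E t : (RtoC 1 * / circ r t ^ N = RtoC (/ r ^ N) * e t)%C.
  have -> : (circ r t = RtoC r * (cos t, sin t))%C by rewrite /circ /Cmult /=; congr pair; ring.
  rewrite Cpow_mult_l.
  rewrite cis_pow.
  have ne : (RtoC r ^ N)%C <> RtoC 0 by apply: Cpow_nz; move=> h; have := RtoC_inj _ _ h; lra.
  have u : ((cos (INR N * t), sin (INR N * t)) * e t = 1)%C.
    rewrite /e /Cmult /=; apply: injective_projections => /=; last ring.
    have := sin2_cos2 (INR N * t); rewrite /Rsqr; lra.
  have ne2 : (cos (INR N * t), sin (INR N * t)) <> RtoC 0.
    move=> h; rewrite h Cmult_0_l in u; have := RtoC_inj _ _ u; lra.
  rewrite RtoC_inv; last by apply: pow_nonzero; lra.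
  rewrite RtoC_pow.
  move: u ne2; set x := (cos _, sin _) => u ne2.
  have -> : (e t = / x)%C.
    have -> : (e t = (x * e t) * / x)%C by field. rewrite u; ring.
  by field.
rewrite (cint_ext _ (fun t => RtoC (/ r ^ N) * e t)%C); [|lra|by []].
have C1 : RInt (fun t => cos (INR N * t)) 0 (2 * PI) = 0.
  apply: is_RInt_unique.
  have := is_RInt_derive (V := R_CompleteNormedModule) (fun t => sin (INR N * t) / INR N) (fun t => cos (INR N * t)) 0 (2 * PI).
  rewrite /minus /plus /opp /= Rmult_0_r sin_0.
  have -> : sin (INR N * (2 * PI)) = 0.
    have := sin_period 0 N; rewrite sin_0.
    by have -> : 0 + 2 * INR N * PI = INR N * (2 * PI) by ring.
  have -> : 0 / INR N + - (0 / INR N) = 0 by field; lra.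
  apply.
  - move=> x _; auto_derive => //; field; lra.
  - move=> x _; apply: continuous_comp; last exact: continuous_cos.
    apply: (continuous_mult (K := R_AbsRing)); [exact: continuous_const|exact: continuous_id].
have S1 : RInt (fun t => - sin (INR N * t)) 0 (2 * PI) = 0.
  apply: is_RInt_unique.
  have := is_RInt_derive (V := R_CompleteNormedModule) (fun t => cos (INR N * t) / INR N) (fun t => - sin (INR N * t)) 0 (2 * PI).
  rewrite /minus /plus /opp /= Rmult_0_r cos_0.
  have -> : cos (INR N * (2 * PI)) = 1.
    have := cos_period 0 N; rewrite cos_0.
    by have -> : 0 + 2 * INR N * PI = INR N * (2 * PI) by ring.
  have -> : 1 / INR N + - (1 / INR N) = 0 by field; lra.
  apply.
  - move=> x _; auto_derive => //; field; lra.
  - move=> x _; apply: (continuous_opp (V := R_NormedModule)); apply: continuous_comp; last exact: continuous_sin.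
    apply: (continuous_mult (K := R_AbsRing)); [exact: continuous_const|exact: continuous_id].
rewrite cint_scal; [|lra|].
  have -> : cint e 0 (2 * PI) = RtoC 0 by rewrite /cint /e /= C1 S1.
  ring.
move=> t _; apply: ccont_pair.
  apply: continuous_comp; last exact: continuous_cos.
  apply: (continuous_mult (K := R_AbsRing)); [exact: continuous_const|exact: continuous_id].
apply: (continuous_opp (V := R_NormedModule)); apply: continuous_comp; last exact: continuous_sin.
apply: (continuous_mult (K := R_AbsRing)); [exact: continuous_const|exact: continuous_id].
Qed.

Definition taylor (f : C -> C) (r : R) (n : nat) : C :=
  (fourier (fun t => f (circ r t)) r n / RtoC (2 * PI))%C.

Theorem cauchy_taylor (f : C -> C) (z : C) (r R0 M : R) : Cmod z < r -> r < R0 ->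
  (forall x, Cmod x < R0 -> cderivable f x) -> (forall x, Cmod x < R0 -> Cmod (f x) <= M) ->
  serC (fun n => taylor f r n * z ^ n)%C (f z).
Proof.
move=> zr rR Hf HM.
have pip := PI_RGT_0.
have rp : 0 < r by have := Cmod_ge_0 z; lra.
have P0 : RtoC (2 * PI) <> RtoC 0 by move=> h; have := RtoC_inj _ _ h; lra.
have Ci0 : Ci <> RtoC 0 by apply/Cmod_gt_0; rewrite Cmod_Ci; lra.
have H1 := kernel_series (fun _ => RtoC 1) z r 1 zr (fun t _ => ccont_const 1 t)
  (fun t _ => Req_le _ _ Cmod_1).
(* For the constant function 1 only the Fourier coefficient of index 0 survives, so the expansion of
   the kernel yields the winding integral [2 PI i]. *)
have E1 : cint (fun t => RtoC 1 * cauchy_kernel z r t)%C 0 (2 * PI) = (Ci * RtoC (2 * PI))%C.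
  apply: serC_unique H1 _.
  apply: (serC_ext (fun n => if Nat.eqb n 0 then Ci * RtoC (2 * PI) else 0)%C).
    move=> n; rewrite fourier_one //; case: n => [|n] /=; ring.
  have := serC_fin (fun n => if Nat.eqb n 0 then Ci * RtoC (2 * PI) else 0)%C 0.
  by rewrite sum_O /=; apply; case=> //; lia.
have E2 : cint (cauchy_kernel z r) 0 (2 * PI) = (Ci * RtoC (2 * PI))%C.
  rewrite -E1; apply: cint_ext; first lra. move=> t _; ring.
have := cauchy_formula f z r R0 zr rR Hf; rewrite E2 => E3.
have Cc t : 0 <= t <= 2 * PI -> ccont (fun t => f (circ r t)) t.
  move=> _; apply: (ccont_comp f (circ r)); last exact: ccont_circ.
  by apply: Hf; rewrite Cmod_circ; lra.
have Bd t : 0 <= t <= 2 * PI -> Cmod (f (circ r t)) <= M.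
  by move=> _; apply: HM; rewrite Cmod_circ; lra.
have := serC_scal (/ (Ci * RtoC (2 * PI)))%C _ _ (kernel_series _ z r M zr Cc Bd).
rewrite E3.
have -> : (/ (Ci * RtoC (2 * PI)) * (f z * (Ci * RtoC (2 * PI))) = f z)%C by field; split.
apply: serC_ext => n; rewrite /taylor; field; by split.
Qed.

Lemma taylor_le f r R0 M n : 0 < r -> r < R0 -> 
  (forall x, Cmod x < R0 -> cderivable f x) -> (forall x, Cmod x < R0 -> Cmod (f x) <= M) ->
  Cmod (taylor f r n) <= 2 * M / r ^ n.
Proof.
move=> rp rR Hf HM; have pip := PI_RGT_0.
rewrite /taylor Cmod_div; last by move=> h; have := RtoC_inj _ _ h; lra.
rewrite Cmod_R Rabs_right; last lra.
have pn : r ^ n <> 0 by apply: pow_nonzero; lra.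
apply/Rle_div_l; first lra.
have -> : 2 * M / r ^ n * (2 * PI) = 4 * PI * M / r ^ n by field.
apply: fourier_le => // t _.
  apply: (ccont_comp f (circ r)); last exact: ccont_circ.
  by apply: Hf; rewrite Cmod_circ; lra.
by apply: HM; rewrite Cmod_circ; lra.
Qed.

(** * Analyticity in two variables *)

Ltac cfield := match goal with |- @eq _ ?a ?b => change (@eq C a b); field end.

(** The series is only claimed on the closed polydisc of radius [1 / (2 R1)], where every geometric
    ratio is at most [1/2]. *)
Definition expansion (h : C -> C -> C) (c : nat -> nat -> C) (M R1 : R) : Prop :=
  0 <= M /\ 0 < R1 /\ (forall i j, Cmod (c i j) <= M * R1 ^ (i + j)) /\
  forall z w, Cmod z * R1 <= 1/2 -> Cmod w * R1 <= 1/2 -> is_dseries (monomials c z w) (h z w).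
Definition analytic2 h := exists c M R1, expansion h c M R1.

Lemma array_analytic c M R1 : 0 <= M -> 0 < R1 ->
  (forall i j, Cmod (c i j) <= M * R1 ^ (i + j)) -> exists h, expansion h c M R1.
Proof.
move=> HM HR Hc.
have X z w : exists S, Cmod z * R1 <= 1/2 -> Cmod w * R1 <= 1/2 -> is_dseries (monomials c z w) S.
  case: (classic (Cmod z * R1 <= 1/2 /\ Cmod w * R1 <= 1/2)) => [[h1 h2]|H].
    case: (ds_ex _ _ (abs_bound_geom c M R1 z w ltac:(lra) HM Hc h1 h2)) => S [HS _].
    by exists S.
  by exists 0%R => h1 h2; case: H.
exists (fun z w => proj1_sig (constructive_indefinite_description _ (X z w))).
split=> //; split=> //; split=> // z w h1 h2.
case: constructive_indefinite_description => S /= HS; exact: HS.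
Qed.

Lemma tail_half (a : nat -> C) (S : C) A N : 0 <= A -> serC a S ->
  (forall n, Cmod (a n) <= A * (1/2) ^ n) -> Cmod (S - sum_n a N) <= A * (1/2) ^ N.
Proof.
move=> HA HS Ha.
have p n : 0 <= (1/2) ^ n by apply: pow_le; lra.
have X m : Cmod (sum_n a (N + m) - sum_n a N) <= A * (1/2) ^ N * (1 - (1/2) ^ m).
  elim: m => [|m IH].
    rewrite Nat.add_0_r /=; have -> : (sum_n a N - sum_n a N = 0)%C by ring. rewrite Cmod_0; lra.
  rewrite Nat.add_succ_r csum_S.
  have -> : (sum_n a (N + m) + a (Datatypes.S (N + m)) - sum_n a N =
     (sum_n a (N + m) - sum_n a N) + a (Datatypes.S (N + m)))%C by ring.
  apply: Rle_trans (Cmod_triangle _ _) _.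
  have := Ha (Datatypes.S (N + m)).
  have -> : (1/2) ^ Datatypes.S (N + m) = (1/2)^N * (1/2)^m / 2 by rewrite /= pow_add; field.
  have -> : (1/2) ^ Datatypes.S m = (1/2)^m / 2 by rewrite /=; field.
  lra.
apply: le_epsilon => eps He.
move/serC_eps: HS => /(_ eps He) [n0 H0].
have := H0 (N + n0)%nat ltac:(lia); have := X n0.
have := Cmod_sub_triangle (sum_n a (N + n0)) S (sum_n a N); rewrite (Cmod_sub_sym S (sum_n a (N + n0))).
have := Rmult_le_pos _ _ (Rmult_le_pos _ _ HA (p N)) (p n0); lra.
Qed.

Lemma INR_le_pow2 n : INR n + 1 <= 2 ^ n.
Proof.
elim: n => [|n IH]; first by rewrite /=; lra.
rewrite S_INR /=; have := pos_INR n; lra.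
Qed.

Lemma pow_diff z y s n : Cmod z <= s -> Cmod y <= s ->
  s * Cmod (z ^ n - y ^ n) <= INR n * s ^ n * Cmod (z - y).
Proof.
move=> Hz Hy; have sp : 0 <= s by have := Cmod_ge_0 z; lra.
elim: n => [|n IH].
  have -> : (z ^ 0 - y ^ 0 = 0)%C by rewrite /=; ring. rewrite Cmod_0 /=; lra.
rewrite !Cpow_S.
have -> : (z * z ^ n - y * y ^ n = z * (z ^ n - y ^ n) + (z - y) * y ^ n)%C by ring.
apply: Rle_trans (Rmult_le_compat_l _ _ _ sp (Cmod_triangle _ _)) _.
rewrite !Cmod_mult Cmod_pow S_INR.
have h1 : Cmod y ^ n <= s ^ n by apply: pow_incr; split=> //; apply: Cmod_ge_0.
have h2 : Cmod z * (s * Cmod (z ^ n - y ^ n)) <= s * (INR n * s ^ n * Cmod (z - y)).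
  apply: Rmult_le_compat => //; first exact: Cmod_ge_0.
  by apply: Rmult_le_pos => //; apply: Cmod_ge_0.
have h3 : Cmod (z - y) * Cmod y ^ n <= Cmod (z - y) * s ^ n.
  by apply: Rmult_le_compat_l => //; apply: Cmod_ge_0.
have h4 := Rmult_le_compat_l _ _ _ sp h3.
rewrite /=; lra.
Qed.

(** Second-order Taylor estimate for a monomial, by induction from [pow_diff]. Multiplying by
    [s * s] avoids both division and the exponent [n - 2]. *)
Lemma pow_diff2 z y s n : Cmod z <= s -> Cmod y <= s ->
  s * s * Cmod (z ^ n - y ^ n - RtoC (INR n) * y ^ (n - 1) * (z - y))
    <= INR n * INR n * s ^ n * (Cmod (z - y) * Cmod (z - y)).
Proof.
move=> Hz Hy; have sp : 0 <= s by have := Cmod_ge_0 z; lra.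
elim: n => [|n IH].
  have -> : (z ^ 0 - y ^ 0 - RtoC (INR 0) * y ^ (0 - 1) * (z - y) = 0)%C by rewrite /=; ring.
  rewrite Cmod_0 /=; lra.
have E : (RtoC (INR n) * y ^ n = RtoC (INR n) * y ^ (n - 1) * y)%C.
  case: (n) => [|m]; first by rewrite /=; ring.
  rewrite Cpow_S (_ : (S m - 1 = m)%nat); [ring|lia].
rewrite !Cpow_S (_ : (S n - 1 = n)%nat); last lia.
have -> : (z * z ^ n - y * y ^ n - RtoC (INR (S n)) * y ^ n * (z - y) =
  y * (z ^ n - y ^ n - RtoC (INR n) * y ^ (n - 1) * (z - y)) + (z - y) * (z ^ n - y ^ n))%C.
  rewrite S_INR RtoC_plus Cmult_plus_distr_r Cmult_1_l E; ring.
have ss := Rmult_le_pos _ _ sp sp.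
apply: Rle_trans (Rmult_le_compat_l _ _ _ ss (Cmod_triangle _ _)) _.
rewrite !Cmod_mult S_INR.
have d0 := Cmod_ge_0 (z - y); have y0 := Cmod_ge_0 y.
set U := Cmod (_ - _ - _) in IH |- *.
have U0 : 0 <= U by apply: Cmod_ge_0.
have h1 : Cmod y * (s * s * U) <= s * (INR n * INR n * s ^ n * (Cmod (z - y) * Cmod (z - y))).
  by apply: Rmult_le_compat => //; apply: Rmult_le_pos.
have h2 := Rmult_le_compat_l _ _ _ (Rmult_le_pos _ _ sp d0) (pow_diff z y s n Hz Hy).
have h3 : 0 <= INR n * (s ^ n * s * (Cmod (z - y) * Cmod (z - y))).
  apply: Rmult_le_pos; first exact: pos_INR.
  apply: Rmult_le_pos; last by apply: Rmult_le_pos.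
  by apply: Rmult_le_pos => //; apply: pow_le.
have h4 : 0 <= (s ^ n * s * (Cmod (z - y) * Cmod (z - y))).
  apply: Rmult_le_pos; last by apply: Rmult_le_pos.
  by apply: Rmult_le_pos => //; apply: pow_le.
rewrite /=; lra.
Qed.

(** Second-order Taylor estimate with one constant for all base points near 0. It gives
    differentiability in a whole neighbourhood, Lipschitz bounds, and quadratic remainders at the
    origin. *)
Definition quad_approx (h : C -> C -> C) (s K : R) := 0 < s /\ 0 < K /\
  forall z0 w0, Cmod z0 <= s -> Cmod w0 <= s -> exists A B, Cmod A <= K /\ Cmod B <= K /\
  forall z w, Cmod z <= s -> Cmod w <= s ->
   Cmod (h z w - h z0 w0 - (A * (z - z0) + B * (w - w0))) <=
    K * ((Cmod (z - z0) + Cmod (w - w0)) * (Cmod (z - z0) + Cmod (w - w0))).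

Theorem analytic_quad h : analytic2 h -> exists s K, quad_approx h s K.
Proof.
move=> [c [M [R1 [HM [HR [Hc Hh]]]]]].
(* Differentiating twice costs a factor [n^2 <= 4^n]; with this radius the ratio [4 s R1] is still
   [1/2]. *)
pose s := / (8 * R1).
have sp : 0 < s by apply: Rinv_0_lt_compat; lra.
have sR : s * R1 = 1/8 by rewrite /s; field; lra.
pose K := 4 * M / (s * s) + 4 * M / s + 1.
have K1 : 0 <= 4 * M / (s * s) by apply: Rdiv_le_0_compat; [lra|exact: Rmult_lt_0_compat].
have K2 : 0 <= 4 * M / s by apply: Rdiv_le_0_compat; lra.
exists s, K; split=> //; split; first by rewrite /K; lra.
move=> z0 w0 Hz0 Hw0.
have H0 : Cmod z0 * R1 <= 1/2 by have := Rmult_le_compat_r R1 _ _ ltac:(lra) Hz0; lra.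
have H0' : Cmod w0 * R1 <= 1/2 by have := Rmult_le_compat_r R1 _ _ ltac:(lra) Hw0; lra.
have ps k : 0 <= s ^ k by apply: pow_le; lra.
have p41 k : 1 <= 4 ^ k by apply: pow_R1_Rle; lra.
have p4s k : 0 <= 4 ^ k * s ^ k by apply: Rmult_le_pos => //; have := p41 k; lra.
have n0 k := pos_INR k.
have nn4 k : INR k * INR k <= 4 ^ k.
  have hk : INR k <= 2 ^ k by have := INR_le_pow2 k; lra.
  have -> : 4 = 2 * 2 by ring. rewrite Rpow_mult_distr; exact: Rmult_le_compat.
have n4 k : INR k <= 4 ^ k.
  apply: Rle_trans (_ : 2 ^ k <= _); first by have := INR_le_pow2 k; lra.
  apply: pow_incr; lra.
have half : 0 <= 4 * s * R1 <= 1/2 by lra.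
(* All the series below are dominated by the double geometric series of ratio 4 s R1 = 1/2. *)
have sum_bd (D : nat -> nat -> C) N (x y : R) : 0 <= N -> 0 < x ->
   (forall i j, exists d, D i j = (c i j * d)%C /\
      x * Cmod d <= y * (4 ^ i * s ^ i * (4 ^ j * s ^ j))) -> N = M * y / x -> abs_bound D (4 * N).
  move=> HN xp HD EN; apply: abs_bound_sq => J.
  apply: Rle_trans (geom2_le N (4 * s * R1) (4 * s * R1) J HN half half).
  apply: rsum_le => i _; apply: rsum_le => j _; case: (HD i j) => d [-> hd].
  rewrite Cmod_mult !(Rpow_mult_distr _ R1) !(Rpow_mult_distr 4 s) EN.
  have -> : M * y / x * (4 ^ i * s ^ i * R1 ^ i) * (4 ^ j * s ^ j * R1 ^ j) =
     (M * R1 ^ (i + j)) * (y * (4 ^ i * s ^ i * (4 ^ j * s ^ j)) / x) by rewrite pow_add; field; lra.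
  apply: Rmult_le_compat (Hc i j) _; try exact: Cmod_ge_0.
  apply/Rle_div_r; lra.
have F1 u n : Cmod u <= s -> Cmod u ^ n <= 4 ^ n * s ^ n.
  move=> Hu; apply: Rle_trans (pow_incr _ _ n (conj (Cmod_ge_0 u) Hu)) _.
  have := Rmult_le_compat_r _ _ _ (ps n) (p41 n); lra.
have F2 u n : Cmod u <= s -> s * (INR n * Cmod u ^ (n - 1)) <= 4 ^ n * s ^ n.
  move=> Hu; apply: Rle_trans (Rmult_le_compat_r _ _ _ (ps n) (n4 n)).
  case: n => [|n]; first by rewrite /=; lra.
  rewrite (_ : (S n - 1 = n)%nat); last lia.
  have hp := pow_incr _ _ n (conj (Cmod_ge_0 u) Hu).
  have := Rmult_le_compat_l _ _ _ (Rmult_le_pos _ _ (Rlt_le _ _ sp) (n0 (S n))) hp.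
  rewrite [s ^ S n]/=; lra.
have F3 u v n : Cmod u <= s -> Cmod v <= s -> s * Cmod (u ^ n - v ^ n) <= 4 ^ n * s ^ n * Cmod (u - v).
  move=> Hu Hv; apply: Rle_trans (pow_diff u v s n Hu Hv) _.
  apply: Rmult_le_compat_r; first exact: Cmod_ge_0. exact: Rmult_le_compat_r.
have F4 u v n : Cmod u <= s -> Cmod v <= s ->
    s * s * Cmod (u ^ n - v ^ n - RtoC (INR n) * v ^ (n - 1) * (u - v)) <=
      4 ^ n * s ^ n * (Cmod (u - v) * Cmod (u - v)).
  move=> Hu Hv; apply: Rle_trans (pow_diff2 u v s n Hu Hv) _.
  apply: Rmult_le_compat_r; first by apply: Rmult_le_pos; apply: Cmod_ge_0.
  exact: Rmult_le_compat_r.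
have Cu u n : 0 <= Cmod u ^ n by apply: pow_le; apply: Cmod_ge_0.
have dm u n : Cmod (RtoC (INR n) * u ^ (n - 1)) = INR n * Cmod u ^ (n - 1).
  by rewrite Cmod_mult Cmod_pow Cmod_R Rabs_right //; apply: Rle_ge.
have s2 u n : 0 <= s * (INR n * Cmod u ^ (n - 1)).
  by apply: Rmult_le_pos; [lra|exact: Rmult_le_pos].
have Ms : 0 <= M / s by apply: Rdiv_le_0_compat.
pose DA i j := (c i j * (RtoC (INR i) * z0 ^ (i - 1) * w0 ^ j))%C.
pose DB i j := (c i j * (RtoC (INR j) * w0 ^ (j - 1) * z0 ^ i))%C.
have HDA : abs_bound DA (4 * (M / s)).
  apply: (sum_bd DA _ s 1 Ms sp) => [i j|]; last by field; lra.
  eexists; split; first reflexivity.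
  rewrite Cmod_mult dm Cmod_pow -Rmult_assoc Rmult_1_l.
  by apply: Rmult_le_compat => //; [exact: F2|exact: F1].
have HDB : abs_bound DB (4 * (M / s)).
  apply: (sum_bd DB _ s 1 Ms sp) => [i j|]; last by field; lra.
  eexists; split; first reflexivity.
  rewrite Cmod_mult dm Cmod_pow -Rmult_assoc Rmult_1_l (Rmult_comm (4 ^ i * s ^ i)).
  by apply: Rmult_le_compat => //; [exact: F2|exact: F1].
case: (ds_ex _ _ HDA) => A [HA A1]; case: (ds_ex _ _ HDB) => B [HB B1].
have Ks : 4 * (M / s) <= K.
  rewrite /K; have -> : 4 * (M / s) = 4 * M / s by field; lra.
  lra.
exists A, B; split; first lra. split; first lra.
move=> z w Hz Hw.
have H1 : Cmod z * R1 <= 1/2 by have := Rmult_le_compat_r R1 _ _ ltac:(lra) Hz; lra.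
have H1' : Cmod w * R1 <= 1/2 by have := Rmult_le_compat_r R1 _ _ ltac:(lra) Hw; lra.
have DS := ds_minus _ _ _ _ (ds_minus _ _ _ _ (Hh z w H1 H1') (Hh z0 w0 H0 H0'))
   (ds_plus _ _ _ _ (ds_scal (z - z0)%C _ _ HA) (ds_scal (w - w0)%C _ _ HB)).
have -> : (A * (z - z0) + B * (w - w0) = (z - z0) * A + (w - w0) * B)%C by ring.
have dz := Cmod_ge_0 (z - z0); have dw := Cmod_ge_0 (w - w0).
set a := Cmod (z - z0) in dz |- *; set b := Cmod (w - w0) in dw |- *.
have De0 : 0 <= (a + b) * (a + b) by apply: Rmult_le_pos; lra.
have ss : 0 < s * s by apply: Rmult_lt_0_compat.
have N0 : 0 <= M * ((a + b) * (a + b)) / (s * s).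
  by apply: Rdiv_le_0_compat => //; apply: Rmult_le_pos.
apply: Rle_trans (_ : 4 * (M * ((a + b) * (a + b)) / (s * s)) <= _); last first.
  have -> : 4 * (M * ((a + b) * (a + b)) / (s * s)) = 4 * M / (s * s) * ((a + b) * (a + b)) by field; lra.
  by apply: Rmult_le_compat_r => //; rewrite /K; lra.
apply: ds_le DS; apply: (sum_bd _ _ (s * s) ((a + b) * (a + b)) N0 ss) => // i j.
(* The second-order remainder of [z^i w^j] splits into a quadratic remainder in [z], a product of
   two first-order terms and a quadratic remainder in [w]. They are bounded by multiples of [a^2],
   [a b] and [b^2], which sum to at most [(a + b)^2]. *)
exists ((z ^ i - z0 ^ i - RtoC (INR i) * z0 ^ (i - 1) * (z - z0)) * w ^ j +
   (RtoC (INR i) * z0 ^ (i - 1) * (z - z0) * (w ^ j - w0 ^ j) +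
    (w ^ j - w0 ^ j - RtoC (INR j) * w0 ^ (j - 1) * (w - w0)) * z0 ^ i))%C.
split; first by rewrite /monomials /DA /DB; ring.
set P := 4 ^ i * s ^ i; set Q := 4 ^ j * s ^ j.
have P0 : 0 <= P by exact: p4s. have Q0 : 0 <= Q by exact: p4s.
have T1 : s * s * Cmod ((z ^ i - z0 ^ i - RtoC (INR i) * z0 ^ (i - 1) * (z - z0)) * w ^ j) <= P * (a * a) * Q.
  rewrite Cmod_mult Cmod_pow -Rmult_assoc; apply: Rmult_le_compat => //; [|exact: F4|exact: F1].
  by apply: Rmult_le_pos; [lra|apply: Cmod_ge_0].
have T3 : s * s * Cmod ((w ^ j - w0 ^ j - RtoC (INR j) * w0 ^ (j - 1) * (w - w0)) * z0 ^ i) <= Q * (b * b) * P.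
  rewrite Cmod_mult Cmod_pow -Rmult_assoc; apply: Rmult_le_compat => //; [|exact: F4|exact: F1].
  by apply: Rmult_le_pos; [lra|apply: Cmod_ge_0].
have T2 : s * s * Cmod (RtoC (INR i) * z0 ^ (i - 1) * (z - z0) * (w ^ j - w0 ^ j)) <= P * (Q * b) * a.
  rewrite 2!Cmod_mult dm.
  have -> : s * s * (INR i * Cmod z0 ^ (i - 1) * Cmod (z - z0) * Cmod (w ^ j - w0 ^ j)) =
    (s * (INR i * Cmod z0 ^ (i - 1))) * (s * Cmod (w ^ j - w0 ^ j)) * a by rewrite /a; ring.
  apply: Rmult_le_compat_r => //; apply: Rmult_le_compat => //; [|exact: F2|exact: F3].
  by apply: Rmult_le_pos; [lra|apply: Cmod_ge_0].
apply: Rle_trans (Rmult_le_compat_l _ _ _ (Rlt_le _ _ ss) (Cmod_triangle _ _)) _.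
have := Rmult_le_compat_l _ _ _ (Rlt_le _ _ ss) (Cmod_triangle
   (RtoC (INR i) * z0 ^ (i - 1) * (z - z0) * (w ^ j - w0 ^ j))%C
   ((w ^ j - w0 ^ j - RtoC (INR j) * w0 ^ (j - 1) * (w - w0)) * z0 ^ i)%C).
have := Rmult_le_pos _ _ (Rmult_le_pos _ _ P0 Q0) (Rmult_le_pos _ _ dz dw).
lra.
Qed.

Definition sep_holomorphic (h : C -> C -> C) (R0 M : R) : Prop := 0 < R0 /\
  forall z w, Cmod z < R0 -> Cmod w < R0 ->
   Cmod (h z w) <= M /\ cderivable (fun x => h x w) z /\ cderivable (h z) w.

(** Osgood's lemma. Expand in [w] for each [z] on a circle, then expand in [z]; boundedness replaces
    joint continuity, because Cauchy estimates make [h] Lipschitz in [z] uniformly in [w]. *)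
Theorem sep_holomorphic_analytic h R0 M : sep_holomorphic h R0 M -> analytic2 h.
Proof.
move=> [R0p H].
have pip := PI_RGT_0.
(* The Lipschitz bound on the disc of radius [r1] uses coefficients on the circle of radius [r];
   with [r1 = r / 4] the terms [k (1/4)^k <= (1/2)^k] are summable. *)
pose r := R0 / 2; pose r1 := r / 4.
have rp : 0 < r by rewrite /r; lra.
have r1p : 0 < r1 by rewrite /r1; lra.
have rR : r < R0 by rewrite /r; lra.
have r1R : r1 < R0 by rewrite /r1; lra.
have M0 : 0 <= M.
  have := proj1 (H 0 0 ltac:(rewrite Cmod_0; lra) ltac:(rewrite Cmod_0; lra)).
  have := Cmod_ge_0 (h 0 0); lra.
have dW z : Cmod z < R0 -> forall x, Cmod x < R0 -> cderivable (h z) x.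
  by move=> hz x hx; case: (H z x hz hx) => _ [].
have bW z : Cmod z < R0 -> forall x, Cmod x < R0 -> Cmod (h z x) <= M.
  by move=> hz x hx; case: (H z x hz hx).
have dZ w : Cmod w < R0 -> forall x, Cmod x < R0 -> cderivable (fun x => h x w) x.
  by move=> hw x hx; case: (H x w hx hw) => _ [].
have bZ w : Cmod w < R0 -> forall x, Cmod x < R0 -> Cmod (h x w) <= M.
  by move=> hw x hx; case: (H x w hx hw).
have lip z y w : Cmod z <= r1 -> Cmod y <= r1 -> Cmod w < R0 ->
   Cmod (h z w - h y w) <= 4 * M / r1 * Cmod (z - y).
  move=> Hz Hy Hw.
  have S1 := cauchy_taylor _ z r R0 M ltac:(rewrite /r1 in Hz; lra) rR (dZ w Hw) (bZ w Hw).
  have S2 := cauchy_taylor _ y r R0 M ltac:(rewrite /r1 in Hy; lra) rR (dZ w Hw) (bZ w Hw).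
  have S3 := serC_plus _ _ _ _ S1 (serC_scal (-1)%C _ _ S2).
  have -> : (h z w - h y w = h z w + -1 * h y w)%C by ring.
  apply: serC_le S3 _ => n; apply: Rle_trans (csum_Cmod _ _) _.
  apply: Rle_trans (_ : sum_n (fun k => (2 * M / r1 * Cmod (z - y)) * (1/2) ^ k) n <= _).
    apply: rsum_le => k _.
    have -> : (taylor (fun x => h x w) r k * z ^ k + -1 * (taylor (fun x => h x w) r k * y ^ k) =
       taylor (fun x => h x w) r k * (z ^ k - y ^ k))%C by ring.
    rewrite Cmod_mult.
    have h1 := taylor_le _ r R0 M k rp rR (dZ w Hw) (bZ w Hw).
    have h2 := pow_diff z y r1 k Hz Hy.
    apply: (Rmult_le_reg_l r1) => //.
    have -> : r1 * (2 * M / r1 * Cmod (z - y) * (1/2) ^ k) = 2 * M * ((1/2)^k * Cmod (z - y)) by field; lra.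
    have -> : forall a b, r1 * (a * b) = a * (r1 * b) by move=> *; ring.
    apply: Rle_trans (Rmult_le_compat _ _ _ _ (Cmod_ge_0 _) _ h1 h2) _.
      by apply: Rmult_le_pos; [lra|apply: Cmod_ge_0].
    have rk : 0 < r ^ k by apply: pow_lt.
    have -> : 2 * M / r ^ k * (INR k * r1 ^ k * Cmod (z - y)) = 2 * M * (INR k * (1/4)^k * Cmod (z - y)).
      have -> : r1 ^ k = (1/4)^k * r ^ k by rewrite -Rpow_mult_distr; congr pow; rewrite /r1; field.
      field; lra.
    apply: Rmult_le_compat_l; first lra.
    apply: Rmult_le_compat_r; first exact: Cmod_ge_0.
    have -> : 1/4 = 1/2 * (1/2) by field.
    rewrite Rpow_mult_distr.
    have q : 0 < (1/2) ^ k by apply: pow_lt; lra.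
    have e : 2 ^ k * (1/2) ^ k = 1 by rewrite -Rpow_mult_distr (_ : 2 * (1/2) = 1) ?pow1 //; field.
    have h3 : INR k <= 2 ^ k by have := INR_le_pow2 k; lra.
    have := Rmult_le_compat_r _ _ _ (Rlt_le _ _ q) h3.
    rewrite e => h4; have := Rmult_le_compat_r _ _ _ (Rlt_le _ _ q) h4; lra.
  rewrite rsum_scal.
  have A0 : 0 <= 2 * M / r1 * Cmod (z - y).
    by apply: Rmult_le_pos; [apply: Rdiv_le_0_compat; lra|apply: Cmod_ge_0].
  have := Rmult_le_compat_l _ _ _ A0 (sum_geom_le (1/2) n ltac:(lra)).
  have -> : 2 * M / r1 * Cmod (z - y) * 2 = 4 * M / r1 * Cmod (z - y) by field; lra. by [].
have cin s : Cmod (circ r1 s) < R0 by rewrite Cmod_circ; lra.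
have cin2 s : Cmod (circ r s) < R0 by rewrite Cmod_circ; lra.
pose Cj j s := taylor (h (circ r1 s)) r j.
have Cc z t : Cmod z < R0 -> ccont (fun t => h z (circ r t)) t.
  move=> hz; apply: (ccont_comp (h z) (circ r)); [exact: dW|exact: ccont_circ].
have P0 : RtoC (2 * PI) <> RtoC 0 by move=> e; have := RtoC_inj _ _ e; lra.
(* The [w]-coefficients are themselves integrated along the circle of radius [r1], hence must be
   continuous there; this is what [lip] is for. *)
have Cjcont j s : ccont (Cj j) s.
  move=> eps He.
  pose L := 4 * M / r1 + 1.
  have L1 : 0 <= 4 * M / r1 by apply: Rdiv_le_0_compat; lra.
  have Lp : 0 < L by rewrite /L; lra.
  have rj : 0 < r ^ j by apply: pow_lt.
  pose e2 := eps * r ^ j / (4 * L).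
  have e2p : 0 < e2 by apply: Rdiv_lt_0_compat; [apply: Rmult_lt_0_compat|lra].
  case: (ccont_circ r1 s e2 e2p) => d [dp Hd]; exists d; split=> // u /Hd Hu.
  have -> : (Cj j u - Cj j s = fourier (fun t => h (circ r1 u) (circ r t) - h (circ r1 s) (circ r t)) r j / RtoC (2 * PI))%C.
    rewrite /Cj /taylor /fourier.
    rewrite (cint_ext (fun t => (_ - _) * _)%C (fun t => h (circ r1 u) (circ r t) * / circ r t ^ j - h (circ r1 s) (circ r t) * / circ r t ^ j)%C);
      [|lra|by move=> t _; ring].
    rewrite cint_minus; [field; exact: P0|lra| |];
    by move=> t _; apply: ccont_mult; [apply: Cc; apply: cin|apply: ccont_circ_inv].
  rewrite Cmod_div // Cmod_R Rabs_right; last lra.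
  apply/Rlt_div_l; first lra.
  apply: Rle_lt_trans (fourier_le _ r (L * e2) j rp _ _) _.
  - by move=> t _; apply: ccont_minus; apply: Cc; apply: cin.
  - move=> t _; apply: Rle_trans (lip _ _ _ _ _ (cin2 t)) _; try (rewrite Cmod_circ; lra).
    apply: Rmult_le_compat; try exact: Cmod_ge_0; rewrite ?/L; lra.
  - have -> : 4 * PI * (L * e2) / r ^ j = eps * PI by rewrite /e2; field; lra.
    have := Rmult_lt_0_compat _ _ He pip; lra.
have Cjle j s : Cmod (Cj j s) <= 2 * M / r ^ j by apply: (taylor_le _ r R0 M) => //; [apply: dW|apply: bW].
pose c i j := (fourier (Cj j) r1 i / RtoC (2 * PI))%C.
(* Exchange of the sum over [j] with the integral over the circle: for [|w| <= r / 2] the tail is at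
   most [2 M (1/2)^n] uniformly along the circle. *)
have row i w : Cmod w <= r / 2 -> serC (fun j => c i j * w ^ j)%C (taylor (fun x => h x w) r1 i).
  move=> Hw.
  have wR : Cmod w < R0 by lra.
  have ri : 0 < r1 ^ i by apply: pow_lt.
  have Hn : forall n, cont_on (fun s => sum_n (fun j => Cj j s * w ^ j)%C n) 0 (2 * PI).
    elim=> [|n IH] t Ht.
      have -> : (fun s => sum_n (fun j => Cj j s * w ^ j)%C 0) = (fun s => Cj 0%nat s * w ^ 0)%C.
        by apply: FunctionalExtensionality.functional_extensionality => x; rewrite sum_O.
      apply: ccont_mult; [exact: Cjcont|exact: ccont_const].
    have -> : (fun s => sum_n (fun j => Cj j s * w ^ j)%C (S n)) =
       (fun s => sum_n (fun j => Cj j s * w ^ j)%C n + Cj (S n) s * w ^ (S n))%C.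
      by apply: FunctionalExtensionality.functional_extensionality => x; rewrite csum_S.
    apply: ccont_plus; first exact: IH.
    apply: ccont_mult; [exact: Cjcont|exact: ccont_const].
  have E n : sum_n (fun j => c i j * w ^ j)%C n = (fourier (fun s => sum_n (fun j => Cj j s * w ^ j)%C n) r1 i / RtoC (2 * PI))%C.
    have cF j : cont_on (fun s => Cj j s * / circ r1 s ^ i)%C 0 (2 * PI).
      by move=> t _; apply: ccont_mult; [exact: Cjcont|exact: ccont_circ_inv].
    elim: n => [|n IH].
      rewrite sum_O /c /fourier.
      rewrite (cint_ext (fun t => sum_n _ 0 * _)%C (fun t => w ^ 0 * (Cj 0%nat t * / circ r1 t ^ i))%C);
        [|lra|by move=> t _; rewrite sum_O; ring].
      rewrite cint_scal; [cfield; exact: P0|lra|exact: cF].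
    rewrite csum_S IH /c /fourier.
    rewrite (cint_ext (fun t => sum_n _ (S n) * _)%C (fun t => sum_n (fun j => Cj j t * w ^ j) n * / circ r1 t ^ i + w ^ S n * (Cj (S n) t * / circ r1 t ^ i))%C);
        [|lra|by move=> t _; rewrite csum_S; ring].
    rewrite cint_plus; [|lra| |exact: cont_on_scal].
      rewrite cint_scal; [cfield; exact: P0|lra|exact: cF].
    by move=> t Ht; apply: ccont_mult; [exact: Hn|exact: ccont_circ_inv].
  apply/serC_eps => eps He.
  have e1 : 0 < eps * r1 ^ i / (4 * M + 1).
    by apply: Rdiv_lt_0_compat; [apply: Rmult_lt_0_compat|lra].
  case: (pow_small _ e1) => N HN; exists N => n Hn'; rewrite E.
  have cz t : ccont (fun s => h (circ r1 s) w) t.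
    by apply: (ccont_comp (fun x => h x w) (circ r1)); [apply: dZ|apply: ccont_circ].
  have -> : (fourier (fun s => sum_n (fun j => Cj j s * w ^ j)%C n) r1 i / RtoC (2 * PI) - taylor (fun x => h x w) r1 i
    = fourier (fun s => sum_n (fun j => Cj j s * w ^ j) n - h (circ r1 s) w) r1 i / RtoC (2 * PI))%C.
    rewrite /taylor /fourier.
    rewrite (cint_ext (fun t => (_ - _) * _)%C (fun t => sum_n (fun j => Cj j t * w ^ j) n * / circ r1 t ^ i - h (circ r1 t) w * / circ r1 t ^ i)%C);
      [|lra|by move=> t _; ring].
    rewrite cint_minus; [field; exact: P0|lra| |]; move=> t Ht; apply: ccont_mult.
    + exact: Hn. + exact: ccont_circ_inv. + exact: cz. + exact: ccont_circ_inv.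
  rewrite Cmod_div // Cmod_R Rabs_right; last lra.
  apply/Rlt_div_l; first lra.
  apply: Rle_lt_trans (fourier_le _ r1 (2 * M * (1/2)^n) i r1p _ _) _.
  - by move=> t Ht; apply: ccont_minus; [exact: Hn|exact: cz].
  - move=> t _.
    rewrite Cmod_sub_sym.
    apply: tail_half; first lra.
      by apply: (cauchy_taylor _ w r R0 M) => //; [lra|apply: dW|apply: bW].
    move=> k; rewrite Cmod_mult Cmod_pow.
    have rk : 0 < r ^ k by apply: pow_lt.
    have wk : Cmod w ^ k <= (1/2) ^ k * r ^ k.
      rewrite -Rpow_mult_distr; apply: pow_incr; split; [exact: Cmod_ge_0|lra].
    apply: Rle_trans (Rmult_le_compat _ _ _ _ (Cmod_ge_0 _) (pow_le _ _ (Cmod_ge_0 _)) (Cjle k t) wk) _.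
    right; field; lra.
  - apply/Rlt_div_l => //.
    have pN : (1/2) ^ n <= (1/2) ^ N.
      have -> : n = (N + (n - N))%nat by lia.
      rewrite pow_add; have := pow_incr (1/2) 1 (n - N) ltac:(lra); rewrite pow1.
      have := pow_lt (1/2) N ltac:(lra); nra.
    have : (4 * M + 1) * (1/2)^N < (4 * M + 1) * (eps * r1 ^ i / (4 * M + 1)).
      apply: Rmult_lt_compat_l; lra.
    have -> : (4 * M + 1) * (eps * r1 ^ i / (4 * M + 1)) = eps * r1 ^ i by field; lra.
    have m1 : M * (1/2)^n <= M * (1/2)^N by apply: Rmult_le_compat_l.
    have q0 : 0 < (1/2)^N by apply: pow_lt; lra.
    move=> h1.
    have : 4 * M * (1/2)^n < eps * r1 ^ i by lra.
    move=> h2; have := Rmult_lt_compat_l _ _ _ (Rmult_lt_0_compat _ _ (Rlt_0_2) pip) h2; lra.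
exists c, (4 * M), (/ r1); split; first lra.
have ir : 0 < / r1 by apply: Rinv_0_lt_compat.
split=> //; split.
- move=> i j.
  rewrite /c Cmod_div // Cmod_R Rabs_right; last lra.
  apply/Rle_div_l; first lra.
  apply: Rle_trans (fourier_le _ r1 (2 * M / r ^ j) i r1p _ _) _.
  + by move=> t _; exact: Cjcont.
  + by move=> t _; exact: Cjle.
  rewrite pow_inv pow_add.
  have ri : 0 < r1 ^ i by apply: pow_lt.
  have rj : 0 < r1 ^ j by apply: pow_lt.
  have rj' : 0 < r ^ j by apply: pow_lt.
  have h1 : / r ^ j <= / r1 ^ j.
    apply: Rinv_le_contravar => //; apply: pow_incr; rewrite /r1; lra.
  have -> : 4 * PI * (2 * M / r ^ j) / r1 ^ i = 4 * M * (2 * PI) * / r1 ^ i * / r ^ j by field; lra.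
  have -> : 4 * M * / (r1 ^ i * r1 ^ j) * (2 * PI) = 4 * M * (2 * PI) * / r1 ^ i * / r1 ^ j by field; lra.
  apply: Rmult_le_compat_l => //.
  apply: Rmult_le_pos; last by left; apply: Rinv_0_lt_compat.
  apply: Rmult_le_pos; lra.
- move=> z w /(Rmult_le_compat_r r1 _ _ ltac:(lra)) Hz /(Rmult_le_compat_r r1 _ _ ltac:(lra)) Hw.
  rewrite Rmult_assoc Rinv_l ?Rmult_1_r in Hz; last lra.
  rewrite Rmult_assoc Rinv_l ?Rmult_1_r in Hw; last lra.
  have wr : Cmod w <= r / 2 by rewrite /r1 in Hw; lra.
  exists (fun i => taylor (fun x => h x w) r1 i * z ^ i)%C; split.
  + move=> i; have := serC_scal (z ^ i)%C _ _ (row i w wr).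
    have -> : (z ^ i * taylor (fun x => h x w) r1 i = taylor (fun x => h x w) r1 i * z ^ i)%C by ring.
    apply: serC_ext => j; rewrite /monomials; ring.
  + apply: (cauchy_taylor (fun x => h x w) z r1 R0 M) => //; [lra|apply: dZ; lra|apply: bZ; lra].
Qed.

(** * Germs at the origin *)

Notation C2 := (prod_NormedModule C_AbsRing C_NormedModule C_NormedModule).

(** Balls in [C * C] are products of real intervals, four of them; halving the radius translates
    them into balls for [Cmod]. *)
Lemma locally_C2 (z0 w0 : C) (P : C * C -> Prop) :
  locally (T := C2) (z0, w0) P <-> exists d, 0 < d /\ forall z w : C,
    Cmod (z - z0) < d -> Cmod (w - w0) < d -> P (z, w).
Proof.
split.
- move=> [e He]; exists e; split; first exact: cond_pos.
  move=> z w hz hw; apply: He; split; exact: C_NormedModule_mixin_compat1.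
- move=> [d [dp H]].
  have dp2 : 0 < d / 2 by lra.
  exists (mkposreal _ dp2) => -[z w] [[h1 h2] [h3 h4]].
  rewrite /ball /= /AbsRing_ball /abs /minus /plus /opp /= in h1 h2 h3 h4.
  apply: H; apply: Rle_lt_trans (Cmod_le_abs _) _; rewrite /=; lra.
Qed.

Lemma locally_C1 (z0 : C) (P : C -> Prop) :
  locally (T := C_NormedModule) z0 P <-> exists d, 0 < d /\ forall z : C,
    Cmod (z - z0) < d -> P z.
Proof.
split.
- move=> [e He]; exists e; split; first exact: cond_pos.
  move=> z hz; apply: He; exact: C_NormedModule_mixin_compat1.
- move=> [d [dp H]].
  have dp2 : 0 < d / 2 by lra.
  exists (mkposreal _ dp2) => z [h1 h2].
  rewrite /ball /= /AbsRing_ball /abs /minus /plus /opp /= in h1 h2.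
  apply: H; apply: Rle_lt_trans (Cmod_le_abs _) _; rewrite /=; lra.
Qed.

Lemma loc_imp (P Q : C * C -> Prop) : (forall p, P p -> Q p) ->
  locally (T := C2) origin P -> locally (T := C2) origin Q.
Proof. intro H; apply filter_imp, H. Qed.
Lemma loc_and (P Q : C * C -> Prop) : locally (T := C2) origin P ->
  locally (T := C2) origin Q -> locally (T := C2) origin (fun p => P p /\ Q p).
Proof. intros HP HQ; apply filter_and; [exact HP|exact HQ]. Qed.
Lemma loc_imp2 (P Q S : C * C -> Prop) : (forall p, P p -> Q p -> S p) ->
  locally (T := C2) origin P -> locally (T := C2) origin Q -> locally (T := C2) origin S.
Proof. move=> H HP HQ; apply: loc_imp (loc_and _ _ HP HQ) => p []; exact: H. Qed.
Lemma loc_all (P : C * C -> Prop) : (forall p, P p) -> locally (T := C2) origin P.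
Proof. intro H; apply filter_forall, H. Qed.

(** Germs of one variable are treated as functions of [(z, w)] that ignore an argument, so that one
    calculus of germs serves for both. *)
Definition near0 (P : C -> C -> Prop) : Prop := exists d, 0 < d /\
  forall z w, Cmod z < d -> Cmod w < d -> P z w.

Lemma near0_locally P : near0 P <-> locally (T := C2) origin (fun p => P (fst p) (snd p)).
Proof.
rewrite /origin locally_C2; split=> -[d [dp H]]; exists d; split=> // z w hz hw.
- have e (x : C) : (x - 0 = x)%C by ring. by apply: H; rewrite -[X in Cmod X]e.
- apply: (H z w).
    by have -> : (z - 0 = z)%C by ring.
  by have -> : (w - 0 = w)%C by ring.
Qed.

Definition hol2 (h : C -> C -> C) : Prop :=
  holomorphic_near (U := C2) (V := C_NormedModule) (fun p => h (fst p) (snd p)) origin.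

Lemma norm_C2_l (x : C) : norm (K := C_AbsRing) (V := C2) (x, RtoC 0) = Cmod x.
Proof.
rewrite /norm /= /prod_norm /=; change (sqrt (Cmod x ^ 2 + Cmod 0 ^ 2) = Cmod x).
rewrite Cmod_0 -(Rsqr_pow2 (Cmod x)) (_ : Rsqr (Cmod x) + 0 ^ 2 = Rsqr (Cmod x)); last ring.
by rewrite sqrt_Rsqr //; apply: Cmod_ge_0.
Qed.
Lemma norm_C2_ge (x y : C) : Cmod x <= norm (K := C_AbsRing) (V := C2) (x, y) /\
  Cmod y <= norm (K := C_AbsRing) (V := C2) (x, y).
Proof.
rewrite /norm /= /prod_norm /=; change (Cmod x <= sqrt (Cmod x ^ 2 + Cmod y ^ 2) /\ Cmod y <= sqrt (Cmod x ^ 2 + Cmod y ^ 2)).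
have h1 := pow2_ge_0 (Cmod x); have h2 := pow2_ge_0 (Cmod y).
split.
- rewrite -{1}(sqrt_Rsqr (Cmod x)); last exact: Cmod_ge_0.
  apply: sqrt_le_1_alt; rewrite Rsqr_pow2; lra.
- rewrite -{1}(sqrt_Rsqr (Cmod y)); last exact: Cmod_ge_0.
  apply: sqrt_le_1_alt; rewrite Rsqr_pow2; lra.
Qed.
Lemma norm_C2_le (x y : C) : norm (K := C_AbsRing) (V := C2) (x, y) <= Cmod x + Cmod y.
Proof.
rewrite /norm /= /prod_norm /=; change (sqrt (Cmod x ^ 2 + Cmod y ^ 2) <= Cmod x + Cmod y).
have h1 := Cmod_ge_0 x; have h2 := Cmod_ge_0 y.
rewrite -(sqrt_Rsqr (Cmod x + Cmod y)); last lra.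
apply: sqrt_le_1_alt; rewrite /Rsqr; nra.
Qed.

Lemma filterdiff_C2 (h : C -> C -> C) (z w A B : C) :
  (forall eps, 0 < eps -> exists d, 0 < d /\ forall x y : C,
    Cmod (x - z) < d -> Cmod (y - w) < d ->
    Cmod (h x y - h z w - (A * (x - z) + B * (y - w))) <= eps * (Cmod (x - z) + Cmod (y - w))) ->
  filterdiff (U := C2) (V := C_NormedModule) (fun p => h (fst p) (snd p)) (locally (T := C2) (z, w))
    (fun p : C2 => (A * fst p + B * snd p)%C).
Proof.
move=> H; split.
  + split.
    * move=> [x1 x2] [y1 y2].
      change ((A * (x1 + y1) + B * (x2 + y2))%C = ((A * x1 + B * x2) + (A * y1 + B * y2))%C); ring.
    * move=> k [x1 x2].
      change ((A * (k * x1) + B * (k * x2))%C = (k * (A * x1 + B * x2))%C); ring.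
    * exists (Cmod A + Cmod B + 1); have a0 := Cmod_ge_0 A; have b0 := Cmod_ge_0 B; split; first lra.
      move=> [x y]; have [h1 h2] := norm_C2_ge x y.
      change (Cmod (A * x + B * y) <= (Cmod A + Cmod B + 1) * norm (K := C_AbsRing) (V := C2) (x, y)).
      move: h1 h2; set N := norm _ => h1 h2.
      apply: Rle_trans (Cmod_triangle _ _) _; rewrite !Cmod_mult.
      have := Rmult_le_compat_l _ _ _ a0 h1; have := Rmult_le_compat_l _ _ _ b0 h2.
      have := Cmod_ge_0 x; lra.
  + move=> x Hx.
    have <- : (z, w) = x by apply: is_filter_lim_locally_unique.
    move=> eps; have he := cond_pos eps.
    case: (H (eps / 2) ltac:(lra)) => d [dp Hd]; apply/(locally_C2 z w); exists d; split=> // x1 y1 h1 h2.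
    apply: Rle_trans (Hd x1 y1 h1 h2) _.
    have -> : minus (x1, y1) (z, w) = ((x1 - z)%C, (y1 - w)%C) by [].
    case: (norm_C2_ge (x1 - z)%C (y1 - w)%C) => h3 h4.
    have := Rmult_le_compat_l (eps / 2) _ _ ltac:(lra) (Rplus_le_compat _ _ _ _ h3 h4). lra.
Qed.

Lemma ex_filterdiff_C2 (h : C -> C -> C) (z w : C) :
  ex_filterdiff (U := C2) (V := C_NormedModule) (fun p => h (fst p) (snd p)) (locally (T := C2) (z, w)) <->
  exists A B : C, forall eps, 0 < eps -> exists d, 0 < d /\ forall x y : C,
    Cmod (x - z) < d -> Cmod (y - w) < d ->
    Cmod (h x y - h z w - (A * (x - z) + B * (y - w))) <= eps * (Cmod (x - z) + Cmod (y - w)).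
Proof.
split.
- move=> [l [[lp ls _] Hl]].
  exists (l (RtoC 1, RtoC 0)), (l (RtoC 0, RtoC 1)) => eps He.
  have := Hl (z, w) (fun P H => H) (mkposreal eps He).
  move/(locally_C2 z w) => [d [dp H]]; exists d; split=> // x y hx hy.
  have := H x y hx hy.
  have -> : minus (x, y) (z, w) = ((x - z)%C, (y - w)%C) by [].
  have E : l ((x - z)%C, (y - w)%C) = (l (RtoC 1, RtoC 0) * (x - z) + l (RtoC 0, RtoC 1) * (y - w))%C.
    have -> : ((x - z)%C, (y - w)%C) = plus (scal (x - z)%C ((RtoC 1, RtoC 0) : C2)) (scal (y - w)%C ((RtoC 0, RtoC 1) : C2)).
      transitivity (((x - z) * 1 + (y - w) * 0)%C, ((x - z) * 0 + (y - w) * 1)%C); last by [].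
      by congr pair; ring.
    rewrite lp !ls.
    transitivity ((x - z) * l (RtoC 1, RtoC 0) + (y - w) * l (RtoC 0, RtoC 1))%C; [by []|cring].
  rewrite E => h1; apply: Rle_trans h1 _.
  apply: Rmult_le_compat_l; [exact: Rlt_le|exact: norm_C2_le].
- move=> [A [B H]]; exists (fun p : C2 => (A * fst p + B * snd p)%C); exact: filterdiff_C2.
Qed.

(** Differentiability at the origin alone already bounds [h] near it; the derivatives in one
    variable come from freezing the other. *)
Lemma hol2_sep_holomorphic h : hol2 h -> exists R0 M, sep_holomorphic h R0 M.
Proof.
move=> H.
have {H} : near0 (fun x y => ex_filterdiff (U := C2) (V := C_NormedModule)
  (fun p => h (fst p) (snd p)) (locally (T := C2) (x, y))).
  apply/near0_locally; apply: loc_imp H => -[x y] //.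
move=> [d [dp Hd]].
case: (proj1 (ex_filterdiff_C2 h 0 0) (Hd 0 0 ltac:(rewrite Cmod_0; lra) ltac:(rewrite Cmod_0; lra))) => A [B].
move=> /(_ 1 ltac:(lra)) [d' [dp' Hd']].
pose R0 := Rmin d (Rmin d' 1).
have R1 : R0 <= d by exact: Rmin_l.
have R2 : R0 <= d' by apply: Rle_trans (Rmin_r _ _) (Rmin_l _ _).
have R3 : R0 <= 1 by apply: Rle_trans (Rmin_r _ _) (Rmin_r _ _).
exists R0, (Cmod (h 0 0) + Cmod A + Cmod B + 2); split.
  by apply: Rmin_pos => //; apply: Rmin_pos => //; lra.
have e0 (x : C) : (x - 0 = x)%C by ring.
move=> z w hz hw; split.
  have := Hd' z w; rewrite !e0 => /(_ ltac:(lra) ltac:(lra)) h1.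
  have := Cmod_triangle (h z w - h 0 0 - (A * z + B * w)) (h 0 0 + (A * z + B * w)).
  have -> : (h z w - h 0 0 - (A * z + B * w) + (h 0 0 + (A * z + B * w)) = h z w)%C by ring.
  have := Cmod_triangle (h 0 0) (A * z + B * w); have := Cmod_triangle (A * z) (B * w).
  rewrite !Cmod_mult.
  have := Rmult_le_compat_l _ _ _ (Cmod_ge_0 A) (Rlt_le _ _ (Rlt_le_trans _ _ _ hz R3)).
  have := Rmult_le_compat_l _ _ _ (Cmod_ge_0 B) (Rlt_le _ _ (Rlt_le_trans _ _ _ hw R3)).
  lra.
case: (proj1 (ex_filterdiff_C2 h z w) (Hd z w ltac:(lra) ltac:(lra))) => A' [B' H].
have z0 (x : C) : Cmod (x - x) = 0 by rewrite (_ : (x - x = 0)%C) ?Cmod_0 //; ring.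
split.
- exists A' => eps He; case: (H eps He) => e [ep He']; exists e; split=> // y hy.
  have := He' y w hy ltac:(rewrite z0; lra); rewrite z0 Rplus_0_r.
  by have -> : (A' * (y - z) + B' * (w - w) = A' * (y - z))%C by ring.
- exists B' => eps He; case: (H eps He) => e [ep He']; exists e; split=> // y hy.
  have := He' z y ltac:(rewrite z0; lra) hy; rewrite z0 Rplus_0_l.
  by have -> : (A' * (z - z) + B' * (y - w) = B' * (y - w))%C by ring.
Qed.

Lemma quad_hol2 h s K : quad_approx h s K -> hol2 h.
Proof.
move=> [sp [Kp H]].
have X : near0 (fun x y => ex_filterdiff (U := C2) (V := C_NormedModule)
  (fun p => h (fst p) (snd p)) (locally (T := C2) (x, y))).
  exists s; split=> // z w hz hw; apply/ex_filterdiff_C2.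
  case: (H z w ltac:(lra) ltac:(lra)) => A [B [_ [_ HAB]]]; exists A, B => eps He.
  have e2 : 0 < eps / (2 * K) by apply: Rdiv_lt_0_compat; lra.
  have m : 0 < Rmin (s - Cmod z) (s - Cmod w) by apply: Rmin_pos; lra.
  exists (Rmin (Rmin (s - Cmod z) (s - Cmod w)) (eps / (2 * K))); split; first exact: Rmin_pos.
  move=> x y hx hy.
  have m1 := Rmin_l (Rmin (s - Cmod z) (s - Cmod w)) (eps / (2 * K)).
  have m2 := Rmin_r (Rmin (s - Cmod z) (s - Cmod w)) (eps / (2 * K)).
  have m3 := Rmin_l (s - Cmod z) (s - Cmod w). have m4 := Rmin_r (s - Cmod z) (s - Cmod w).
  have t1 := Cmod_triangle (x - z) z; have t2 := Cmod_triangle (y - w) w.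
  rewrite (_ : (x - z + z = x)%C) in t1; last ring.
  rewrite (_ : (y - w + w = y)%C) in t2; last ring.
  apply: Rle_trans (HAB x y ltac:(lra) ltac:(lra)) _.
  set De := _ + _.
  have D0 : 0 <= De by have := Cmod_ge_0 (x - z); have := Cmod_ge_0 (y - w); rewrite /De; lra.
  have DD : De <= eps / K.
    have -> : eps / K = eps / (2 * K) + eps / (2 * K) by field; lra. rewrite /De; lra.
  rewrite -Rmult_assoc; apply: Rmult_le_compat_r => //.
  have := Rmult_le_compat_l K _ _ ltac:(lra) DD.
  have -> : K * (eps / K) = eps by field; lra. by [].
move/near0_locally: X; apply: loc_imp => -[x y] //.
Qed.

Lemma hol2_analytic h : hol2 h -> analytic2 h.
Proof. by move/hol2_sep_holomorphic => [R0 [M /sep_holomorphic_analytic]]. Qed.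
Lemma analytic_hol2 h : analytic2 h -> hol2 h.
Proof. by move/analytic_quad => [s [K /quad_hol2]]. Qed.

(** Symmetry is hidden in the iterated sum [is_dseries] but evident in [sep_holomorphic], so the
    swap is done there. *)
Lemma hol2_swap h : hol2 h -> hol2 (fun z w => h w z).
Proof.
move/hol2_sep_holomorphic => [R0 [M [R0p H]]]; apply: analytic_hol2; apply: (sep_holomorphic_analytic _ R0 M).
split=> // z w hz hw; case: (H w z hw hz) => h1 [h2 h3]; by [].
Qed.

Lemma hol2_ext h h' : near0 (fun z w => h z w = h' z w) -> hol2 h -> hol2 h'.
Proof.
move/near0_locally/locally_locally => E.
apply: loc_imp2 E => p E [l Hl]; exists l.
exact: filterdiff_ext_locally E Hl.
Qed.

Lemma hol2_const c : hol2 (fun _ _ => c).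
Proof.
apply: loc_all => p; eexists; apply: filterdiff_const.
Qed.
Lemma hol2_fst : hol2 (fun z _ => z).
Proof.
by apply: loc_all => p; eexists; apply: filterdiff_linear; apply: is_linear_fst.
Qed.
Lemma hol2_snd : hol2 (fun _ w => w).
Proof.
by apply: loc_all => p; eexists; apply: filterdiff_linear; apply: is_linear_snd.
Qed.
Lemma hol2_plus h k : hol2 h -> hol2 k -> hol2 (fun z w => h z w + k z w)%C.
Proof.
apply: loc_imp2 => p [l Hl] [m Hm]; eexists.
apply: filterdiff_plus_fct Hl Hm.
Qed.
Lemma Cmult_ex_filterdiff (z w : C) :
  ex_filterdiff (U := C2) (V := C_NormedModule) (fun p : C * C => (fst p * snd p)%C) (locally (T := C2) (z, w)).
Proof.
apply/(ex_filterdiff_C2 Cmult); exists w, z => eps He; exists eps; split=> // x y hx hy.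
have -> : (x * y - z * w - (w * (x - z) + z * (y - w)) = (x - z) * (y - w))%C by ring.
rewrite Cmod_mult.
have h1 := Cmod_ge_0 (x - z); have h2 := Cmod_ge_0 (y - w).
have := Rmult_le_compat_l _ _ _ h1 (Rlt_le _ _ hy).
have := Rmult_le_pos _ _ (Rlt_le _ _ He) h2; lra.
Qed.
Lemma hol2_mult h k : hol2 h -> hol2 k -> hol2 (fun z w => h z w * k z w)%C.
Proof.
apply: loc_imp2 => p [l Hl] [m Hm].
case: (Cmult_ex_filterdiff (h (fst p) (snd p)) (k (fst p) (snd p))) => lh Hlh.
exists (fun y => lh (l y, m y)).
apply: (filterdiff_comp'_2 (K := C_AbsRing) (T := C2) (U := C_NormedModule) (V := C_NormedModule) (W := C_NormedModule)
   (fun p => h (fst p) (snd p)) (fun p => k (fst p) (snd p)) Cmult p l m (fun x y => lh (x, y))) => //.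
apply: filterdiff_ext_lin Hlh _ => -[x y] //.
Qed.

Lemma hol2_pair_near a b : hol2 a -> hol2 b -> a 0 0 = RtoC 0 -> b 0 0 = RtoC 0 ->
  forall P, locally (T := C2) origin P -> locally (T := C2) origin (fun p => P (a (fst p) (snd p), b (fst p) (snd p))).
Proof.
move=> Ha Hb a0 b0 P HP.
have Ca : continuous (T := C2) (U := C_NormedModule) (fun p => a (fst p) (snd p)) origin.
  apply: (filterdiff_continuous (K := C_AbsRing) (U := C2) (V := C_NormedModule)); exact: locally_singleton Ha.
have Cb : continuous (T := C2) (U := C_NormedModule) (fun p => b (fst p) (snd p)) origin.
  apply: (filterdiff_continuous (K := C_AbsRing) (U := C2) (V := C_NormedModule)); exact: locally_singleton Hb.
have CC := filterlim_pair _ _ Ca Cb.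
rewrite /origin [fst _]/= [snd _]/= a0 b0 in CC.
move/(locally_C2 0 0): HP => [d [dp Hd]].
have L0 : locally (T := C_NormedModule) (RtoC 0) (fun x : C => Cmod (x - 0) < d) by apply/locally_C1; exists d.
apply: (CC _ P); exists (fun x : C => Cmod (x - 0) < d) (fun x : C => Cmod (x - 0) < d) => //.
Qed.

Lemma hol2_comp h a b : hol2 h -> hol2 a -> hol2 b -> a 0 0 = RtoC 0 -> b 0 0 = RtoC 0 ->
  hol2 (fun z w => h (a z w) (b z w)).
Proof.
move=> Hh Ha Hb a0 b0.
have Hh' := hol2_pair_near a b Ha Hb a0 b0 _ Hh.
have HA : locally (T := C2) origin (fun p => ex_filterdiff (U := C2) (V := C_NormedModule) (fun p => a (fst p) (snd p)) (locally p) /\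
   ex_filterdiff (U := C2) (V := C_NormedModule) (fun p => b (fst p) (snd p)) (locally p)) by exact: loc_and.
apply: loc_imp2 Hh' HA => p [lh Hlh] [[la Hla] [lb Hlb]].
exists (fun y => lh (la y, lb y)).
apply: (filterdiff_comp'_2 (K := C_AbsRing) (T := C2) (U := C_NormedModule) (V := C_NormedModule) (W := C_NormedModule)
   (fun p => a (fst p) (snd p)) (fun p => b (fst p) (snd p)) h p la lb (fun x y => lh (x, y))) => //.
apply: filterdiff_ext_lin Hlh _ => -[x y] //.
Qed.

Lemma near0_comp a b P : hol2 a -> hol2 b -> a 0 0 = RtoC 0 -> b 0 0 = RtoC 0 ->
  near0 P -> near0 (fun z w => P (a z w) (b z w)).
Proof.
move=> Ha Hb a0 b0 /near0_locally HP; apply/near0_locally.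
exact: (hol2_pair_near a b Ha Hb a0 b0 _ HP).
Qed.
Lemma near0_and P Q : near0 P -> near0 Q -> near0 (fun z w => P z w /\ Q z w).
Proof. by move=> /near0_locally HP /near0_locally HQ; apply/near0_locally; exact: loc_and. Qed.
Lemma near0_imp (P Q : C -> C -> Prop) : (forall z w, P z w -> Q z w) -> near0 P -> near0 Q.
Proof. by move=> H [d [dp Hd]]; exists d; split=> // z w hz hw; apply: H; apply: Hd. Qed.
Lemma near0_all (P : C -> C -> Prop) : (forall z w, P z w) -> near0 P.
Proof. by move=> H; exists 1; split; [lra|]. Qed.
Lemma near0_origin (P : C -> C -> Prop) : near0 P -> P 0 0.
Proof. by move=> [d [dp H]]; apply: H; rewrite Cmod_0. Qed.

(** * Jets, vanishing coefficients and division *)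

Lemma csum_last (a : nat -> C) n : (forall k, (k < n)%nat -> a k = RtoC 0) -> sum_n a n = a n.
Proof.
case: n => [|n] H; first by rewrite sum_O.
rewrite csum_S csum_zero; last by move=> k kn; apply: H; lia.
cring.
Qed.

(** The [m] terms of degree strictly below [m]; the jet of order 0 is zero. *)
Fixpoint jet (a : nat -> C) (m : nat) (w : C) : C :=
  match m with O => 0 | S m => (jet a m w + a m * w ^ m)%C end.

Lemma jet_sum a m w : jet a (S m) w = sum_n (fun k => a k * w ^ k)%C m.
Proof.
elim: m => [|m IH]; first by rewrite sum_O /=; cring.
by rewrite csum_S -IH.
Qed.

Lemma jet_series a m w : serC (fun k => if Nat.ltb k m then a k * w ^ k else RtoC 0)%C (jet a m w).
Proof.
case: m => [|m]; first exact: serC_zero.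
rewrite jet_sum (sum_n_ext_loc _ (fun k => if Nat.ltb k (S m) then a k * w ^ k else RtoC 0)%C).
  by apply: serC_fin => k mk; have -> : Nat.ltb k (S m) = false by apply/Nat.ltb_ge; lia.
by move=> k km; have -> : Nat.ltb k (S m) = true by apply/Nat.ltb_lt; lia.
Qed.

(** Writing [R1 |z|] as half of [2 R1 |z| <= 1] splits each term into the wanted power [m] and a
    summable factor [(1/2)^k]. *)
Lemma series_tail (a : nat -> C) M R1 (z S : C) m : 0 <= M -> 0 < R1 ->
  (forall n, Cmod (a n) <= M * R1 ^ n) -> 2 * R1 * Cmod z <= 1 ->
  serC (fun n => a n * z ^ n)%C S -> Cmod (S - jet a m z) <= 2 * (M * (2 * R1 * Cmod z) ^ m).
Proof.
move=> HM HR Ha Rt HS.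
have z0 := Cmod_ge_0 z.
have Rt0 : 0 <= 2 * R1 * Cmod z by apply: Rmult_le_pos; lra.
pose b k := (if Nat.ltb k m then RtoC 0 else a k * z ^ k)%C.
pose a' k := (if Nat.ltb k m then a k * z ^ k else RtoC 0)%C.
have Ea' : serC a' (jet a m z) by exact: jet_series.
have Hb : serC b (S - jet a m z)%C.
  have := serC_plus _ _ _ _ HS (serC_scal (-1)%C _ _ Ea').
  have -> : (S - jet a m z = S + -1 * jet a m z)%C by ring.
  apply: serC_ext => k; rewrite /a' /b; case: (Nat.ltb k m); ring.
have Mt : 0 <= M * (2 * R1 * Cmod z) ^ m by apply: Rmult_le_pos => //; apply: pow_le.
have bb k : Cmod (b k) <= M * (2 * R1 * Cmod z) ^ m * (1/2) ^ k.
  have P0 : 0 <= M * (2 * R1 * Cmod z) ^ m * (1/2) ^ k.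
    by apply: Rmult_le_pos => //; apply: pow_le; lra.
  rewrite /b; case: (Nat.ltb_spec k m) => hk; first by rewrite Cmod_0.
  rewrite Cmod_mult Cmod_pow.
  apply: Rle_trans (Rmult_le_compat_r _ _ _ (pow_le _ _ z0) (Ha k)) _.
  have -> : M * R1 ^ k * Cmod z ^ k = M * (2 * R1 * Cmod z) ^ k * (1/2) ^ k.
    rewrite !Rmult_assoc -!Rpow_mult_distr; congr (_ * _ ^ _); field.
  apply: Rmult_le_compat_r; first by apply: pow_le; lra.
  apply: Rmult_le_compat_l => //.
  have -> : (k = m + (k - m))%nat by lia.
  rewrite pow_add; have := pow_incr (2 * R1 * Cmod z) 1 (k - m) (conj Rt0 Rt); rewrite pow1.
  move=> h; have := Rmult_le_compat_l _ _ _ (pow_le _ m Rt0) h; lra.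
apply: serC_le Hb _ => N; apply: Rle_trans (csum_Cmod _ _) _.
apply: Rle_trans (_ : sum_n (fun k => M * (2 * R1 * Cmod z) ^ m * (1/2) ^ k) N <= _); first by apply: rsum_le.
rewrite rsum_scal Rmult_comm; apply: Rmult_le_compat_r => //; apply: sum_geom_le; lra.
Qed.

Lemma jet_last a n w : (forall k, (k < n)%nat -> a k = RtoC 0) -> jet a (S n) w = (a n * w ^ n)%C.
Proof.
move=> H; rewrite jet_sum (csum_last (fun k => a k * w ^ k)%C) // => k kn; rewrite H //; ring.
Qed.

(** By strong induction the lowest remaining term [a n t^n] is [O(t^(n+1))], so its coefficient
    vanishes. With [c = 0] this is the identity theorem for power series. *)
Lemma coef_zero (a : nat -> C) M R1 d c m : 0 <= M -> 0 < R1 ->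
  (forall n, Cmod (a n) <= M * R1 ^ n) -> 0 < d -> 0 <= c ->
  (forall z, Cmod z < d -> exists S, serC (fun n => a n * z ^ n)%C S /\ Cmod S <= c * Cmod z ^ m) ->
  forall n, (n < m)%nat -> a n = RtoC 0.
Proof.
move=> HM HR Ha dp cp H.
elim/(well_founded_induction Wf_nat.lt_wf) => n IH nm.
pose B := c + 2 * (M * (2 * R1) ^ S n).
have R2 : 0 < 2 * R1 by lra.
have B0 : 0 <= 2 * (M * (2 * R1) ^ S n).
  by apply: Rmult_le_pos; [lra|apply: Rmult_le_pos => //; apply: pow_le; lra].
pose t0 := Rmin (d / 2) (Rmin 1 (/ (2 * R1))).
have iR : 0 < / (2 * R1) by apply: Rinv_0_lt_compat.
have t0p : 0 < t0 by apply: Rmin_pos; [lra|apply: Rmin_pos; lra].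
have t01 : t0 <= d / 2 by apply: Rmin_l.
have t02 : t0 <= 1 by apply: Rle_trans (Rmin_r _ _) (Rmin_l _ _).
have t03 : t0 <= / (2 * R1) by apply: Rle_trans (Rmin_r _ _) (Rmin_r _ _).
have key t : 0 < t <= t0 -> Cmod (a n) <= B * t.
  move=> [tp tt].
  have mt : Cmod (RtoC t) = t by rewrite Cmod_R Rabs_right; lra.
  have Rt : 2 * R1 * t <= 1.
    have := Rmult_le_compat_l (2 * R1) _ _ ltac:(lra) (Rle_trans _ _ _ tt t03).
    rewrite Rinv_r; lra.
  case: (H (RtoC t)) => [|S0 [HS Sb]]; first by rewrite mt; lra.
  have := series_tail a M R1 (RtoC t) S0 (S n) HM HR Ha.
  rewrite mt in Sb |- *; move=> /(_ Rt HS).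
  rewrite (jet_last a n) => [Hb2|k kn]; last by apply: IH => //; lia.
  have tn : 0 < t ^ n by apply: pow_lt.
  apply: (Rmult_le_reg_r (t ^ n)) => //.
  have -> : Cmod (a n) * t ^ n = Cmod (a n * RtoC t ^ n) by rewrite Cmod_mult Cmod_pow mt.
  have := Cmod_triangle S0 (- (S0 - a n * RtoC t ^ n)); rewrite Cmod_opp.
  have -> : (S0 + - (S0 - a n * RtoC t ^ n) = a n * RtoC t ^ n)%C by ring.
  have tm : t ^ m <= t ^ S n.
    have -> : (m = S n + (m - S n))%nat by lia.
    rewrite pow_add; have := pow_incr t 1 (m - S n) ltac:(lra); rewrite pow1.
    move=> h; have := Rmult_le_compat_l _ _ _ (pow_le t (S n) ltac:(lra)) h; lra.
  have := Rmult_le_compat_l _ _ _ cp tm.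
  have -> : B * t * t ^ n = c * t ^ S n + 2 * (M * (2 * R1 * t) ^ S n).
    rewrite /B (Rpow_mult_distr (2 * R1)) /=; ring.
  lra.
apply: Cmod_eq_0; apply: Rle_antisym; last exact: Cmod_ge_0.
apply: le_epsilon => eps He; rewrite Rplus_0_l.
have e1 : 0 < eps / (B + 1) by apply: Rdiv_lt_0_compat; rewrite /B; lra.
pose t := Rmin t0 (eps / (B + 1)).
have tp : 0 < t by apply: Rmin_pos.
apply: Rle_trans (key t (conj tp (Rmin_l _ _))) _.
have := Rmult_le_compat_l B _ _ ltac:(rewrite /B; lra) (Rmin_r t0 (eps / (B + 1))).
have : B * (eps / (B + 1)) <= eps.
  have -> : eps = (B + 1) * (eps / (B + 1)) by field; rewrite /B; lra.
  have -> : B * ((B + 1) * (eps / (B + 1)) / (B + 1)) = B * (eps / (B + 1)) by field; rewrite /B; lra.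
  lra.
rewrite -/t; lra.
Qed.

Lemma ds_shiftn m A S : is_dseries A S ->
  is_dseries (fun n l => if Nat.ltb n m then RtoC 0 else A (n - m)%nat l) S.
Proof.
elim: m => [|m IH] H.
  apply: ds_ext H => n l; by rewrite Nat.sub_0_r.
apply: ds_ext (ds_shift _ _ (IH H)) => n l; case: n => [//|n].
by [].
Qed.

Lemma row_sum (c : nat -> nat -> C) M R1 n w : 0 <= M -> 0 < R1 ->
  (forall i j, Cmod (c i j) <= M * R1 ^ (i + j)) -> Cmod w * R1 <= 1/2 ->
  exists b, serC (fun l => c n l * w ^ l)%C b /\ Cmod b <= 2 * M * R1 ^ n.
Proof.
move=> HM HR Hc Hw; apply: serC_ex => N.
have Rn : 0 <= R1 ^ n by apply: pow_le; lra.
apply: Rle_trans (_ : sum_n (fun l => M * R1 ^ n * (Cmod w * R1) ^ l) N <= _).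
  apply: rsum_le => l _; rewrite Cmod_mult Cmod_pow.
  apply: Rle_trans (Rmult_le_compat_r _ _ _ (pow_le _ _ (Cmod_ge_0 w)) (Hc n l)) _.
  rewrite pow_add Rpow_mult_distr; right; ring.
rewrite (rsum_scal _ (fun l => (Cmod w * R1) ^ l)).
have := sum_geom_le (Cmod w * R1) N (conj (Rmult_le_pos _ _ (Cmod_ge_0 w) (Rlt_le _ _ HR)) Hw).
move=> h; have := Rmult_le_compat_l _ _ _ (Rmult_le_pos _ _ HM Rn) h; lra.
Qed.

Lemma ds_rows c M R1 z w S : 0 <= M -> 0 < R1 ->
  (forall i j, Cmod (c i j) <= M * R1 ^ (i + j)) -> Cmod w * R1 <= 1/2 ->
  is_dseries (monomials c z w) S -> exists b : nat -> C,
   (forall n, serC (fun l => c n l * w ^ l)%C (b n)) /\ (forall n, Cmod (b n) <= 2 * M * R1 ^ n) /\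
   serC (fun n => b n * z ^ n)%C S.
Proof.
move=> HM HR Hc Hw [al [H1 H2]].
pose b n := proj1_sig (constructive_indefinite_description _ (row_sum c M R1 n w HM HR Hc Hw)).
have Hb n : serC (fun l => c n l * w ^ l)%C (b n) /\ Cmod (b n) <= 2 * M * R1 ^ n.
  by rewrite /b; case: constructive_indefinite_description.
exists b; split; first by move=> n; case: (Hb n).
split; first by move=> n; case: (Hb n).
apply: serC_ext H2 => n; apply: (serC_unique _ _ _ (H1 n)).
have -> : (b n * z ^ n = z ^ n * b n)%C by ring.
apply: serC_ext (serC_scal _ _ _ (proj1 (Hb n))) => l; rewrite /monomials; ring.
Qed.

(** [coef_zero] is used twice: in [z] for fixed [w], which kills the row sums of index below [m],
    then in [w] with bound 0, which kills the entries of these rows. *)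
Lemma coef_zero2 h c M R1 d e m : expansion h c M R1 -> 0 < d -> 0 <= e ->
  (forall z w, Cmod z < d -> Cmod w < d -> Cmod (h z w) <= e * Cmod z ^ m) ->
  forall n l, (n < m)%nat -> c n l = RtoC 0.
Proof.
move=> [HM [HR [Hc Hh]]] dp ep H n l nm.
pose d1 := Rmin d (/ (2 * R1)).
have iR : 0 < / (2 * R1) by apply: Rinv_0_lt_compat; lra.
have d1p : 0 < d1 by apply: Rmin_pos.
have d1d : d1 <= d by exact: Rmin_l.
have sm x : Cmod x < d1 -> Cmod x * R1 <= 1/2.
  move=> hx; have := Rmult_le_compat_r R1 _ _ ltac:(lra) (Rle_trans _ _ _ (Rlt_le _ _ hx) (Rmin_r d (/ (2 * R1)))).
  have -> : / (2 * R1) * R1 = 1/2 by field; lra. by [].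
have B w : Cmod w < d1 -> serC (fun l => c n l * w ^ l)%C (RtoC 0).
  move=> hw; case: (ds_rows c M R1 0 w _ HM HR Hc (sm w hw) (Hh 0 w ltac:(rewrite Cmod_0; lra) (sm w hw))) => b [Hb1 [Hb2 _]].
  have -> : RtoC 0 = b n; last exact: Hb1.
  symmetry; apply: (coef_zero b (2 * M) R1 d1 e m) => //; first lra.
  move=> z hz; exists (h z w); split; last by apply: H; lra.
  case: (ds_rows c M R1 z w _ HM HR Hc (sm w hw) (Hh z w (sm z hz) (sm w hw))) => b' [Hb1' [_ Hb']].
  apply: serC_ext Hb' => k; congr Cmult; exact: serC_unique (Hb1' k) (Hb1 k).
apply: (coef_zero (c n) (M * R1 ^ n) R1 d1 0 (S l)) => //; try lra; try lia.
- apply: Rmult_le_pos => //; apply: pow_le; lra.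
- by move=> k; rewrite Rmult_assoc -pow_add.
- move=> w hw; exists (RtoC 0); split; first exact: B.
  rewrite Cmod_0; lra.
Qed.

(** The bound makes the first [m] rows vanish; the quotient is the sum of the array shifted by [m]
    rows. *)
Theorem division h m e : hol2 h -> near0 (fun z w => Cmod (h z w) <= e * Cmod z ^ m) ->
  exists s, hol2 s /\ near0 (fun z w => h z w = (z ^ m * s z w)%C).
Proof.
move=> /hol2_analytic [c [M [R1 Hexp]]] [d [dp Hd]].
case: (Hexp) => HM [HR [Hc Hh]].
have Hz := coef_zero2 h c M R1 d (Rabs e) m Hexp dp (Rabs_pos e).
have {}Hz n l : (n < m)%nat -> c n l = RtoC 0.
  apply: Hz => z w hz hw; apply: Rle_trans (Hd z w hz hw) _.
  apply: Rmult_le_compat_r; [by apply: pow_le; apply: Cmod_ge_0|exact: Rle_abs].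
have Hc' i j : Cmod (c (i + m)%nat j) <= (M * R1 ^ m) * R1 ^ (i + j).
  apply: Rle_trans (Hc _ _) _; rewrite !pow_add; right; ring.
case: (array_analytic (fun i j => c (i + m)%nat j) (M * R1 ^ m) R1) => //.
  by apply: Rmult_le_pos => //; apply: pow_le; lra.
move=> s Hs; exists s; split; first by apply: analytic_hol2; eexists; eexists; eexists; exact: Hs.
have iR : 0 < / (2 * R1) by apply: Rinv_0_lt_compat; lra.
exists (/ (2 * R1)); split=> // z w hz hw.
have sm x : Cmod x < / (2 * R1) -> Cmod x * R1 <= 1/2.
  move=> hx; have := Rmult_le_compat_r R1 _ _ ltac:(lra) (Rlt_le _ _ hx).
  have -> : / (2 * R1) * R1 = 1/2 by field; lra. by [].
apply: (ds_unique (monomials c z w)); first by apply: Hh; apply: sm.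
case: Hs => _ [_ [_ Hs]].
have := ds_shiftn m _ _ (ds_scal (z ^ m)%C _ _ (Hs z w (sm z hz) (sm w hw))).
apply: ds_ext => n l; rewrite /monomials.
case: (Nat.ltb_spec n m) => nm; first by rewrite Hz //; ring.
have -> : (n - m + m = n)%nat by lia.
have -> : (z ^ n = z ^ m * z ^ (n - m))%C by rewrite -Cpow_add_r; congr Cpow; lia.
ring.
Qed.

Lemma hol2_lip h : hol2 h -> exists s K, 0 < s /\ 0 < K /\ forall z w z' w',
  Cmod z < s -> Cmod w < s -> Cmod z' < s -> Cmod w' < s ->
  Cmod (h z w - h z' w') <= K * (Cmod (z - z') + Cmod (w - w')).
Proof.
move/hol2_analytic/analytic_quad => [s [K [sp [Kp H]]]].
exists s, (K + K * (4 * s)); have Ks : 0 < K * (4 * s) by apply: Rmult_lt_0_compat; lra.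
split=> //; split; first lra.
move=> z w z' w' hz hw hz' hw'.
case: (H z' w' ltac:(lra) ltac:(lra)) => A [B [HA [HB /(_ z w ltac:(lra) ltac:(lra)) H2]]].
have := Cmod_triangle (h z w - h z' w' - (A * (z - z') + B * (w - w'))) (A * (z - z') + B * (w - w')).
have -> : (h z w - h z' w' - (A * (z - z') + B * (w - w')) + (A * (z - z') + B * (w - w')) = h z w - h z' w')%C by ring.
have := Cmod_triangle (A * (z - z')) (B * (w - w')); rewrite !Cmod_mult.
have dz := Cmod_ge_0 (z - z'); have dw := Cmod_ge_0 (w - w').
have := Rmult_le_compat_r _ _ _ dz HA; have := Rmult_le_compat_r _ _ _ dw HB.
have tz := Cmod_triangle z (- z'); have tw := Cmod_triangle w (- w').
rewrite Cmod_opp -/(Cminus _ _) in tz; rewrite Cmod_opp -/(Cminus _ _) in tw.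
have D1 : Cmod (z - z') + Cmod (w - w') <= 4 * s by lra.
have D2 : 0 <= Cmod (z - z') + Cmod (w - w') by lra.
have := Rmult_le_compat_l K _ _ ltac:(lra) (Rmult_le_compat_r _ _ _ D2 D1).
lra.
Qed.

(** * Twisted and implicit equations *)

(* The weights [K] encode the small divisors; see [brjuno_weight_shift]. *)
Definition divisor_weight (sig : nat -> C) (K : nat -> R) (B : R) : Prop :=
  K 0%nat = 0 /\ (forall n, 0 <= K n) /\ (forall m n, K m + K n <= K (m + n)%nat) /\
  (forall n, K n <= B * INR n) /\ (forall n, exp (K n - K (S n)) <= Cmod (sig (S n))).

(** Composition with [z -> mu z] multiplies row [n] by [mu^n], so the left side multiplies row [n]
    by the divisor and [formal_solution] applies. The bound [|mu| <= 1] keeps [mu z] in the domain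
    of [x]. *)
Theorem solve_twisted (k1 k2 mu : C) K B h : 
  divisor_weight (fun n => k1 * mu ^ n + k2)%C K B -> Cmod mu <= 1 -> hol2 h ->
  exists x, hol2 x /\ near0 (fun _ w => x 0 w = RtoC 0) /\
    near0 (fun z w => (k1 * x (mu * z) w + k2 * x z w = z * h z (w + x z w))%C).
Proof.
move=> [K0 [Kp [Ks [KB Kd]]]] mu1 /hol2_analytic [c [M [R1 [HM [HR [Hc Hh]]]]]].
case: (formal_solution K B (fun n => k1 * mu ^ n + k2)%C c M R1 K0 Kp Ks KB Kd HR HM Hc)
  => X [d [M' [R' [dp [HM' [HR' [X0 [HX Hsol]]]]]]]].
case: (array_analytic X M' R' HM' HR' HX) => x Hx.
have Hx3 := proj2 (proj2 (proj2 Hx)).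
exists x; split; first by apply: analytic_hol2; eexists; eexists; eexists; exact: Hx.
pose e := Rmin d (/ (2 * R')).
have iR : 0 < / (2 * R') by apply: Rinv_0_lt_compat; lra.
have ep : 0 < e by apply: Rmin_pos.
have ed : e <= d by exact: Rmin_l.
have sm y : Cmod y < e -> Cmod y * R' <= 1/2.
  move=> hy; have := Rmult_le_compat_r R' _ _ ltac:(lra) (Rle_trans _ _ _ (Rlt_le _ _ hy) (Rmin_r d (/ (2 * R')))).
  have -> : / (2 * R') * R' = 1/2 by field; lra. by [].
split.
- exists e; split=> // z w _ hw.
  apply: (ds_unique (monomials X 0 w)); first by apply: Hx3; [rewrite Cmod_0; lra|exact: sm].
  exists (fun _ => RtoC 0); split; last exact: serC_zero.
  move=> n; apply: serC_ext serC_zero => l; rewrite /monomials.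
  case: n => [|n]; first by rewrite X0; ring.
  rewrite Cpow_S; ring.
- exists e; split=> // z w hz hw.
  have hmz : Cmod (mu * z) < e.
    rewrite Cmod_mult; have := Rmult_le_compat_r _ _ _ (Cmod_ge_0 z) mu1; lra.
  have D1 := Hx3 z w (sm z hz) (sm w hw).
  have D2 := Hx3 (mu * z)%C w (sm _ hmz) (sm w hw).
  case: (Hsol z w ltac:(lra) ltac:(lra)) => y [Hy [B1 [B2 Hy2]]].
  have Ey : y = x z w by apply: ds_unique Hy D1.
  rewrite Ey in B2 Hy2.
  have := Hy2 _ (Hh z (w + x z w)%C ltac:(lra) ltac:(lra)).
  move=> D3; apply: ds_unique D3.
  apply: ds_ext (ds_plus _ _ _ _ (ds_scal k1 _ _ D2) (ds_scal k2 _ _ D1)) => n l.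
  rewrite /monomials Cpow_mult_l; ring.
Qed.

Lemma trivial_weight (c : C) : Cmod c = 1 -> divisor_weight (fun n => 0 * 1 ^ n + c)%C (fun _ => 0) 0.
Proof.
move=> Hc; do 4 (split; first by move=> *; lra || exact: Rle_refl).
by move=> n; rewrite Rminus_0_r exp_0 Cmult_0_l Cplus_0_l Hc; lra.
Qed.

(* No small divisors here: [x = z * h z (w + x)] is an ordinary implicit equation. *)
Lemma solve_implicit h : hol2 h -> exists x, hol2 x /\ near0 (fun _ w => x 0 w = RtoC 0) /\
    near0 (fun z w => (x z w = z * h z (w + x z w))%C).
Proof.
move=> Hh; case: (solve_twisted 0 1 1 _ _ h (trivial_weight 1 Cmod_1) ltac:(rewrite Cmod_1; lra) Hh)
  => x [Hx [Hx0 Hx1]]; exists x; split=> //; split=> //.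
apply: near0_imp Hx1 => z w <-; ring.
Qed.

(** Dividing out the solution's own factors of [z] decides [s]: the divisors are [lambda^n - 1] for
    [s = 0] and [lambda^(n+1) - 1] for [s = 1]. *)
Lemma brjuno_solve lambda h (s : nat) : Brjuno lambda -> (s <= 1)%nat -> hol2 h ->
  exists x, hol2 x /\ near0 (fun _ w => x 0 w = RtoC 0) /\
    near0 (fun z w => (lambda ^ s * x (lambda * z) w - x z w = z * h z (w + x z w))%C).
Proof.
move=> HB Hs Hh.
case: (brjuno_weight_shift lambda s HB Hs) => K [B [h1 [h2 [h3 [h4 h5]]]]].
have W : divisor_weight (fun n => lambda ^ s * lambda ^ n + -1)%C K B.
  do 4 (split; first by []).
  move=> n; have := h5 n; rewrite Cpow_add_r.
  by have -> : (lambda ^ S n * lambda ^ s - 1 = lambda ^ s * lambda ^ S n + -1)%C by ring.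
case: (brjuno_unit lambda HB) => L1 _.
case: (solve_twisted _ _ _ _ _ h W ltac:(lra) Hh) => x [Hx [Hx0 Hx1]].
exists x; split=> //; split=> //; apply: near0_imp Hx1 => z w <-; ring.
Qed.

(** * Inverses of shears *)

Lemma vanish_div v : hol2 v -> near0 (fun _ w => v 0 w = RtoC 0) ->
  exists h, hol2 h /\ near0 (fun z w => v z w = (z * h z w)%C).
Proof.
move=> Hv [d [dp Hd]]; case: (hol2_lip v Hv) => s [K [sp [Kp HL]]].
case: (division v 1 K Hv) => [|h [Hh He]].
  exists (Rmin d s); split; first exact: Rmin_pos.
  move=> z w hz hw; have m1 := Rmin_l d s; have m2 := Rmin_r d s.
  have := HL z w 0 w ltac:(lra) ltac:(lra) ltac:(rewrite Cmod_0; lra) ltac:(lra).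
  rewrite (Hd z w); [|lra|lra].
  have -> : (v z w - 0 = v z w)%C by ring. have -> : (z - 0 = z)%C by ring.
  have -> : (w - w = 0)%C by ring. rewrite Cmod_0 Rplus_0_r /= Rmult_1_r; by [].
exists h; split=> //; apply: near0_imp He => z w ->; by rewrite Cpow_1_r.
Qed.

(** With [v = z h], the equation for the inverse reads [u = - z h(z, w + u)], which is exactly the
    form of [solve_implicit]. *)
Lemma shear_right_inverse v : hol2 v -> near0 (fun _ w => v 0 w = RtoC 0) ->
  exists u, hol2 u /\ near0 (fun _ w => u 0 w = RtoC 0) /\
    near0 (fun z w => (u z w + v z (w + u z w) = 0)%C).
Proof.
move=> Hv Hv0; case: (vanish_div v Hv Hv0) => h [Hh Eh].
case: (solve_implicit (fun z w => RtoC (-1) * h z w)%C) => [|u [Hu [Hu0 Eu]]].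
  by apply: hol2_mult => //; exact: hol2_const.
exists u; split=> //; split=> //.
have u00 : (0 + u 0 0 = 0)%C by rewrite (near0_origin _ Hu0); ring.
have := near0_comp (fun z w => z) (fun z w => w + u z w)%C _ hol2_fst
  (hol2_plus _ _ hol2_snd Hu) eq_refl u00 Eh.
move=> E2; apply: near0_imp (near0_and _ _ Eu E2) => z w [e1 ->].
rewrite {1}e1; ring.
Qed.

(* The right inverse is a shear again, so it has a right inverse itself: it is two-sided. *)
Lemma shear_inverse v : hol2 v -> near0 (fun _ w => v 0 w = RtoC 0) ->
  exists u, hol2 u /\ near0 (fun _ w => u 0 w = RtoC 0) /\
    near0 (fun z w => (u z w + v z (w + u z w) = 0)%C) /\
    near0 (fun z w => (v z w + u z (w + v z w) = 0)%C).
Proof.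
move=> Hv Hv0; case: (shear_right_inverse v Hv Hv0) => u [Hu [Hu0 Eu]].
case: (shear_right_inverse u Hu Hu0) => v' [Hv' [Hv0' Ev']].
exists u; split=> //; split=> //; split=> //.
have w0 f : near0 (fun _ w => f 0 w = RtoC 0) -> (0 + f 0 0 = 0)%C.
  by move=> /near0_origin ->; ring.
have C1 := near0_comp (fun z w => z) (fun z w => w + v' z w)%C _ hol2_fst
  (hol2_plus _ _ hol2_snd Hv') eq_refl (w0 v' Hv0') Eu.
have Evv : near0 (fun z w => v z w = v' z w).
  apply: near0_imp (near0_and _ _ C1 Ev') => z w [e1 e2].
  have E : (w + v' z w + u z (w + v' z w) = w)%C.
    have -> : (w + v' z w + u z (w + v' z w) = w + (v' z w + u z (w + v' z w)))%C by ring.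
    rewrite e2; ring.
  rewrite E in e1.
  have -> : (v z w = (u z (w + v' z w) + v z w) - (v' z w + u z (w + v' z w)) + v' z w)%C by ring.
  rewrite e1 e2; ring.
apply: near0_imp (near0_and _ _ Evv Ev') => z w [-> e2]; exact: e2.
Qed.

(** With [y = z h], the equation reads [x = - z (1 + x)^2 h(z (1 + x))]; solving it as a family in
    [w] and setting [w = 0] gives the unknown of one variable. *)
Lemma radial_right_inverse y : hol2 (fun z _ => y z) -> y 0 = RtoC 0 ->
  exists x, hol2 (fun z _ => x z) /\ x 0 = RtoC 0 /\
    near0 (fun z _ => ((1 + x z) * (1 + y (z * (1 + x z))) = 1)%C).
Proof.
move=> Hy y0; case: (vanish_div (fun z _ => y z) Hy) => [|h [Hh Eh]]; first exact: near0_all.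
have one_snd : hol2 (fun z w => 1 + w)%C by apply: hol2_plus; [exact: hol2_const|exact: hol2_snd].
have arg : hol2 (fun z w => z * (1 + w))%C by apply: hol2_mult; [exact: hol2_fst|].
have Z00 : (0 * (1 + 0) = 0)%C by ring.
case: (solve_implicit (fun z w => RtoC (-1) * ((1 + w) * (1 + w) * h (z * (1 + w)) 0))%C) => [|X [HX [HX0 EX]]].
  apply: hol2_mult; first exact: hol2_const.
  apply: hol2_mult; first exact: hol2_mult.
  by apply: hol2_comp => //; exact: hol2_const.
have Hx : hol2 (fun z _ => X z 0).
  apply: (hol2_comp X (fun z _ => z) (fun _ _ => RtoC 0)) => //; [exact: hol2_fst|exact: hol2_const].
exists (fun z => X z 0); split=> //; split; first exact: (near0_origin _ HX0).
have E1 := near0_comp (fun z _ => z) (fun _ _ => RtoC 0) _ hol2_fst (hol2_const 0) eq_refl eq_refl EX.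
have E2 := near0_comp (fun z _ => z * (1 + X z 0))%C (fun _ _ => RtoC 0) _
  (hol2_mult _ _ hol2_fst (hol2_plus _ _ (hol2_const 1) Hx)) (hol2_const 0) ltac:(cbv beta; ring) eq_refl Eh.
apply: near0_imp (near0_and _ _ E1 E2) => z w [e1 e2].
rewrite Cplus_0_l in e1.
rewrite e2.
set H := h _ _ in e1 *.
set T := X z 0 in e1 *.
have -> : ((1 + T) * (1 + z * (1 + T) * H) = 1 + T - z * (-1 * ((1 + T) * (1 + T) * H)))%C by ring.
rewrite -e1; ring.
Qed.

Lemma radial_inverse y : hol2 (fun z _ => y z) -> y 0 = RtoC 0 ->
  exists x, hol2 (fun z _ => x z) /\ x 0 = RtoC 0 /\
    near0 (fun z _ => (z * (1 + x z) * (1 + y (z * (1 + x z))) = z)%C) /\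
    near0 (fun z _ => (z * (1 + y z) * (1 + x (z * (1 + y z))) = z)%C).
Proof.
move=> Hy y0; case: (radial_right_inverse y Hy y0) => x [Hx [x0 Ex]].
case: (radial_right_inverse x Hx x0) => y' [Hy' [y0' Ey']].
exists x; split=> //; split=> //; split.
  apply: near0_imp Ex => z w e; have -> : forall a b : C, (z * a * b = z * (a * b))%C by move=> *; ring.
  rewrite e; ring.
have C1 := near0_comp (fun z _ => z * (1 + y' z))%C (fun _ _ => RtoC 0) _
  (hol2_mult _ _ hol2_fst (hol2_plus _ _ (hol2_const 1) Hy')) (hol2_const 0) ltac:(cbv beta; ring) eq_refl Ex.
apply: near0_imp (near0_and _ _ C1 Ey') => z w [e1 e2].
have e3 : (z * (1 + y' z) * (1 + x (z * (1 + y' z))) = z)%C.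
  have -> : forall a b : C, (z * a * b = z * (a * b))%C by move=> *; ring.
  rewrite e2; ring.
rewrite e3 in e1.
have E : (1 + y z = 1 + y' z)%C.
  set a := (1 + x _)%C in e1 e2.
  have -> : (1 + y z = ((1 + y' z) * a) * (1 + y z))%C by rewrite e2; ring.
  have -> : ((1 + y' z) * a * (1 + y z) = (1 + y' z) * (a * (1 + y z)))%C by ring.
  rewrite e1; ring.
by rewrite E.
Qed.

(** * Conjugacy of skew-products *)

Definition pmap (a b : C -> C -> C) (p : C * C) : C * C := (a (fst p) (snd p), b (fst p) (snd p)).

Lemma filterdiff_pmap (a b : C -> C -> C) (p : C2) la lb :
  filterdiff (U := C2) (V := C_NormedModule) (fun p => a (fst p) (snd p)) (locally p) la ->
  filterdiff (U := C2) (V := C_NormedModule) (fun p => b (fst p) (snd p)) (locally p) lb ->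
  filterdiff (U := C2) (V := C2) (pmap a b) (locally p) (fun y => (la y, lb y)).
Proof.
move=> Ha Hb.
apply: (filterdiff_comp'_2 (K := C_AbsRing) (T := C2) (U := C_NormedModule) (V := C_NormedModule) (W := C2)
   (fun p => a (fst p) (snd p)) (fun p => b (fst p) (snd p)) (fun x y => (x, y)) p la lb (fun x y => (x, y))) => //.
set q := locally _.
apply: (filterdiff_ext_lin (K := C_AbsRing) (U := C2) (V := C2) (F := q) (fun t => (fst t, snd t)) (fun t => t)); last by case.
apply: (filterdiff_ext (K := C_AbsRing) (U := C2) (V := C2) (F := q) (fun t => t)); first by case.
exact: filterdiff_id.
Qed.

Lemma hol_pmap a b : hol2 a -> hol2 b -> holomorphic_near (U := C2) (V := C2) (pmap a b) origin.
Proof.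
apply: loc_imp2 => p [la Ha] [lb Hb]; exists (fun y => (la y, lb y)); exact: filterdiff_pmap.
Qed.

Lemma hol_fst (F : C * C -> C * C) : holomorphic_near (U := C2) (V := C2) F origin ->
  hol2 (fun z w => fst (F (z, w))) /\ hol2 (fun z w => snd (F (z, w))).
Proof.
move=> H; split.
- apply: loc_imp H => p [l Hl]; exists (fun y => fst (l y)).
  apply: (filterdiff_ext (K := C_AbsRing) (U := C2) (V := C_NormedModule) (fun q => fst (F q))); first by case.
  apply: (filterdiff_comp' (K := C_AbsRing) (U := C2) (V := C2) (W := C_NormedModule) F (fun t => fst t) p l (fun t => fst t)) => //.
  exact: (filterdiff_linear (K := C_AbsRing) (U := C2) (V := C_NormedModule) _ is_linear_fst).
- apply: loc_imp H => p [l Hl]; exists (fun y => snd (l y)).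
  apply: (filterdiff_ext (K := C_AbsRing) (U := C2) (V := C_NormedModule) (fun q => snd (F q))); first by case.
  apply: (filterdiff_comp' (K := C_AbsRing) (U := C2) (V := C2) (W := C_NormedModule) F (fun t => snd t) p l (fun t => snd t)) => //.
  exact: (filterdiff_linear (K := C_AbsRing) (U := C2) (V := C_NormedModule) _ is_linear_snd).
Qed.

Lemma hol_1var (al : C -> C) : hol2 (fun z _ => al z) ->
  holomorphic_near (U := C_NormedModule) (V := C_NormedModule) al (RtoC 0).
Proof.
move=> H.
have {H} : near0 (fun x y => ex_filterdiff (U := C2) (V := C_NormedModule)
  (fun p => al (fst p)) (locally (T := C2) (x, y))).
  apply/near0_locally; apply: loc_imp H => -[x y] //.
move=> [d [dp H]].
apply/(locally_C1 (RtoC 0)); exists d; split=> // z hz.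
have {}hz : Cmod z < d by have <- : (z - 0 = z)%C by ring.
case: (H z (RtoC 0) hz) => [|l Hl]; first by rewrite Cmod_0.
exists (fun x => l (x, RtoC 0)).
apply: (filterdiff_comp' (K := C_AbsRing) (U := C_NormedModule) (V := C2) (W := C_NormedModule)
  (fun x => (x, RtoC 0)) (fun p => al (fst p)) z (fun x => (x, RtoC 0)) l) => //.
split.
- split.
  + move=> x y; rewrite /plus /= /prod_plus /=; congr pair; rewrite /plus /=; symmetry; exact: Cplus_0_l.
  + move=> k x; rewrite /scal /= /prod_scal /=; congr pair; rewrite /scal /= /mult /=; symmetry; exact: Cmult_0_r.
  + exists 2; split; first lra. move=> x.
    change (norm (K := C_AbsRing) (V := C2) (x, RtoC 0) <= 2 * Cmod x).
    rewrite norm_C2_l; have := Cmod_ge_0 x; lra.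
- move=> x Hx eps; apply: filter_forall => y.
  have -> : minus (minus ((y, RtoC 0) : C2) (x, RtoC 0)) (minus y x, RtoC 0) = zero.
    rewrite /minus /plus /opp /zero /= /prod_plus /prod_opp /prod_zero /=.
    congr pair; rewrite /plus /opp /zero /=; ring.
  rewrite norm_zero; apply: Rmult_le_pos; [left; exact: cond_pos|exact: norm_ge_0].
Qed.

(** The coordinates [(a, b)] map the normal form [(p, q)] to [F], whereas [locally_conjugate] asks
    for a map in the other direction; hence [Phi] is the inverse [(a', b')]. *)
Lemma conj_intro (F : C * C -> C * C) a b a' b' p q :
  hol2 a -> hol2 b -> hol2 a' -> hol2 b' -> hol2 p -> hol2 q ->
  a 0 0 = RtoC 0 -> b 0 0 = RtoC 0 -> a' 0 0 = RtoC 0 -> b' 0 0 = RtoC 0 -> p 0 0 = RtoC 0 -> q 0 0 = RtoC 0 ->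
  near0 (fun z w => a (a' z w) (b' z w) = z /\ b (a' z w) (b' z w) = w) ->
  near0 (fun z w => a' (a z w) (b z w) = z /\ b' (a z w) (b z w) = w) ->
  near0 (fun z w => F (a z w, b z w) = (a (p z w) (q z w), b (p z w) (q z w))) ->
  locally_conjugate F (pmap p q).
Proof.
move=> Ha Hb Ha' Hb' Hp Hq a0 b0 a0' b0' p0 q0 E1 E2 E3.
exists (pmap a' b'); split.
- split; first exact: hol_pmap.
  exists (pmap a b); split; first exact: hol_pmap.
  split; first by rewrite /pmap /origin /= a0' b0'.
  split; first by rewrite /pmap /origin /= a0 b0.
  split.
  + move/near0_locally: E1; apply: loc_imp => -[z w] /= [e1 e2]; by rewrite /pmap /= e1 e2.
  + move/near0_locally: E2; apply: loc_imp => -[z w] /= [e1 e2]; by rewrite /pmap /= e1 e2.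
- have X3 := near0_comp a' b' _ Ha' Hb' a0' b0' E3.
  have Hp' := hol2_comp p a' b' Hp Ha' Hb' a0' b0'.
  have Hq' := hol2_comp q a' b' Hq Ha' Hb' a0' b0'.
  have p0' : p (a' 0 0) (b' 0 0) = RtoC 0 by rewrite a0' b0'.
  have q0' : q (a' 0 0) (b' 0 0) = RtoC 0 by rewrite a0' b0'.
  have X2 := near0_comp _ _ _ Hp' Hq' p0' q0' E2.
  have := near0_and _ _ E1 (near0_and _ _ X2 X3).
  move/near0_locally; apply: loc_imp => -[z w]; cbv beta; rewrite [fst _]/= [snd _]/=.
  move=> [[e1 e2] [[e3 e4] e5]].
  rewrite e1 e2 in e5; rewrite e5 /pmap /=.
  by rewrite e3 e4.
Qed.

(* The shear [(z, w + v z w)] conjugates [(lambda z, gt)] to [(lambda z, g)]. *)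
Definition shear_conj (lambda : C) (g v gt : C -> C -> C) : Prop :=
  near0 (fun z w => (gt z w + v (lambda * z) (gt z w) = g z (w + v z w))%C).
Definition shear_fixes (v : C -> C -> C) : Prop := near0 (fun _ w => v 0 w = RtoC 0).

Lemma shear_fixes00 v : shear_fixes v -> v 0 0 = RtoC 0.
Proof. exact: (near0_origin (fun _ w => v 0 w = RtoC 0)). Qed.

Ltac hol := repeat first
  [ assumption | apply: hol2_const | apply: hol2_fst | apply: hol2_snd
  | apply: hol2_plus | apply: hol2_mult ].

Lemma near0_at0 (P : C -> C -> Prop) : near0 P -> near0 (fun _ w => P 0 w).
Proof. by move=> [d [dp H]]; exists d; split=> // z w hz hw; apply: H => //; rewrite Cmod_0. Qed.

(** Shears compose to shears: the displacement of the composite is [b z w + v z (w + b z w)]. *)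
Lemma shear_conj_trans lambda g v gt b gt' : hol2 gt -> hol2 b -> hol2 gt' -> hol2 v -> shear_fixes v -> shear_fixes b ->
  gt 0 0 = RtoC 0 -> gt' 0 0 = RtoC 0 ->
  shear_conj lambda g v gt -> shear_conj lambda gt b gt' ->
  exists v', hol2 v' /\ shear_fixes v' /\ shear_conj lambda g v' gt'.
Proof.
move=> Hgt Hb Hgt' Hv v0 b0 gt00 gt00' E1 E2.
have Hwb : hol2 (fun z w => w + b z w)%C by hol.
have wb0 : (0 + b 0 0 = 0)%C by rewrite (shear_fixes00 b b0); ring.
exists (fun z w => b z w + v z (w + b z w))%C; split.
  apply: hol2_plus => //; apply: hol2_comp => //; exact: hol2_fst.
split.
  have := near0_and _ _ b0 (near0_at0 _ (near0_comp (fun z w => z) (fun z w => w + b z w)%C _ hol2_fst Hwb eq_refl wb0 v0)).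
  apply: near0_imp => z w [e1 e2]; rewrite e2 e1; ring.
have X := near0_comp (fun z w => z) (fun z w => w + b z w)%C _ hol2_fst Hwb eq_refl wb0 E1.
apply: near0_imp (near0_and _ _ X E2) => z w [e1 e2].
rewrite -Cplus_assoc in e1 |- *.
have -> : forall x y t : C, (x + (y + t) = (x + y) + t)%C by move=> *; ring.
rewrite e2.
by rewrite e1; congr (g z _); ring.
Qed.

Lemma shear_conj_exists lambda g b : hol2 g -> g 0 0 = RtoC 0 -> hol2 b -> shear_fixes b ->
  exists u gt, hol2 u /\ shear_fixes u /\ hol2 gt /\ gt 0 0 = RtoC 0 /\ shear_conj lambda g b gt /\
    near0 (fun z w => (b z w + u z (w + b z w) = 0)%C) /\
    (forall z w, gt z w = (g z (w + b z w) + u (lambda * z) (g z (w + b z w)))%C).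
Proof.
move=> Hg g0 Hb b0; case: (shear_inverse b Hb b0) => u [Hu [u0 [E1 E2]]].
have wb0 : (0 + b 0 0 = 0)%C by rewrite (shear_fixes00 b b0); ring.
have Hwb : hol2 (fun z w => w + b z w)%C by hol.
have HW : hol2 (fun z w => g z (w + b z w))%C by apply: hol2_comp => //; exact: hol2_fst.
have Hl : hol2 (fun z w => lambda * z)%C by hol.
have l0 : (lambda * 0 = 0)%C by ring.
have W0 : g 0 (0 + b 0 0)%C = RtoC 0 by rewrite wb0.
exists u, (fun z w => g z (w + b z w) + u (lambda * z) (g z (w + b z w)))%C.
split=> //; split=> //; split.
  by apply: hol2_plus => //; apply: hol2_comp.
split; first by rewrite W0 l0 (shear_fixes00 u u0); ring.
split; last by split.
have X := near0_comp _ _ _ Hl HW l0 W0 E1.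
apply: near0_imp X => z w e; rewrite -Cplus_assoc e; ring.
Qed.

Section Main.
Context (lambda : C) (f : C -> C) (g : C -> C -> C).
Context (HB : Brjuno lambda).
Context (Hf : hol2 (fun z _ => f z)) (Hg : hol2 g).
Context (M0 : R) (Hf2 : near0 (fun z _ => Cmod (f z - lambda * z) <= M0 * Cmod z ^ 2)).
Context (g00 : g 0 0 = RtoC 0).

Lemma lambda_ne0 : lambda <> RtoC 0.
Proof. by apply/Cmod_gt_0; case: (brjuno_unit _ HB) => -> _; lra. Qed.
Lemma lambda_ne1 : (lambda - 1)%C <> RtoC 0.
Proof.
case: (brjuno_unit _ HB) => _ /(_ 1%nat (le_n _)) H E; apply: H.
rewrite Cpow_1_r; have -> : (lambda = (lambda - 1) + 1)%C by ring. rewrite E; ring.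
Qed.

(** Inserting [phi = z (1 + y)] into [f (phi z) = phi (lambda z)] and dividing by [lambda z] gives
    [y (lambda z) - y z = z h(z, y z)]. As [f] has no other linear part, [k] is divisible by [z^2]:
    one factor is divided out, the other is the factor [z] that the solver requires. *)
Lemma base_linearization : exists y, hol2 (fun z _ => y z) /\ y 0 = RtoC 0 /\
  near0 (fun z _ => (f (z * (1 + y z)) = lambda * z * (1 + y (lambda * z)))%C).
Proof.
have l0 := lambda_ne0.
have Harg : hol2 (fun z w => z * (1 + w))%C by hol.
have A0 : (0 * (1 + 0) = 0)%C by ring.
pose k z w := (/ lambda * (f (z * (1 + w)) + RtoC (-1) * (lambda * (z * (1 + w)))))%C.
have Hk : hol2 k.
  apply: hol2_mult; first by hol.
  apply: hol2_plus; last by hol.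
  by apply: (hol2_comp (fun z _ => f z) (fun z w => z * (1 + w))%C (fun _ _ => RtoC 0)) => //; hol.
have Bk : near0 (fun z w => Cmod (k z w) <= (Cmod (/ lambda) * (Rabs M0 * 4)) * Cmod z ^ 2).
  have := near0_comp (fun z w => z * (1 + w))%C (fun _ _ => RtoC 0) _ Harg (hol2_const 0) A0 eq_refl Hf2.
  move=> [d [dp H]]; exists (Rmin d 1); split; first by apply: Rmin_pos; lra.
  move=> z w hz hw; have m1 := Rmin_l d 1; have m2 := Rmin_r d 1.
  rewrite /k Cmod_mult Rmult_assoc; apply: Rmult_le_compat_l; first exact: Cmod_ge_0.
  have -> : (f (z * (1 + w)) + -1 * (lambda * (z * (1 + w))) = f (z * (1 + w)) - lambda * (z * (1 + w)))%C by ring.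
  apply: Rle_trans (H z w ltac:(lra) ltac:(lra)) _.
  rewrite Cmod_mult Rpow_mult_distr.
  have h1 : Cmod (1 + w) <= 2 by apply: Rle_trans (Cmod_triangle _ _) _; rewrite Cmod_1; lra.
  have h2 := pow_incr _ _ 2 (conj (Cmod_ge_0 _) h1).
  have h3 : 0 <= Cmod z ^ 2 by apply: pow_le; apply: Cmod_ge_0.
  have h4 : 0 <= Cmod (1 + w) ^ 2 by apply: pow_le; apply: Cmod_ge_0.
  have h5 := Rle_abs M0; have h6 := Rabs_pos M0.
  have h7 := Rmult_le_compat_l _ _ _ (Rmult_le_pos _ _ h6 h3) h2.
  have h8 := Rmult_le_compat_r _ _ _ (Rmult_le_pos _ _ h3 h4) h5.
  lra.
case: (division k 2 _ Hk Bk) => h [Hh Eh].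
case: (brjuno_solve lambda h 0 HB ltac:(lia) Hh) => x [Hx [x0 Ex]].
have Hy : hol2 (fun z _ => x z 0) by apply: (hol2_comp x (fun z _ => z) (fun _ _ => RtoC 0)) => //; hol.
exists (fun z => x z 0); split=> //.
have y0 : x 0 0 = RtoC 0 by exact: (shear_fixes00 x x0).
split=> //.
have E1 := near0_comp (fun z _ => z) (fun _ _ => RtoC 0) _ hol2_fst (hol2_const 0) eq_refl eq_refl Ex.
have E2 := near0_comp (fun z _ => z) (fun z _ => x z 0) _ hol2_fst Hy eq_refl y0 Eh.
apply: near0_imp (near0_and _ _ E1 E2) => z w [].
rewrite Cplus_0_l /k; set T := x z 0; set U := x (lambda * z)%C 0; set H := h z T; set Fz := f _.
move=> e1 e2.
have e3 : (Fz = lambda * z * (1 + T) + lambda * (z ^ 2 * H))%C.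
  rewrite -e2; field; exact: l0.
have e4 : (U = T + z * H)%C.
  have -> : (U = lambda ^ 0 * U - T + T)%C by rewrite /=; ring. rewrite e1; ring.
rewrite e3 e4 /=; ring.
Qed.

Definition fibre (y : C -> C) (z w : C) : C := g (z * (1 + y z)) w.

Lemma conjugacy y v gt : hol2 (fun z _ => y z) -> y 0 = RtoC 0 ->
  near0 (fun z _ => (f (z * (1 + y z)) = lambda * z * (1 + y (lambda * z)))%C) ->
  hol2 v -> shear_fixes v -> hol2 gt -> gt 0 0 = RtoC 0 -> shear_conj lambda (fibre y) v gt ->
  locally_conjugate (skew_product f g) (pmap (fun z _ => lambda * z)%C gt).
Proof.
move=> Hy y0 Ey Hv v0 Hgt gt0 Egt.
case: (radial_inverse y Hy y0) => x [Hx [x0 [Ex1 Ex2]]].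
case: (shear_inverse v Hv v0) => u [Hu [u0 [Eu1 Eu2]]].
have v00 := shear_fixes00 v v0. have u00 := shear_fixes00 u u0.
have Hphi : hol2 (fun z _ => z * (1 + y z))%C by hol.
have Hpsi : hol2 (fun z _ => z * (1 + x z))%C by hol.
have phi0 (t : C) : (0 * t = 0)%C by ring.
have Hl : hol2 (fun z w => lambda * z)%C by hol.
have l0 : (lambda * 0 = 0)%C by ring.
apply: (conj_intro _ (fun z _ => z * (1 + y z))%C (fun z w => w + v z w)%C
   (fun z _ => z * (1 + x z))%C (fun z w => w + u (z * (1 + x z)) w)%C) => //.
- by hol.
- by apply: hol2_plus; [hol|apply: hol2_comp => //; hol].
- by rewrite v00; ring.
- by rewrite phi0 u00; ring.
- have X := near0_comp _ _ _ Hpsi hol2_snd (phi0 _) eq_refl Eu1.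
  apply: near0_imp (near0_and _ _ Ex1 X) => z w [e1 e2]; split=> //.
  rewrite -Cplus_assoc e2; ring.
- apply: near0_imp (near0_and _ _ Ex2 Eu2) => z w [e1 e2].
  have e3 : (z * (1 + y z) * (1 + x (z * (1 + y z))) = z)%C by [].
  split=> //; rewrite e3 -Cplus_assoc e2; ring.
- apply: near0_imp (near0_and _ _ Ey Egt) => z w [e1 e2].
  by rewrite /skew_product [fst _]/= [snd _]/= e1 e2.
Qed.
End Main.

(** * Neutral fibre *)

Section Part1.
Context (lambda : C) (f : C -> C) (g : C -> C -> C).
Context (HB : Brjuno lambda).
Context (Hf : hol2 (fun z _ => f z)) (Hg : hol2 g).
Context (M0 : R) (Hf2 : near0 (fun z _ => Cmod (f z - lambda * z) <= M0 * Cmod z ^ 2)).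
Context (g00 : g 0 0 = RtoC 0).

Lemma fibre_hol2 y : hol2 (fun z _ => y z) -> hol2 (fibre g y).
Proof.
move=> Hy; apply: (hol2_comp g (fun z _ => z * (1 + y z))%C (fun _ w => w)) => //; try by hol.
by ring.
Qed.
Lemma fibre_0 y w : fibre g y 0 w = g 0 w.
Proof. by rewrite /fibre (_ : (0 * (1 + y 0) = 0)%C) //; ring. Qed.

Lemma neutral_fibre_linear c : near0 (fun _ w => g 0 w = w) ->
  locally_conjugate (skew_product f g) (pmap (fun z _ => lambda * z)%C (fun z w => w + c * z)%C).
Proof.
move=> Hid.
case: (base_linearization lambda f HB Hf M0 Hf2) => y [Hy [y0 Ey]].
have HF := fibre_hol2 y Hy.
(* The fibre map is [w + z h(z, w)], so a shear that conjugates the identity to it satisfies [v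
   (lambda z, w) - v (z, w) = z h(z, w + v)]. *)
case: (vanish_div (fun z w => fibre g y z w + RtoC (-1) * w)%C) => [||h [Hh Eh]].
- by hol.
- apply: near0_imp Hid => z w e; rewrite fibre_0 e; ring.
case: (brjuno_solve lambda h 0 HB ltac:(lia) Hh) => v [Hv [v0 Ev]].
have v00 := shear_fixes00 v v0.
have E1 : shear_conj lambda (fibre g y) v (fun z w => w).
  have wv0 : (0 + v 0 0 = 0)%C by rewrite v00; ring.
  have X := near0_comp (fun z w => z) (fun z w => w + v z w)%C _ hol2_fst (hol2_plus _ _ hol2_snd Hv) eq_refl wv0 Eh.
  apply: near0_imp (near0_and _ _ Ev X) => z w [e1 e2].
  have -> : (fibre g y z (w + v z w) = (fibre g y z (w + v z w) + -1 * (w + v z w)) + (w + v z w))%C by ring.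
  rewrite e2 -e1 /=; ring.
have l1 := lambda_ne1 lambda HB.
have l1' : (1 - lambda)%C <> RtoC 0.
  move=> E; apply: l1; have -> : (lambda - 1 = - (1 - lambda))%C by ring. rewrite E; ring.
(* The linear shear by [c / (1 - lambda) * z] diagonalises the differential [(lambda z, w + c z)]:
   both sides of the conjugacy equal [w + c z / (1 - lambda)]. *)
case: (shear_conj_trans lambda (fibre g y) v (fun z w => w) (fun z w => c / (1 - lambda) * z)%C (fun z w => w + c * z)%C) => //; try by hol.
- apply: near0_all => z w; ring.
- by ring.
- apply: near0_all => z w; field; exact: l1'.
move=> v' [Hv' [v0' E']].
by apply: (conjugacy lambda f g y v') => //; [hol|ring].
Qed.

Lemma derive_eps (u : C -> C) (l : C) :
  is_derive (K := C_AbsRing) (V := C_NormedModule) u (RtoC 0) l -> forall eps, 0 < eps ->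
  exists d, 0 < d /\ forall t, Cmod t < d -> Cmod (u t - u 0 - t * l)%C <= eps * Cmod t.
Proof.
move=> [_ Hd] eps he; case: (Hd (RtoC 0) (fun P H => H) (mkposreal _ he)) => d H.
exists d; split; first exact: cond_pos.
have e0 (x : C) : (x - 0 = x)%C by ring.
move=> t ht; have : Cmod (u t - u 0 - (t - 0) * l)%C <= eps * Cmod (t - 0)%C.
  by apply: (H t); change (Cmod (t - 0)%C < d); rewrite e0.
by rewrite e0.
Qed.

Lemma linear_part : is_derive (K := C_AbsRing) (V := C_NormedModule) (g (RtoC 0)) (RtoC 0) (RtoC 1) ->
  exists c, filterdiff (U := C2) (V := C2) (skew_product f g) (locally (T := C2) origin)
    (pmap (fun z _ => lambda * z)%C (fun z w => w + c * z)%C).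
Proof.
move=> /derive_eps Hd.
have f0 : f 0 = RtoC 0.
  have := near0_origin _ Hf2; rewrite Cmod_0 /= Rmult_0_l Rmult_0_r.
  have -> : (f 0 - lambda * 0 = f 0)%C by ring.
  move=> h; apply: Cmod_eq_0; have := Cmod_ge_0 (f 0); lra.
have e0 (x : C) : (x - 0 = x)%C by ring.
case: (proj1 (ex_filterdiff_C2 g 0 0) (locally_singleton _ _ Hg)) => c [B Hc].
have B1 : B = RtoC 1.
  (* The partial derivative [B] in [w] is compared with the derivative of [g 0] along real points
     [t]; the two remainders are at most [eps / 2 * t] each. *)
  have : Cmod (B - 1) <= 0.
    apply: le_epsilon => eps He; rewrite Rplus_0_l.
    have he : 0 < eps / 2 by lra.
    case: (Hc _ he) => d [dp H1].
    case: (Hd _ he) => d' [dp' H2].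
    pose t := Rmin d d' / 2.
    have m : 0 < Rmin d d' by apply: Rmin_pos.
    have m1 := Rmin_l d d'; have m2 := Rmin_r d d'.
    have ct : Cmod (RtoC t) = t by rewrite Cmod_R Rabs_right // /t; lra.
    have := H1 (RtoC 0) (RtoC t); rewrite !e0 ct Cmod_0 => /(_ ltac:(lra) ltac:(rewrite /t; lra)).
    have -> : (g 0 t - g 0 0 - (c * 0 + B * t) = g 0 t - g 0 0 - B * t)%C by ring.
    have := H2 (RtoC t); rewrite ct => /(_ ltac:(rewrite /t; lra)) h2 h1.
    have := Cmod_triangle (g 0 t - g 0 0 - t * 1) (- (g 0 t - g 0 0 - B * t)); rewrite Cmod_opp.
    have -> : (g 0 t - g 0 0 - t * 1 + - (g 0 t - g 0 0 - B * t) = (B - 1) * t)%C by ring.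
    rewrite Cmod_mult ct => h3.
    apply: (Rmult_le_reg_r t); [rewrite /t; lra|lra].
  move=> h; have /Cmod_eq_0 E : Cmod (B - 1) = 0 by have := Cmod_ge_0 (B - 1); lra.
  have -> : (B = B - 1 + 1)%C by ring. rewrite E; ring.
exists c.
have Df : filterdiff (U := C2) (V := C_NormedModule) (fun p => f (fst p)) (locally (T := C2) origin) (fun p : C2 => (lambda * fst p + 0 * snd p)%C).
  apply: (filterdiff_C2 (fun z _ => f z) 0 0 lambda 0) => eps He.
  case: Hf2 => d [dp Hd2].
  have M1 : 0 < Rabs M0 + 1 by have := Rabs_pos M0; lra.
  have ep : 0 < eps / (Rabs M0 + 1) by apply: Rdiv_lt_0_compat.
  exists (Rmin d (eps / (Rabs M0 + 1))); split; first exact: Rmin_pos.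
  move=> x y; rewrite !e0 f0 => hx hy.
  have m1 := Rmin_l d (eps / (Rabs M0 + 1)); have m2 := Rmin_r d (eps / (Rabs M0 + 1)).
  have -> : (f x - 0 - (lambda * x + 0 * y) = f x - lambda * x)%C by ring.
  apply: Rle_trans (Hd2 x 0 ltac:(lra) ltac:(rewrite Cmod_0; lra)) _.
  have x0 := Cmod_ge_0 x; have y0 := Cmod_ge_0 y.
  have h1 : M0 * Cmod x ^ 2 <= (Rabs M0 + 1) * Cmod x * Cmod x.
    rewrite /= Rmult_1_r -Rmult_assoc; apply: Rmult_le_compat_r => //; apply: Rmult_le_compat_r => //.
    have := Rle_abs M0; lra.
  have h2 : (Rabs M0 + 1) * Cmod x <= eps.
    have := Rmult_le_compat_l (Rabs M0 + 1) _ _ ltac:(lra) (Rlt_le _ _ (Rlt_le_trans _ _ _ hx m2)).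
    have -> : (Rabs M0 + 1) * (eps / (Rabs M0 + 1)) = eps by field; lra. by [].
  have := Rmult_le_compat_r _ _ _ x0 h2; have := Rmult_le_pos _ _ (Rlt_le _ _ He) y0; lra.
have Dg : filterdiff (U := C2) (V := C_NormedModule) (fun p => g (fst p) (snd p)) (locally (T := C2) origin) (fun p : C2 => (c * fst p + B * snd p)%C).
  exact: (filterdiff_C2 g 0 0 c B).
apply: (filterdiff_ext_lin (K := C_AbsRing) (U := C2) (V := C2) (F := locally (T := C2) origin) _ _ _
  (filterdiff_pmap (fun z _ => f z) g origin _ _ Df Dg)) => -[z w].
rewrite /pmap /= B1; congr pair; ring.
Qed.
End Part1.

(** * Jets in the fibre variable *)

Lemma jet_0 a m : a 0%nat = RtoC 0 -> jet a m 0 = RtoC 0.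
Proof.
move=> a0; elim: m => [//|m IH] /=; rewrite IH.
case: m {IH} => [|m]; first by rewrite a0; ring.
rewrite Cpow_S; ring.
Qed.
Lemma hol2_pow h n : hol2 h -> hol2 (fun z w => h z w ^ n)%C.
Proof.
move=> H; elim: n => [|n IH]; first exact: hol2_const.
have : hol2 (fun z w => h z w * h z w ^ n)%C by hol.
by apply: hol2_ext; apply: near0_all => z w; rewrite Cpow_S.
Qed.
Lemma hol2_jet a m : hol2 (fun _ w => jet a m w).
Proof.
elim: m => [|m IH] /=; first exact: hol2_const.
apply: hol2_plus => //; apply: hol2_mult; [exact: hol2_const|apply: hol2_pow; exact: hol2_snd].
Qed.
Lemma hol2_slice h : hol2 h -> hol2 (fun z _ => h z 0).
Proof. by move=> H; apply: (hol2_comp h (fun z _ => z) (fun _ _ => RtoC 0)) => //; hol. Qed.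

Lemma near0_small d : 0 < d -> near0 (fun z w => Cmod z < d /\ Cmod w < d).
Proof. by move=> dp; exists d. Qed.

Lemma hol2_lip0 T : hol2 T -> exists c, 0 < c /\ near0 (fun z w => Cmod (T z w - T z 0) <= c * Cmod w).
Proof.
move/hol2_lip => [s [K [sp [Kp H]]]]; exists K; split=> //; exists s; split=> // z w hz hw.
have := H z w z 0 hz hw hz ltac:(rewrite Cmod_0; lra).
have -> : (z - z = 0)%C by ring. have -> : (w - 0 = w)%C by ring. by rewrite Cmod_0 Rplus_0_l.
Qed.
Lemma hol2_bdd T : hol2 T -> near0 (fun z w => Cmod (T z w) <= Cmod (T 0 0) + 1).
Proof.
move/hol2_lip => [s [K [sp [Kp H]]]].
have kp : 0 < / (2 * K) by apply: Rinv_0_lt_compat; lra.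
exists (Rmin s (/ (2 * K))); split; first exact: Rmin_pos.
move=> z w hz hw; have m1 := Rmin_l s (/ (2 * K)); have m2 := Rmin_r s (/ (2 * K)).
have := H z w 0 0 ltac:(lra) ltac:(lra) ltac:(rewrite Cmod_0; lra) ltac:(rewrite Cmod_0; lra).
have e0 (x : C) : (x - 0 = x)%C by ring. rewrite !e0.
have : K * (Cmod z + Cmod w) <= K * (/ K).
  apply: Rmult_le_compat_l; first lra.
  have -> : / K = / (2 * K) + / (2 * K) by field; lra. lra.
rewrite Rinv_r; last lra.
have := Cmod_triangle (T z w - T 0 0) (T 0 0).
have -> : (T z w - T 0 0 + T 0 0 = T z w)%C by ring. lra.
Qed.

(** [division] concerns powers of the first variable, so the variables are swapped before and after
    it. *)
Lemma jet_quotient gt a m c : hol2 gt -> near0 (fun z w => Cmod (gt z w - jet a m w) <= c * Cmod w ^ m) ->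
  exists s, hol2 s /\ near0 (fun z w => gt z w = (jet a m w + w ^ m * s z w)%C).
Proof.
move=> Hgt H.
have X : hol2 (fun z w => gt z w + RtoC (-1) * jet a m w)%C.
  by apply: hol2_plus => //; apply: hol2_mult; [exact: hol2_const|exact: hol2_jet].
case: (division _ m c (hol2_swap _ X)) => [|s [Hs Es]].
  case: H => d [dp H]; exists d; split=> // w z hw hz.
  have -> : (gt z w + -1 * jet a m w = gt z w - jet a m w)%C by ring.
  exact: H.
exists (fun z w => s w z); split; first exact: hol2_swap.
case: Es => d [dp Es]; exists d; split=> // z w hz hw.
rewrite -Es //; ring.
Qed.

Lemma le_small_zero (u : C) K d : 0 < d -> 0 <= K -> (forall t, 0 < t < d -> Cmod u <= K * t) -> u = RtoC 0.
Proof.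
move=> dp Kp H; apply: Cmod_eq_0; apply: Rle_antisym; last exact: Cmod_ge_0.
apply: le_epsilon => eps He; rewrite Rplus_0_l.
have e1 : 0 < eps / (K + 1) by apply: Rdiv_lt_0_compat; lra.
pose t := Rmin (d / 2) (eps / (K + 1)).
have m1 : t <= d / 2 by exact: Rmin_l.
have m2 : t <= eps / (K + 1) by exact: Rmin_r.
have tp : 0 < t by apply: Rmin_pos; lra.
apply: Rle_trans (H t ltac:(lra)) _.
have := Rmult_le_compat_l (K + 1) _ _ ltac:(lra) m2.
have -> : (K + 1) * (eps / (K + 1)) = eps by field; lra. lra.
Qed.

(** The jet is tangent to the identity, so a displacement of its argument passes through it
    unchanged up to second order. This isolates the first-order effect of a shear of degree [m]. *)
Lemma jet_diff a m : a 0%nat = RtoC 0 -> a 1%nat = RtoC 1 ->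
  exists c, 0 <= c /\ forall x y, Cmod x <= 1/2 -> Cmod y <= 1/2 ->
   Cmod (jet a (S (S m)) x - jet a (S (S m)) y - (x - y))%C <= c * ((Cmod x + Cmod y) * Cmod (x - y)).
Proof.
move=> a0 a1; elim: m => [|m [c [cp IH]]].
  exists 0; split; first lra. move=> x y _ _; rewrite /= a0 a1.
  have -> : (0 + 0 * 1 + 1 * (x * 1) - (0 + 0 * 1 + 1 * (y * 1)) - (x - y) = 0)%C by ring.
  rewrite Cmod_0; lra.
set n := S (S m) in IH *.
exists (c + Cmod (a n) * INR n); have an := Cmod_ge_0 (a n); have np := pos_INR n.
split; first by have := Rmult_le_pos _ _ an np; lra.
move=> x y hx hy.
have -> : (jet a (S n) x - jet a (S n) y - (x - y) = (jet a n x - jet a n y - (x - y)) + a n * (x ^ n - y ^ n))%C.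
  rewrite /=; ring.
apply: Rle_trans (Cmod_triangle _ _) _; rewrite Cmod_mult.
have x0 := Cmod_ge_0 x; have y0 := Cmod_ge_0 y.
set s := Cmod x + Cmod y.
have P : Cmod (x ^ n - y ^ n) <= INR n * (s * Cmod (x - y)).
  have s0 : 0 <= s by rewrite /s; lra.
  have s1 : s <= 1 by rewrite /s; lra.
  have Q := pow_diff x y s n ltac:(rewrite /s; lra) ltac:(rewrite /s; lra).
  case: (Req_dec s 0) => [sz|sn].
    have xz : x = RtoC 0 by apply: Cmod_eq_0; rewrite /s in sz; lra.
    have yz : y = RtoC 0 by apply: Cmod_eq_0; rewrite /s in sz; lra.
    rewrite xz yz (_ : (0 ^ n - 0 ^ n = 0)%C); last ring.
    rewrite Cmod_0 sz; lra.
  have sp : 0 < s by lra.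
  apply: (Rmult_le_reg_l s) => //; apply: Rle_trans Q _.
  have d0 := Cmod_ge_0 (x - y).
  have -> : s * (INR n * (s * Cmod (x - y))) = INR n * (s * s) * Cmod (x - y) by ring.
  apply: Rmult_le_compat_r => //; apply: Rmult_le_compat_l => //.
  rewrite /n /=; have := pow_incr s 1 m ltac:(lra); rewrite pow1 => h.
  have := Rmult_le_compat_l _ _ _ (Rmult_le_pos _ _ s0 s0) h; lra.
have := IH x y hx hy; rewrite -/s => h1.
have := Rmult_le_compat_l _ _ _ an P; lra.
Qed.

Lemma jet_factor a m : a 0%nat = RtoC 0 -> a 1%nat = RtoC 1 ->
  exists rho, hol2 (fun _ w => rho w) /\ rho 0 = RtoC 1 /\ forall w, jet a (S (S m)) w = (w * rho w)%C.
Proof.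
move=> a0 a1; elim: m => [|m [rho [H1 [H2 H3]]]].
  exists (fun _ => RtoC 1); split; first exact: hol2_const. split=> // w; rewrite /= a0 a1; ring.
exists (fun w => rho w + a (S (S m)) * w ^ (S m))%C; split.
  by apply: hol2_plus => //; apply: hol2_mult; [exact: hol2_const|apply: hol2_pow; exact: hol2_snd].
split; first by rewrite H2 Cpow_S; ring.
move=> w.
have -> : jet a (S (S (S m))) w = (jet a (S (S m)) w + a (S (S m)) * w ^ (S (S m)))%C by [].
rewrite H3 (Cpow_S w (S m)); ring.
Qed.

(** * Normalisation of jets *)

Section Part2.
Context (lambda : C) (f : C -> C) (g : C -> C -> C).
Context (HB : Brjuno lambda).
Context (Hf : hol2 (fun z _ => f z)) (Hg : hol2 g).
Context (M0 : R) (Hf2 : near0 (fun z _ => Cmod (f z - lambda * z) <= M0 * Cmod z ^ 2)).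
Context (g00 : g 0 0 = RtoC 0).
Context (a : nat -> C) (a0 : a 0%nat = RtoC 0) (a1 : a 1%nat = RtoC 1).
Context (Ha : forall m, exists c, near0 (fun _ w => Cmod (g 0 w - jet a m w) <= c * Cmod w ^ m)).

(** All shears used are the identity over [z = 0], so the fibre map there remains [g 0]. This fixes
    the constant term of the next coefficient, and finally the values [alpha (0)]. *)
Definition jet_normal (gt : C -> C -> C) (m : nat) : Prop :=
  hol2 gt /\ gt 0 0 = RtoC 0 /\ near0 (fun _ w => gt 0 w = g 0 w) /\
  exists c, near0 (fun z w => Cmod (gt z w - jet a m w) <= c * Cmod w ^ m).

(** The hypothesis says that the shear intertwines [gt] and the jet modulo [w^(m+1)]. Applying the
    inverse shear, which is Lipschitz, turns this into closeness of the conjugated map to the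
    jet. *)
Lemma jet_step gt m beta c : jet_normal gt m -> hol2 (fun z _ => beta z) -> beta 0 = RtoC 0 ->
  near0 (fun z w => Cmod (gt z (w + beta z * w ^ m) -
     (jet a (S m) w + beta (lambda * z) * jet a (S m) w ^ m))%C <= c * Cmod w ^ (S m)) ->
  exists gt', jet_normal gt' (S m) /\ shear_conj lambda gt (fun z w => beta z * w ^ m)%C gt'.
Proof.
move=> [Hgt [gt0 [Eg _]]] Hb b0 Hc.
set J := fun w => jet a (S m) w.
have HJ : hol2 (fun _ w => J w) by exact: hol2_jet.
have J0 : J 0 = RtoC 0 by exact: jet_0.
pose b z w := (beta z * w ^ m)%C.
have Hbb : hol2 b by apply: hol2_mult => //; apply: hol2_pow; exact: hol2_snd.
have bz : shear_fixes b by apply: near0_all => z w; rewrite /b b0; ring.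
case: (shear_conj_exists lambda gt b Hgt gt0 Hbb bz) => u [gt' [Hu [u0 [Hgt' [gt'0 [Econj [Ebu Egt']]]]]]].
exists gt'; split; last exact: Econj.
have b00 := shear_fixes00 b bz. have u00 := shear_fixes00 u u0.
have Hl : hol2 (fun z w => lambda * z)%C by hol.
have l0 : (lambda * 0 = 0)%C by ring.
have Hwb : hol2 (fun z w => w + b z w)%C by hol.
have wb0 : (0 + b 0 0 = 0)%C by rewrite b00; ring.
have HW : hol2 (fun z w => gt z (w + b z w))%C by apply: hol2_comp => //; exact: hol2_fst.
have W0 : gt 0 (0 + b 0 0)%C = RtoC 0 by rewrite wb0.
have HQ : hol2 (fun z w => J w + b (lambda * z) (J w))%C by apply: hol2_plus => //; apply: hol2_comp.
have Q0 : (J 0 + b (lambda * 0)%C (J 0) = 0)%C by rewrite J0 l0 b00; ring.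
split=> //; split=> //; split.
  have X := near0_comp (fun _ w => RtoC 0) gt _ (hol2_const 0) Hgt eq_refl gt0 u0.
  apply: near0_imp (near0_and _ _ Eg (near0_at0 _ X)) => z w [e1 e2].
  have Eb : b (RtoC 0) w = RtoC 0 by rewrite /b b0; ring.
  by rewrite Egt' l0 Eb Cplus_0_r e2 e1 Cplus_0_r.
case: (hol2_lip u Hu) => s [K [sp [Kp HL]]].
exists ((1 + K) * c).
have S1 := near0_comp _ _ _ Hl HW l0 W0 (near0_small s sp).
have S2 := near0_comp _ _ _ Hl HQ l0 Q0 (near0_small s sp).
have X := near0_comp _ _ _ Hl HJ l0 J0 Ebu.
apply: near0_imp (near0_and _ _ Hc (near0_and _ _ X (near0_and _ _ S1 S2))) => z w.
rewrite -/(J w) Egt' -/(b z w).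
set W := gt z (w + b z w)%C; set Q := (J w + b (lambda * z) (J w))%C.
move=> [h1 [h2 [[s1 s2] [s3 s4]]]].
have {}h1 : Cmod (W - Q) <= c * Cmod w ^ S m by exact: h1.
have EJ : J w = (Q + u (lambda * z) Q)%C.
  rewrite {2}/Q; have -> : (J w + b (lambda * z) (J w) + u (lambda * z) Q = J w + (b (lambda * z) (J w) + u (lambda * z) Q))%C by ring.
  rewrite h2; ring.
have -> : (W + u (lambda * z) W - jet a (S m) w = (W - Q) + (u (lambda * z) W - u (lambda * z) Q))%C.
  rewrite -/(J w) EJ; ring.
apply: Rle_trans (Cmod_triangle _ _) _.
have := HL _ _ _ _ s1 s2 s3 s4.
have -> : (lambda * z - lambda * z = 0)%C by ring.
rewrite Cmod_0 Rplus_0_l => h3.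
have := Rmult_le_compat_l _ _ _ (Rlt_le _ _ Kp) h1; lra.
Qed.

Lemma slice_solution (h : C -> C -> C) (s : nat) : (s <= 1)%nat -> hol2 h ->
  exists x, hol2 (fun z _ => x z) /\ x 0 = RtoC 0 /\
   near0 (fun z _ => (lambda ^ s * x (lambda * z)%C - x z = z * h z (x z))%C).
Proof.
move=> Hs Hh; case: (brjuno_solve lambda h s HB Hs Hh) => x [Hx [x0 Ex]].
exists (fun z => x z 0); split; first exact: hol2_slice.
split; first exact: (shear_fixes00 x x0).
have := near0_comp (fun z _ => z) (fun _ _ => RtoC 0) _ hol2_fst (hol2_const 0) eq_refl eq_refl Ex.
apply: near0_imp => z w; by rewrite Cplus_0_l.
Qed.

(* An invariant curve [w = beta z]: the ansatz [beta z = z (e + x z)] removes the resonant first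
   coefficient, leaving an equation divisible by [z]. *)
Lemma step_curve gt : jet_normal gt 0 -> exists beta c, hol2 (fun z _ => beta z) /\ beta 0 = RtoC 0 /\
  near0 (fun z w => Cmod (gt z (w + beta z * w ^ 0) -
     (jet a 1 w + beta (lambda * z) * jet a 1 w ^ 0))%C <= c * Cmod w ^ 1).
Proof.
move=> [Hgt [gt0 [Eg _]]].
case: (analytic_quad gt (hol2_analytic gt Hgt)) => s [K [sp [Kp HQ]]].
case: (HQ 0 0 ltac:(rewrite Cmod_0; lra) ltac:(rewrite Cmod_0; lra)) => A [B [_ [_ HAB]]].
have e0 (x : C) : (x - 0 = x)%C by ring.
(* The fibre over 0 is [g 0], whose jet of order 2 is [w]. *)
have B1 : B = RtoC 1.
  case: (Ha 2) => c [d [dp Hd]]; case: Eg => d2 [dp2 Eg].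
  have : (B - 1 = 0)%C.
    pose d' := Rmin s (Rmin d d2).
    have m1 : d' <= s by exact: Rmin_l.
    have m2 : d' <= d by apply: Rle_trans (Rmin_r _ _) (Rmin_l _ _).
    have m3 : d' <= d2 by apply: Rle_trans (Rmin_r _ _) (Rmin_r _ _).
    apply: (le_small_zero _ (K + Rabs c) d'); first by apply: Rmin_pos => //; apply: Rmin_pos.
      by have := Rabs_pos c; lra.
    move=> t [tp td].
    have ct : Cmod (RtoC t) = t by rewrite Cmod_R Rabs_right; lra.
    have := HAB 0 (RtoC t) ltac:(rewrite Cmod_0; lra) ltac:(lra).
    rewrite !e0 ct Cmod_0 gt0 Rplus_0_l (Eg 0 (RtoC t)) ?ct; [|rewrite Cmod_0; lra|lra].
    have := Hd 0 (RtoC t) ltac:(rewrite Cmod_0; lra) ltac:(lra); rewrite ct.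
    have -> : jet a 2 t = RtoC t by rewrite /= a0 a1; ring.
    move=> h1 h2.
    apply: (Rmult_le_reg_r t) => //.
    have -> : Cmod (B - 1) * t = Cmod ((B - 1) * t)%C by rewrite Cmod_mult ct.
    have -> : ((B - 1) * t = (g 0 t - t) + - (g 0 t - 0 - (A * 0 + B * t)))%C by ring.
    apply: Rle_trans (Cmod_triangle _ _) _; rewrite Cmod_opp.
    have h3 := Rmult_le_compat_r (t ^ 2) _ _ ltac:(apply: pow_le; lra) (Rle_abs c).
    rewrite /= in h1 h3; lra.
  move=> h; have -> : (B = B - 1 + 1)%C by ring. rewrite h; ring.
have l1 := lambda_ne1 lambda HB.
(* The linear coefficient of the curve must satisfy [lambda e = e + A]. It is fixed by hand because
   the solver only produces germs that vanish at [z = 0]. *)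
pose e := (A / (lambda - 1))%C.
have Ee : (lambda * e = e + A)%C by rewrite /e; field; exact: l1.
pose arg z w := (z * (e + w))%C.
have Harg : hol2 arg by rewrite /arg; hol.
have arg0 : arg 0 0 = RtoC 0 by rewrite /arg; ring.
pose k z w := (gt z (arg z w) + RtoC (-1) * (arg z w + A * z))%C.
have Hk : hol2 k.
  apply: hol2_plus; first by apply: hol2_comp => //; exact: hol2_fst.
  by apply: hol2_mult; [exact: hol2_const|apply: hol2_plus => //; hol].
have Bk : near0 (fun z w => Cmod (k z w) <= (K * ((Cmod e + 2) * (Cmod e + 2))) * Cmod z ^ 2).
  have S1 := near0_comp (fun z _ => z) arg _ hol2_fst Harg eq_refl arg0 (near0_small s sp).
  apply: near0_imp (near0_and _ _ S1 (near0_small 1 ltac:(lra))) => z w [[h1 h2] [_ h3]].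
  have := HAB z (arg z w) ltac:(lra) ltac:(lra); rewrite !e0 gt0 B1 e0.
  have -> : k z w = (gt z (arg z w) - (A * z + 1 * arg z w))%C by rewrite /k; ring.
  move=> h; apply: Rle_trans h _; rewrite Rmult_assoc; apply: Rmult_le_compat_l; first lra.
  have z0 := Cmod_ge_0 z.
  have h4 : Cmod z + Cmod (arg z w) <= (Cmod e + 2) * Cmod z.
    rewrite /arg Cmod_mult; have := Cmod_triangle e w => h5.
    have : Cmod z * Cmod (e + w) <= Cmod z * (Cmod e + 1) by apply: Rmult_le_compat_l; lra.
    lra.
  have h6 : 0 <= Cmod z + Cmod (arg z w) by have := Cmod_ge_0 (arg z w); lra.
  have := Rmult_le_compat _ _ _ _ h6 h6 h4 h4; rewrite /=; lra.
case: (division k 2 _ Hk Bk) => h [Hh Eh].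
case: (slice_solution h 1 (le_n _) Hh) => x [Hx [x0 Ex]].
have Hbeta : hol2 (fun z _ => z * (e + x z))%C by hol.
have b0 : (0 * (e + x 0) = 0)%C by ring.
have Inv : near0 (fun z _ => gt z (z * (e + x z))%C = (lambda * z * (e + x (lambda * z)%C))%C).
  have X := near0_comp (fun z _ => z) (fun z _ => x z) _ hol2_fst Hx eq_refl x0 Eh.
  apply: near0_imp (near0_and _ _ Ex X) => z w [e1 e2].
  have -> : (gt z (z * (e + x z))%C = k z (x z) + (z * (e + x z) + A * z))%C by rewrite /k /arg; ring.
  rewrite e2.
  have -> : (lambda * z * (e + x (lambda * z)) = z * (lambda * e) + z * (lambda ^ 1 * x (lambda * z) - x z) + z * x z)%C.
    rewrite /=; ring.
  rewrite e1 Ee /=; ring.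
case: (hol2_lip0 (fun z w => gt z (w + z * (e + x z))%C)) => [|c [cp Hc]].
  apply: hol2_comp => //; try by hol.
  by rewrite b0; ring.
exists (fun z => z * (e + x z))%C, c; split=> //; split=> //.
apply: near0_imp (near0_and _ _ Hc Inv) => z w [h1 h2].
have -> : (w + z * (e + x z) * w ^ 0 = w + z * (e + x z))%C by rewrite /=; ring.
have -> : (jet a 1 w + lambda * z * (e + x (lambda * z)) * jet a 1 w ^ 0 = gt z (0 + z * (e + x z))%C)%C.
  rewrite Cplus_0_l h2 /= a0; ring.
by rewrite pow_1.
Qed.

Lemma quotient_at0 gt m s : jet_normal gt m -> hol2 s ->
  near0 (fun z w => gt z w = (jet a m w + w ^ m * s z w)%C) -> s 0 0 = a m.
Proof.
move=> [Hgt [gt0 [Eg _]]] Hs [d1 [dp1 Es]].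
case: Eg => d2 [dp2 Eg]; case: (Ha (S m)) => c [d3 [dp3 Hc]].
case: (hol2_lip0 s Hs) => c2 [cp2 [d4 [dp4 H4]]].
have : (s 0 0 - a m = 0)%C; last first.
  by move=> E; transitivity (s 0 0 - a m + a m)%C; [ring|rewrite E; ring].
pose d := Rmin (Rmin d1 d2) (Rmin d3 d4).
have m1 : d <= d1 by apply: Rle_trans (Rmin_l _ _) (Rmin_l _ _).
have m2 : d <= d2 by apply: Rle_trans (Rmin_l _ _) (Rmin_r _ _).
have m3 : d <= d3 by apply: Rle_trans (Rmin_r _ _) (Rmin_l _ _).
have m4 : d <= d4 by apply: Rle_trans (Rmin_r _ _) (Rmin_r _ _).
apply: (le_small_zero _ (Rabs c + c2) d).
- by apply: Rmin_pos; apply: Rmin_pos.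
- by have := Rabs_pos c; lra.
move=> t [tp td].
have ct : Cmod (RtoC t) = t by rewrite Cmod_R Rabs_right; lra.
have z0 : Cmod 0 < d by rewrite Cmod_0; lra.
have h1 := Es 0 (RtoC t) ltac:(lra) ltac:(lra).
have h2 := Eg 0 (RtoC t) ltac:(lra) ltac:(lra).
have h3 := Hc 0 (RtoC t) ltac:(lra) ltac:(lra).
have h4 := H4 0 (RtoC t) ltac:(lra) ltac:(lra).
rewrite ct in h3 h4.
have tm : 0 < t ^ m by apply: pow_lt.
have h5 : Cmod (s 0 t - a m) * t ^ m <= Rabs c * t * t ^ m.
  have -> : Cmod (s 0 t - a m) * t ^ m = Cmod (g 0 t - jet a (S m) t)%C.
    rewrite -h2 h1 [jet a (S m) t]/=.
    have -> : (jet a m t + t ^ m * s 0 t - (jet a m t + a m * t ^ m) = (s 0 t - a m) * t ^ m)%C by ring.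
    by rewrite Cmod_mult Cmod_pow ct.
  apply: Rle_trans h3 _; rewrite Rmult_assoc; apply: Rmult_le_compat_r (Rle_abs c).
  by apply: pow_le; lra.
have h6 := Rmult_le_reg_r _ _ _ tm h5.
have := Cmod_triangle (s 0 t - a m) (- (s 0 t - s 0 0)); rewrite Cmod_opp.
have -> : (s 0 t - a m + - (s 0 t - s 0 0) = s 0 0 - a m)%C by ring.
lra.
Qed.

(** Writing [gt = w s(z, w)], the coefficient of [w] asks for
    [1 + x (lambda z) = (1 + x z) s(z, 0)]. Since [s(z, 0) = 1 + z h0], this multiplicative equation
    is [x (lambda z) - x z = z h0 (1 + x z)]; the solver accepts the unknown on the right. *)
Lemma step_linear gt : jet_normal gt 1 -> exists beta c, hol2 (fun z _ => beta z) /\ beta 0 = RtoC 0 /\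
  near0 (fun z w => Cmod (gt z (w + beta z * w ^ 1) -
     (jet a 2 w + beta (lambda * z) * jet a 2 w ^ 1))%C <= c * Cmod w ^ 2).
Proof.
move=> G; case: (G) => [Hgt [gt0 [Eg [c0 Hc0]]]].
case: (jet_quotient gt a 1 c0 Hgt Hc0) => s [Hs Es].
have s0 := quotient_at0 gt 1 s G Hs Es. rewrite a1 in s0.
case: (vanish_div (fun z _ => s z 0 + RtoC (-1))%C) => [||h0 [Hh0 Eh0]].
- by apply: hol2_plus; [exact: hol2_slice|hol].
- by apply: near0_all => z w; rewrite s0; ring.
case: (slice_solution (fun z w => h0 z 0 * (1 + w))%C 0) => [||x [Hx [x0 Ex]]]; first lia.
  by apply: hol2_mult; [exact: hol2_slice|hol].
pose q z w := (w * (1 + x z))%C.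
have Hq : hol2 q by rewrite /q; hol.
have q0 : q 0 0 = RtoC 0 by rewrite /q; ring.
pose T z w := ((1 + x z) * s z (q z w))%C.
have HT : hol2 T.
  apply: hol2_mult; first by hol.
  by apply: hol2_comp => //; exact: hol2_fst.
case: (hol2_lip0 T HT) => c [cp Hc].
exists x, c; split=> //; split=> //.
have X := near0_comp (fun z _ => z) q _ hol2_fst Hq eq_refl q0 Es.
have Y := near0_comp (fun z _ => z) (fun _ _ => RtoC 0) _ hol2_fst (hol2_const 0) eq_refl eq_refl Eh0.
apply: near0_imp (near0_and _ _ Hc (near0_and _ _ X (near0_and _ _ Ex Y))) => z w [h1 [h2 [h3 h4]]].
have -> : (w + x z * w ^ 1 = q z w)%C by rewrite /q /=; ring.
have j1 u : jet a 1 u = RtoC 0 by rewrite /= a0; ring.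
have j2 u : jet a 2 u = u by rewrite /= a0 a1; ring.
rewrite h2 j1 j2.
have -> : (x (lambda * z) = (1 + x z) * s z 0 - 1)%C.
  have -> : (x (lambda * z)%C = (lambda ^ 0 * x (lambda * z)%C - x z) + x z)%C by rewrite /=; ring.
  rewrite h3; have -> : forall u : C, (z * (h0 z 0 * u) = (z * h0 z 0) * u)%C by move=> *; ring.
  rewrite -h4; ring.
have -> : (0 + q z w ^ 1 * s z (q z w) - (w + ((1 + x z) * s z 0 - 1) * w ^ 1) = w * (T z w - T z 0))%C.
  have qz0 : q z 0 = RtoC 0 by rewrite /q; ring.
  rewrite /T qz0; set S := s z (q z w); rewrite /q /=; ring.
rewrite Cmod_mult /= Rmult_1_r.
have := Rmult_le_compat_l _ _ _ (Cmod_ge_0 w) h1; lra.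
Qed.

(** For [m >= 2] the factor [r] is 1 at [w = 0], so the coefficient of [w^m] gives the additive
    equation [x (lambda z) - x z = s(z, 0) - a m]. Everything else is of order [m + 1]. *)
Lemma step_higher gt m' (m := S (S m')) : jet_normal gt m -> exists beta c, hol2 (fun z _ => beta z) /\ beta 0 = RtoC 0 /\
  near0 (fun z w => Cmod (gt z (w + beta z * w ^ m) -
     (jet a (S m) w + beta (lambda * z) * jet a (S m) w ^ m))%C <= c * Cmod w ^ (S m)).
Proof.
move=> G; case: (G) => [Hgt [gt0 [Eg [c0 Hc0]]]].
case: (jet_quotient gt a m c0 Hgt Hc0) => s [Hs Es].
have s0 := quotient_at0 gt m s G Hs Es.
case: (vanish_div (fun z _ => s z 0 + RtoC (-1) * a m)%C) => [||h0 [Hh0 Eh0]].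
- by apply: hol2_plus; [exact: hol2_slice|hol].
- by apply: near0_all => z w; rewrite s0; ring.
case: (slice_solution (fun z w => h0 z 0) 0) => [||x [Hx [x0 Ex]]]; first lia.
  exact: hol2_slice.
pose r z w := (1 + x z * w ^ (S m'))%C.
have Hr : hol2 r.
  by apply: hol2_plus; [hol|apply: hol2_mult => //; apply: hol2_pow; exact: hol2_snd].
have r0 z : r z 0 = RtoC 1 by rewrite /r Cpow_S; ring.
pose q z w := (w * r z w)%C.
have Hq : hol2 q by rewrite /q; hol.
have q00 : q 0 0 = RtoC 0 by rewrite /q; ring.
pose T z w := (r z w ^ m * s z (q z w))%C.
have HT : hol2 T.
  apply: hol2_mult; first exact: hol2_pow.
  by apply: hol2_comp => //; exact: hol2_fst.
case: (hol2_lip0 T HT) => c2 [cp2 Hc2].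
case: (jet_factor a (S m') a0 a1) => rho [Hrho [rho0 Erho]].
have Hxl : hol2 (fun z _ => x (lambda * z)%C).
  apply: (hol2_comp (fun z _ => x z) (fun z _ => lambda * z)%C (fun _ _ => RtoC 0)) => //; try by hol.
  by ring.
pose V z w := (x (lambda * z) * rho w ^ m)%C.
have HV : hol2 V by apply: hol2_mult => //; exact: hol2_pow.
case: (hol2_lip0 V HV) => c3 [cp3 Hc3].
case: (jet_diff a m' a0 a1) => c1 [cp1 Hc1].
exists x, (c1 * 3 + c2 + c3); split=> //; split=> //.
have Bx := hol2_bdd _ Hx. cbv beta in Bx; rewrite x0 Cmod_0 Rplus_0_l in Bx.
have Br : near0 (fun z w => Cmod (r z w) <= 2).
  by have := hol2_bdd r Hr; rewrite r0 Cmod_1.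
have X := near0_comp (fun z _ => z) q _ hol2_fst Hq eq_refl q00 Es.
have Sq := near0_comp (fun z _ => z) q _ hol2_fst Hq eq_refl q00 (near0_small (1/2) ltac:(lra)).
have Y := near0_comp (fun z _ => z) (fun _ _ => RtoC 0) _ hol2_fst (hol2_const 0) eq_refl eq_refl Eh0.
have N1 := near0_and _ _ (near0_and _ _ Hc2 Hc3) (near0_and _ _ Bx Br).
have N2 := near0_and _ _ (near0_and _ _ X Sq) (near0_and _ _ Ex Y).
apply: near0_imp (near0_and _ _ (near0_small (1/2) ltac:(lra)) (near0_and _ _ N1 N2)) => z w.
move=> [[_ hw] [[[h2 h3] [hx hr]] [[h4 [_ hq]] [h5 h6]]]].
have Eq : (w + x z * w ^ m = q z w)%C by rewrite /q /r /m !Cpow_S; ring.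
rewrite Eq h4.
have Ex2 : (x (lambda * z) = x z + s z 0 - a m)%C.
  have -> : (x (lambda * z)%C = (lambda ^ 0 * x (lambda * z)%C - x z) + x z)%C by rewrite /=; ring.
  rewrite h5 -h6; ring.
have ES : jet a (S m) w = (jet a m w + a m * w ^ m)%C by [].
(* The terms of degree [m] cancel by the equation for [x]. What remains is the nonlinear effect of
   the jet, handled by [jet_diff], and [w^m] times increments of [T] and [V] in [w], each [O(w)]. *)
have -> : (jet a m (q z w) + q z w ^ m * s z (q z w) - (jet a (S m) w + x (lambda * z) * jet a (S m) w ^ m) =
  (jet a m (q z w) - jet a m w - (q z w - w)) + (w ^ m * (T z w - T z 0) - w ^ m * (V z w - V z 0)))%C.
  rewrite {1}ES [jet a (S m) w]Erho /T /V r0 rho0 /q r0.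
  rewrite (_ : (0 * 1 = 0)%C); last ring.
  rewrite !Cpow_mult_l !Cpow_1_l.
  have Eqw : (w * r z w - w = x z * w ^ m)%C by rewrite -/(q z w) -Eq; ring.
  rewrite Eqw Ex2; ring.
have Hj := Hc1 (q z w) w ltac:(lra) ltac:(lra).
have w0 := Cmod_ge_0 w.
have wm : 0 <= Cmod w ^ m by apply: pow_le.
have Hq3 : Cmod (q z w) + Cmod w <= 3 * Cmod w.
  rewrite /q Cmod_mult; have := Rmult_le_compat_l _ _ _ w0 hr; lra.
have Hqw : Cmod (q z w - w) <= Cmod w ^ m.
  rewrite -Eq (_ : (w + x z * w ^ m - w = x z * w ^ m)%C); last ring.
  rewrite Cmod_mult Cmod_pow; have := Rmult_le_compat_r _ _ _ wm hx; lra.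
have P0 : 0 <= Cmod (q z w) + Cmod w by have := Cmod_ge_0 (q z w); lra.
have Hj2 := Rmult_le_compat_l _ _ _ cp1 (Rmult_le_compat _ _ _ _ P0 (Cmod_ge_0 (q z w - w)) Hq3 Hqw).
apply: Rle_trans (Cmod_triangle _ _) _.
have Tr : Cmod (w ^ m * (T z w - T z 0) - w ^ m * (V z w - V z 0)) <=
    Cmod w ^ m * Cmod (T z w - T z 0) + Cmod w ^ m * Cmod (V z w - V z 0).
  by apply: Rle_trans (Cmod_triangle _ _) _; rewrite Cmod_opp !Cmod_mult Cmod_pow; exact: Rle_refl.
have h2' := Rmult_le_compat_l _ _ _ wm h2.
have h3' := Rmult_le_compat_l _ _ _ wm h3.
rewrite -/m in Hj.
have -> : Cmod w ^ S m = Cmod w * Cmod w ^ m by [].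
lra.
Qed.

Lemma jet_normal_form y m : hol2 (fun z _ => y z) -> exists v gt, hol2 v /\ shear_fixes v /\ jet_normal gt m /\
  shear_conj lambda (fibre g y) v gt.
Proof.
move=> Hy; elim: m => [|m [v [gt [Hv [v0 [G E]]]]]].
  have HF := fibre_hol2 g Hg y Hy.
  exists (fun _ _ => RtoC 0), (fibre g y); split; first exact: hol2_const.
  split; first exact: near0_all.
  split; last by apply: near0_all => z w; rewrite !Cplus_0_r.
  split=> //; split; first by rewrite fibre_0.
  split; first by apply: near0_all => z w; rewrite fibre_0.
  (* The jet of order 0 is zero, so the induction starts from boundedness alone. *)
  exists (Cmod (fibre g y 0 0) + 1); apply: near0_imp (hol2_bdd _ HF) => z w h /=.
  by rewrite Rmult_1_r (_ : (fibre g y z w - 0 = fibre g y z w)%C) //; ring.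
have [beta [c [Hb [b0 Hc]]]] : exists beta c, hol2 (fun z _ => beta z) /\ beta 0 = RtoC 0 /\
  near0 (fun z w => Cmod (gt z (w + beta z * w ^ m) -
     (jet a (S m) w + beta (lambda * z) * jet a (S m) w ^ m))%C <= c * Cmod w ^ (S m)).
  case: m G E => [|[|m]] G E; [exact: step_curve|exact: step_linear|exact: step_higher].
case: (jet_step gt m beta c G Hb b0 Hc) => gt' [G' E'].
have Hbb : hol2 (fun z w => beta z * w ^ m)%C by apply: hol2_mult => //; apply: hol2_pow; exact: hol2_snd.
case: (shear_conj_trans lambda (fibre g y) v gt (fun z w => beta z * w ^ m)%C gt') => //.
- by case: G.
- by case: G'.
- by apply: near0_all => z w; rewrite b0; ring.
- by case: G => _ [].
- by case: G' => _ [].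
- by move=> v' [Hv' [v0' E'']]; exists v', gt'.
Qed.
End Part2.

(** * Power series of the fibre maps and conclusion *)

Lemma pow_n_Cpow (w : C) k : pow_n (K := C_Ring) w k = (w ^ k)%C.
Proof. elim: k => [//|k IH]; rewrite Cpow_S -IH; by []. Qed.

Lemma power_series_near u a : power_series_at_0 u a ->
  exists d, 0 < d /\ forall w, Cmod w < d -> serC (fun n => a n * w ^ n)%C (u w).
Proof.
move/(locally_C1 (RtoC 0)) => [d [dp H]]; exists d; split=> // w hw.
have := H w ltac:(by have -> : (w - 0 = w)%C by ring).
apply: serC_ext => n; rewrite pow_n_Cpow; change ((w ^ n * a n)%C = (a n * w ^ n)%C); ring.
Qed.

Lemma series_coef_bound a u d : 0 < d ->
  (forall w, Cmod w < d -> serC (fun n => a n * w ^ n)%C (u w)) ->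
  exists M R1, 0 <= M /\ 0 < R1 /\ forall n, Cmod (a n) <= M * R1 ^ n.
Proof.
move=> dp H.
pose t := d / 2. have tp : 0 < t by rewrite /t; lra.
have ct : Cmod (RtoC t) = t by rewrite Cmod_R Rabs_right; lra.
have := H (RtoC t) ltac:(rewrite ct /t; lra).
move/serC_eps => /(_ 1 ltac:(lra)) [N HN].
pose b n := Cmod (a n * t ^ n)%C.
have b0 n : 0 <= b n by apply: Cmod_ge_0.
(* Beyond [N] a term is the difference of two partial sums, each within 1 of the limit, hence of
   modulus less than 2. *)
pose M := sum_n b N + 2.
have Mp : 0 <= sum_n b N by apply: rsum_ge0.
have bM n : b n <= M.
  case: (Nat.le_gt_cases n N) => hn.
    have := rsum_mono b n N hn b0; rewrite /M.
    have : b n <= sum_n b n; last lra.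
    case: n {hn} => [|n]; first by rewrite sum_O; apply: Rle_refl.
    rewrite rsum_S; have := rsum_ge0 b n (fun k _ => b0 k); lra.
  case: n hn => [|n] hn; first lia.
  have h1 := HN n ltac:(lia); have h2 := HN (S n) ltac:(lia).
  have : b (S n) = Cmod ((sum_n (fun n => a n * t ^ n) (S n) - u t) + - (sum_n (fun n => a n * t ^ n) n - u t))%C.
    rewrite csum_S /b; congr Cmod; ring.
  have := Cmod_triangle (sum_n (fun n => a n * t ^ n)%C (S n) - u t) (- (sum_n (fun n => a n * t ^ n)%C n - u t)).
  rewrite Cmod_opp /M; lra.
exists M, (/ t); split; first by rewrite /M; lra.
split; first exact: Rinv_0_lt_compat.
move=> n; rewrite pow_inv; have tn := pow_lt t n tp.
apply/(Rle_div_r _ _ _ tn); have := bM n; by rewrite /b Cmod_mult Cmod_pow ct.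
Qed.

(** The sequence is placed in column 0 of a double array, which reduces the claim to [ds_shiftn]. *)
Lemma serC_shiftn m (a : nat -> C) (S : C) : serC a S ->
  serC (fun n => if Nat.ltb n m then RtoC 0 else a (n - m)%nat) S.
Proof.
move=> H.
have X : is_dseries (fun n l => if Nat.eqb l 0 then a n else RtoC 0) S.
  exists a; split=> // n.
  have := serC_fin (fun l => if Nat.eqb l 0 then a n else RtoC 0) 0.
  by rewrite sum_O /=; apply; case=> //; lia.
case: (ds_shiftn m _ _ X) => al [H1 H2].
apply: serC_ext H2 => n; apply: (serC_unique _ _ _ (H1 n)).
have := serC_fin (fun l => if Nat.ltb n m then RtoC 0 else if Nat.eqb l 0 then a (n - m)%nat else RtoC 0) 0.
rewrite sum_O /=; apply; case=> [|l] hl; first lia. by case: (Nat.ltb n m).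
Qed.

(** After the swap [w] is the outer index, so the row sums are the coefficient functions [B n z].
    Each is holomorphic as the value at 0 of an array supported in a single row. *)
Lemma fibre_expansion s : hol2 s -> exists (B : nat -> C -> C) M R1 d, 0 <= M /\ 0 < R1 /\ 0 < d /\
  (forall n, hol2 (fun z _ => B n z)) /\ (forall n, Cmod (B n 0) <= M * R1 ^ n) /\
  (forall z w, Cmod z < d -> Cmod w < d -> serC (fun n => B n z * w ^ n)%C (s z w)).
Proof.
move=> /hol2_swap/hol2_analytic [c [M [R1 [HM [HR [Hc Hs]]]]]].
have iR : 0 < / (2 * R1) by apply: Rinv_0_lt_compat; lra.
have sm x : Cmod x < / (2 * R1) -> Cmod x * R1 <= 1/2.
  move=> hx; have := Rmult_le_compat_r R1 _ _ ltac:(lra) (Rlt_le _ _ hx).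
  have -> : / (2 * R1) * R1 = 1/2 by field; lra. by [].
have row n : exists b : C -> C, hol2 (fun z _ => b z) /\
    forall z, Cmod z < / (2 * R1) -> serC (fun l => c n l * z ^ l)%C (b z).
  have Mn : 0 <= M * R1 ^ n by apply: Rmult_le_pos => //; apply: pow_le; lra.
  pose e i j := if Nat.eqb i 0 then c n j else RtoC 0.
  case: (array_analytic e (M * R1 ^ n) R1 Mn HR) => [i j|h Hh].
    rewrite /e; case: (Nat.eqb_spec i 0) => [->|_].
      rewrite Nat.add_0_l Rmult_assoc -pow_add; exact: Hc.
    rewrite Cmod_0; apply: Rmult_le_pos => //; apply: pow_le; lra.
  exists (fun z => h 0 z); split.
    apply: (hol2_comp h (fun _ _ => RtoC 0) (fun z _ => z)) => //; try by hol.
    by apply: analytic_hol2; eexists; eexists; eexists; exact: Hh.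
  move=> z hz; case: Hh => _ [_ [_ Hh]].
  case: (Hh 0 z ltac:(rewrite Cmod_0; lra) (sm z hz)) => al [H1 H2].
  have -> : h 0 z = al 0%nat.
    apply: (serC_unique _ _ _ H2); rewrite -(sum_O al).
    apply: serC_fin => k kp; apply: (serC_unique _ _ _ (H1 k)).
    apply: serC_ext serC_zero => l; rewrite /monomials /e; case: k kp => [|k] kp /=; [lia|ring].
  apply: serC_ext (H1 0%nat) => l; rewrite /monomials /e /=; ring.
pose B n := proj1_sig (constructive_indefinite_description _ (row n)).
have HB n : hol2 (fun z _ => B n z) /\ forall z, Cmod z < / (2 * R1) -> serC (fun l => c n l * z ^ l)%C (B n z).
  by rewrite /B; case: constructive_indefinite_description.
have key z w : Cmod z < / (2 * R1) -> Cmod w < / (2 * R1) ->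
    (forall n, Cmod (B n z) <= 2 * M * R1 ^ n) /\ serC (fun n => B n z * w ^ n)%C (s z w).
  move=> hz hw; case: (ds_rows c M R1 w z _ HM HR Hc (sm z hz) (Hs w z (sm w hw) (sm z hz))) => b [Hb1 [Hb2 Hb3]].
  have E n : b n = B n z by apply: (serC_unique _ _ _ (Hb1 n)); exact: (proj2 (HB n)).
  split; first by move=> n; rewrite -E.
  apply: serC_ext Hb3 => n; by rewrite E.
exists B, (2 * M), R1, (/ (2 * R1)); split; first lra.
split=> //; split=> //; split; first by move=> n; case: (HB n).
split; last by move=> z w hz hw; case: (key z w hz hw).
by apply: (proj1 (key (RtoC 0) (RtoC 0) _ _)); rewrite Cmod_0.
Qed.

Lemma jet_split a k h w : a 0%nat = RtoC 0 -> a 1%nat = RtoC 1 -> (1 <= k)%nat ->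
  (forall m, (2 <= m <= k)%nat -> a m = RtoC 0) ->
  jet a (k + h + 2) w = (w + sum_n_m (fun m => a m * w ^ m)%C (k + 1) (k + h + 1))%C.
Proof.
move=> a0 a1 k1 ak.
have Ek : sum_n (fun m => a m * w ^ m)%C k = w.
  elim: k k1 ak => [|k IH] k1 ak; first lia.
  case: k IH k1 ak => [|k] IH k1 ak.
    rewrite csum_S sum_O a0 a1 /=; cring.
  rewrite csum_S IH; [|lia|by move=> m hm; apply: ak; lia].
  rewrite (ak (S (S k))); [cring|lia].
have -> : (k + h + 2 = S (k + h + 1))%nat by lia.
have -> : (k + 1 = S k)%nat by lia.
rewrite jet_sum sum_n_m_sum_n; last lia.
change (sum_n (fun m => a m * w ^ m)%C (k + h + 1) = (w + (sum_n (fun m => a m * w ^ m)%C (k + h + 1) - sum_n (fun m => a m * w ^ m)%C k))%C).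
rewrite Ek; cring.
Qed.

Theorem proposition2 :
  forall (lambda : C) (f : C -> C) (g : C -> C -> C),
    holomorphic_near (skew_product f g) origin ->
    (exists M : R, locally (RtoC 0) (fun z : C =>
       Cmod (f z - lambda * z)%C <= M * Cmod z ^ 2)) ->
    g (RtoC 0) (RtoC 0) = RtoC 0 ->
    is_derive (K := C_AbsRing) (V := C_NormedModule)
      (g (RtoC 0)) (RtoC 0) (RtoC 1) ->
    Brjuno lambda ->
    (locally (RtoC 0) (fun w : C => g (RtoC 0) w = w) ->
       linearizable (skew_product f g))
    /\
    (forall (a : nat -> C) (k : nat),
       power_series_at_0 (g (RtoC 0)) a ->
       (1 <= k)%nat ->
       (forall m : nat, (2 <= m <= k)%nat -> a m = RtoC 0) ->
       a (k + 1)%nat <> RtoC 0 ->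
       forall h : nat,
       exists (gt : C -> C -> C) (alpha : nat -> C -> C),
         locally_conjugate (skew_product f g)
           (skew_product (fun z : C => (lambda * z)%C) gt) /\
         (forall j : nat, (h <= j)%nat ->
            holomorphic_near (U := C_NormedModule) (V := C_NormedModule)
              (alpha (k + j + 2)%nat) (RtoC 0) /\
            alpha (k + j + 2)%nat (RtoC 0) = a (k + j + 2)%nat) /\
         locally origin (fun p : C * C =>
           let (z, w) := p in
           is_series (K := C_AbsRing) (V := C_NormedModule)
             (fun n : nat => let j := (h + n)%nat in
                (w ^ (k + j + 2) * alpha (k + j + 2)%nat z)%C)
             (gt z w -
               (w + sum_n_m (fun m : nat => (a m * w ^ m)%C)
                      (k + 1) (k + h + 1)))%C)).
Proof.
move=> lambda f g /hol_fst [Hf Hg] [M0 HM] g00 Hder HB.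
have e0 (x : C) : (x - 0 = x)%C by ring.
have Hf2 : near0 (fun z _ => Cmod (f z - lambda * z)%C <= M0 * Cmod z ^ 2).
  move/(locally_C1 (RtoC 0)): HM => [d [dp H]]; exists d; split=> // z w hz _.
  by apply: H; rewrite e0.
split.
- move=> /(locally_C1 (RtoC 0)) [d [dp Hid]].
  case: (linear_part lambda f g Hg M0 Hf2 Hder) => c Hc.
  exists (pmap (fun z _ => lambda * z)%C (fun z w => w + c * z)%C); split; first exact: Hc.
  apply: (neutral_fibre_linear lambda f g HB Hf Hg M0 Hf2).
  by exists d; split=> // z w _ hw; apply: Hid; rewrite e0.
- move=> a k Hps k1 ak _ h.
  case: (power_series_near _ _ Hps) => d [dp Hser].
  case: (series_coef_bound a _ d dp Hser) => M [R1 [Mp [R1p Hab]]].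
  have iR : 0 < / (2 * R1) by apply: Rinv_0_lt_compat; lra.
  have tail m w : Cmod w < d -> Cmod w < / (2 * R1) ->
      Cmod (g 0 w - jet a m w)%C <= 2 * (M * (2 * R1 * Cmod w) ^ m).
    move=> h1 h2; apply: series_tail => //; last exact: Hser.
    have := Rmult_le_compat_l (2 * R1) _ _ ltac:(lra) (Rlt_le _ _ h2); rewrite Rinv_r; lra.
  have Ha m : exists c, near0 (fun _ w => Cmod (g 0 w - jet a m w)%C <= c * Cmod w ^ m).
    exists (2 * (M * (2 * R1) ^ m)), (Rmin d (/ (2 * R1))); split; first exact: Rmin_pos.
    move=> z w _ hw; have m1 := Rmin_l d (/ (2 * R1)); have m2 := Rmin_r d (/ (2 * R1)).
    apply: Rle_trans (tail m w ltac:(lra) ltac:(lra)) _; rewrite Rpow_mult_distr; lra.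
  have a0 : a 0%nat = RtoC 0.
    case: (Ha 1%nat) => c /(near0_origin (fun _ w => _)).
    rewrite g00 Cmod_0 /= Rmult_0_l Rmult_0_r => h0.
    have /Cmod_eq_0 E : Cmod (0 - (0 + a 0%nat * 1))%C = 0.
      have := Cmod_ge_0 (0 - (0 + a 0%nat * 1))%C; lra.
    transitivity (- (0 - (0 + a 0%nat * 1)))%C; [ring|rewrite E; ring].
  have a1 : a 1%nat = RtoC 1.
    case: (Ha 2%nat) => c [d1 [dp1 Hc]].
    have : (a 1%nat - 1)%C = RtoC 0; last by move=> E; transitivity (a 1%nat - 1 + 1)%C; [ring|rewrite E; ring].
    apply: Cmod_eq_0; apply: Rle_antisym; last exact: Cmod_ge_0.
    apply: le_epsilon => eps He; rewrite Rplus_0_l.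
    case: (derive_eps _ _ Hder (eps / 2) ltac:(lra)) => d2 [dp2 H2].
    have cp := Rabs_pos c.
    have e1 : 0 < eps / 2 / (Rabs c + 1) by apply: Rdiv_lt_0_compat; lra.
    pose t := Rmin (Rmin (d1 / 2) (d2 / 2)) (eps / 2 / (Rabs c + 1)).
    have tp : 0 < t by apply: Rmin_pos => //; apply: Rmin_pos; lra.
    have t1 : t <= d1 / 2 by apply: Rle_trans (Rmin_l _ _) (Rmin_l _ _).
    have t2 : t <= d2 / 2 by apply: Rle_trans (Rmin_l _ _) (Rmin_r _ _).
    have t3 : t <= eps / 2 / (Rabs c + 1) by exact: Rmin_r.
    have ct : Cmod (RtoC t) = t by rewrite Cmod_R Rabs_right; lra.
    have := H2 (RtoC t) ltac:(rewrite ct; lra); rewrite ct g00.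
    have := Hc (RtoC 0) (RtoC t) ltac:(rewrite Cmod_0; lra) ltac:(rewrite ct; lra); rewrite ct.
    have -> : jet a 2 t = (a 1%nat * t)%C by rewrite /= a0; ring.
    move=> h1 h2.
    have h3 : Rabs c * t <= eps / 2.
      have := Rmult_le_compat_l (Rabs c + 1) _ _ ltac:(lra) t3.
      have -> : (Rabs c + 1) * (eps / 2 / (Rabs c + 1)) = eps / 2 by field; lra.
      lra.
    apply: (Rmult_le_reg_r t) => //.
    have -> : Cmod (a 1%nat - 1)%C * t = Cmod ((a 1%nat - 1) * t)%C by rewrite Cmod_mult ct.
    have -> : ((a 1%nat - 1) * t = (g 0 t - 0 - t * 1) + - (g 0 t - a 1%nat * t))%C by ring.
    apply: Rle_trans (Cmod_triangle _ _) _; rewrite Cmod_opp.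
    have h4 := Rmult_le_compat_r (t ^ 2) _ _ ltac:(apply: pow_le; lra) (Rle_abs c).
    have h5 := Rmult_le_compat_r t _ _ ltac:(lra) h3.
    rewrite /= in h1 h4; lra.
  case: (base_linearization lambda f HB Hf M0 Hf2) => y [Hy [y0 Ey]].
  (* A jet of order [m] stops at degree [m - 1 = k + h + 1], the last prescribed coefficient. *)
  set m := (k + h + 2)%nat.
  case: (jet_normal_form lambda g HB Hg g00 a a0 a1 Ha y m Hy) => v [gt [Hv [v0 [G E]]]].
  case: (G) => Hgt [gt0 [Eg [c Hc]]].
  case: (jet_quotient gt a m c Hgt Hc) => s [Hs Es].
  case: (fibre_expansion s Hs) => B [M' [R' [d' [Mp' [Rp' [dp' [HBh [HBb HBs]]]]]]]].
  (* The quotient of [gt] minus its jet by [w^m] has coefficients indexed from 0, so [alpha i] is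
     the one of index [i - m]. *)
  exists gt, (fun i => B (i - m)%nat); split.
    exact: (conjugacy lambda f g y v gt Hy y0 Ey Hv v0 Hgt gt0 E).
  split.
  + move=> j hj; split; first exact: hol_1var.
    (* Coefficients of the difference between two expansions of [g 0]: the given one, and the jet
       plus [w^m s(0, w)]. Its sum is 0 near the origin, so [coef_zero] with bound 0 kills every
       coefficient up to the wanted index. *)
    pose e n := (a n - (if Nat.ltb n m then a n else B (n - m)%nat 0))%C.
    (* A common growth rate for both expansions, at least 1 so that the shifted exponent [n - m] may
       be replaced by [n]. *)
    pose R2 := R1 + R' + 1.
    have p2 n : R1 ^ n <= R2 ^ n by apply: pow_incr; rewrite /R2; lra.
    have : e (k + j + 2)%nat = RtoC 0; last first.
      rewrite /e; have -> : Nat.ltb (k + j + 2) m = false by apply/Nat.ltb_ge; rewrite /m; lia.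
      move=> he; transitivity (a (k + j + 2)%nat - (a (k + j + 2)%nat - B (k + j + 2 - m)%nat 0))%C; [ring|rewrite he; ring].
    case: Eg => d1 [dp1 Eg]; case: Es => d2 [dp2 Es].
    pose d3 := Rmin (Rmin d d') (Rmin d1 d2).
    have m1 : d3 <= d by apply: Rle_trans (Rmin_l _ _) (Rmin_l _ _).
    have m2 : d3 <= d' by apply: Rle_trans (Rmin_l _ _) (Rmin_r _ _).
    have m3 : d3 <= d1 by apply: Rle_trans (Rmin_r _ _) (Rmin_l _ _).
    have m4 : d3 <= d2 by apply: Rle_trans (Rmin_r _ _) (Rmin_r _ _).
    apply: (coef_zero e (M + M') R2 d3 0 (S (k + j + 2))) => //; try lra.
    * by rewrite /R2; lra.
    * move=> n; rewrite /e; have Rn : 0 <= R2 ^ n by apply: pow_le; rewrite /R2; lra.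
      have P1 := Rmult_le_compat_l _ _ _ Mp (p2 n). have P2 := Rmult_le_pos _ _ Mp' Rn.
      have P3 := Rmult_le_pos _ _ Mp Rn.
      case: (Nat.ltb_spec n m) => nm.
        have -> : (a n - a n = 0)%C by ring. rewrite Cmod_0; lra.
      apply: Rle_trans (Cmod_triangle _ _) _; rewrite Cmod_opp.
      have h1 := HBb (n - m)%nat.
      have h2 : R' ^ (n - m) <= R2 ^ n.
        apply: Rle_trans (_ : R2 ^ (n - m) <= _); first by apply: pow_incr; rewrite /R2; lra.
        apply: Rle_pow; [rewrite /R2; lra|lia].
      have := Rmult_le_compat_l _ _ _ Mp' h2; have := Hab n; lra.
    * apply: Rmin_pos; exact: Rmin_pos.
    * move=> w hw; exists (RtoC 0); rewrite Cmod_0; split; last by rewrite Rmult_0_l; lra.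
      have z0 : Cmod 0 < d3 by rewrite Cmod_0; have := Cmod_ge_0 w; lra.
      have S1 := Hser w ltac:(lra).
      have S2 := jet_series a m w.
      have S3 := serC_shiftn m _ _ (serC_scal (w ^ m)%C _ _ (HBs 0 w ltac:(lra) ltac:(lra))).
      have S4 := serC_plus _ _ _ _ S1 (serC_scal (-1)%C _ _ (serC_plus _ _ _ _ S2 S3)).
      have E0 : (g 0 w + -1 * (jet a m w + w ^ m * s 0 w) = 0)%C.
        rewrite -(Eg 0 w) ?(Es 0 w) //; [ring|lra..].
      rewrite E0 in S4; apply: serC_ext S4 => n; rewrite /e.
      case: (Nat.ltb_spec n m) => nm; first by ring.
      have -> : (w ^ n = w ^ m * w ^ (n - m))%C by rewrite -Cpow_add_r; congr Cpow; lia.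
      ring.
  + have N : near0 (fun z w => gt z w = (jet a m w + w ^ m * s z w)%C /\ serC (fun n => B n z * w ^ n)%C (s z w)).
      by apply: near0_and => //; exists d'.
    move/near0_locally: N; apply: loc_imp => -[z w] /= [E1 E2].
    rewrite -(jet_split a k h w a0 a1 k1 ak) -/m E1.
    have -> : (jet a m w + w ^ m * s z w - jet a m w = w ^ m * s z w)%C by ring.
    apply: serC_ext (serC_scal (w ^ m)%C _ _ E2) => n.
    have -> : (k + (h + n) + 2 - m = n)%nat by rewrite /m; lia.
    have -> : (k + (h + n) + 2 = m + n)%nat by rewrite /m; lia.
    rewrite Cpow_add_r; ring.
Qed.
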